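(* Fix $m>0$ and $N>0$, and consider $c$ with $0<N^{2/3}<cN_*^{2/3}$. (i) For each such $c$ let $\rho_c$ be a nonnegative minimizer of $E_c(N)$, and let $\rho_\infty$ be a nonnegative minimizer of $E_\infty(N)$. Then $$0\le\int_{\mathbb{R}^3}\rho_c(x)^{5/3}\,dx-\int_{\mathbb{R}^3}\rho_\infty(x)^{5/3}\,dx=O\Big(\frac1{c^2}\Big)\quad\text{as }c\to\infty.$$ (ii) Let $R_c$ denote the radius of the compact support of $\rho_c$ and $R_\infty$ the radius of the compact support of $\rho_\infty$. Then $$0\le R_\infty-R_c=O\Big(\frac1{c^2}\Big)\quad\text{as }c\to\infty.$$ Here $f(c)=O(1/c^2)$ is understood in the two-sided sense: there exist constants $K_1,K_2>0$ independent of $c$ such that $\frac{K_1}{c^2}\le f(c)\le\frac{K_2}{c^2}$ for all sufficiently large $c$.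
   Context: Fix constants $\kappa>0$ and $q\ge 1$. For a density $\rho\ge 0$ on $\mathbb{R}^3$ put $$j_{mc}(\rho(x))=\frac{q}{8\pi^3}\int_{|p|<(6\pi^2\rho(x)/q)^{1/3}}\left(\sqrt{c^2|p|^2+m^2c^4}-mc^2\right)dp,\qquad D(\rho,\rho)=\frac12\int_{\mathbb{R}^3}\int_{\mathbb{R}^3}\frac{\rho(x)\rho(y)}{|x-y|}\,dxdy,$$ $$j_\infty(\rho(x))=\frac{q}{8\pi^3}\int_{|p|<(6\pi^2\rho(x)/q)^{1/3}}\frac{|p|^2}{2m}\,dp=\frac{3}{10m}\Big(\frac{6\pi^2}{q}\Big)^{2/3}\rho(x)^{5/3},$$ where $p\in\mathbb{R}^3$. Define $\mathcal{E}_c(\rho)=\int_{\mathbb{R}^3}j_{mc}(\rho(x))\,dx-\kappa D(\rho,\rho)$ and $\mathcal{E}_\infty(\rho)=\int_{\mathbb{R}^3}j_\infty(\rho(x))\,dx-\kappa D(\rho,\rho)$, and $$E_c(N)=\inf\Big\{\mathcal{E}_c(\rho):0\le\rho\in L^1\cap L^{4/3}(\mathbb{R}^3),\ \int_{\mathbb{R}^3}\rho\,dx=N\Big\},$$ $$E_\infty(N)=\inf\Big\{\mathcal{E}_\infty(\rho):0\le\rho\in L^1\cap L^{5/3}(\mathbb{R}^3),\ \int_{\mathbb{R}^3}\rho\,dx=N\Big\}.$$ A minimizer of $E_c(N)$ (resp. $E_\infty(N)$) is an admissible $\rho$ attaining the infimum. The constant $N_*>0$ is the optimal (largest) constant such that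 $$\kappa N_*^{2/3}D(\rho,\rho)\le K_{cl}\|\rho\|_{L^{4/3}}^{4/3}\|\rho\|_{L^1}^{2/3}\quad\text{for all }0\le\rho\in L^1\cap L^{4/3}(\mathbb{R}^3),\qquad K_{cl}=\frac34\Big(\frac{6\pi^2}{q}\Big)^{1/3}.$$ When speaking of the radius of the support (part (ii)), the minimizers are taken to be symmetric decreasing (radial about the origin and nonincreasing in $|x|$) with compact support, so that the support is a closed ball centered at the origin, whose radius is $R_c$, resp. $R_\infty$. *)

(* Defs.v *)
From mathcomp Require Import all_boot all_order all_algebra.
From mathcomp Require Import all_classical all_reals all_analysis.

Set Implicit Arguments.
Unset Strict Implicit.
Unset Printing Implicit Defensive.

Import Order.TTheory GRing.Theory Num.Theory.
Import numFieldNormedType.Exports.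

Local Open Scope classical_set_scope.
Local Open Scope ring_scope.

(* [measurableTypeR R] is [R] with its Borel sigma-algebra. *)
Notation "''R3' R" :=
  (measurableTypeR R * measurableTypeR R * measurableTypeR R)%type
  (at level 8, R at level 2).

Definition leb3 (R : realType) : {measure set ('R3 R) -> \bar R} :=
  ((@lebesgue_measure R \x @lebesgue_measure R) \x @lebesgue_measure R)%E.

(* The library's norm on a product type is the sup norm. *)
Definition eucl_norm (R : realType) (x : 'R3 R) : R :=
  Num.sqrt ((x.1.1 : R) ^+ 2 + (x.1.2 : R) ^+ 2 + (x.2 : R) ^+ 2).

Definition eucl_dist (R : realType) (x y : 'R3 R) : R :=
  Num.sqrt (((x.1.1 : R) - (y.1.1 : R)) ^+ 2
            + ((x.1.2 : R) - (y.1.2 : R)) ^+ 2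
            + ((x.2 : R) - (y.2 : R)) ^+ 2).

Definition T_rel (R : realType) (m c : R) (p : 'R3 R) : R :=
  Num.sqrt (c ^+ 2 * eucl_norm p ^+ 2 + m ^+ 2 * c ^+ 4) - m * c ^+ 2.

Definition T_nonrel (R : realType) (m : R) (p : 'R3 R) : R :=
  eucl_norm p ^+ 2 / (2 * m).

Definition fermi_momentum (R : realType) (q t : R) : R :=
  (6 * pi ^+ 2 * t / q) `^ 3^-1.

Definition fermi_kinetic (R : realType) (q : R) (T : 'R3 R -> R) (t : R) : R :=
  q / (8 * pi ^+ 3)
  * \int[@leb3 R]_(p in [set p | eucl_norm p < fermi_momentum q t]) T p.

Definition j_mc (R : realType) (q m c : R) : R -> R :=
  fermi_kinetic q (T_rel m c).

Definition j_oo (R : realType) (q m : R) : R -> R :=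
  fermi_kinetic q (T_nonrel m).

(* On the null set [x = y] the integrand is 0, since [0^-1 = 0]. *)
Definition coulomb (R : realType) (rho : 'R3 R -> R) : \bar R :=
  ((2^-1)%:E * \int[@leb3 R]_x \int[@leb3 R]_y
    (rho x * rho y / eucl_dist x y)%:E)%E.

Definition energy (R : realType) (kappa : R) (j : R -> R) (rho : 'R3 R -> R) :
    \bar R :=
  (\int[@leb3 R]_x (j (rho x))%:E - kappa%:E * coulomb rho)%E.

Definition density (R : realType) (p : R) (rho : 'R3 R -> R) : Prop :=
  [/\ forall x, 0 <= rho x,
      rho \in Lfun (@leb3 R) 1%E
    & rho \in Lfun (@leb3 R) p%:E].

Definition admissible (R : realType) (p N : R) (rho : 'R3 R -> R) : Prop :=
  density p rho /\ (\int[@leb3 R]_x (rho x)%:E = N%:E)%E.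

Definition E_c (R : realType) (kappa q m c N : R) : \bar R :=
  ereal_inf [set energy kappa (j_mc q m c) rho | rho in admissible (4 / 3) N].

Definition E_oo (R : realType) (kappa q m N : R) : \bar R :=
  ereal_inf [set energy kappa (j_oo q m) rho | rho in admissible (5 / 3) N].

Definition minimizer_c (R : realType) (kappa q m c N : R) (rho : 'R3 R -> R) :=
  admissible (4 / 3) N rho
  /\ energy kappa (j_mc q m c) rho = E_c kappa q m c N.

Definition minimizer_oo (R : realType) (kappa q m N : R) (rho : 'R3 R -> R) :=
  admissible (5 / 3) N rho
  /\ energy kappa (j_oo q m) rho = E_oo kappa q m N.

Definition K_cl (R : realType) (q : R) : R :=
  3 / 4 * (6 * pi ^+ 2 / q) `^ 3^-1.

Definition interpolation_ineq (R : realType) (kappa q M : R) : Prop :=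
  forall rho : 'R3 R -> R, density (4 / 3) rho ->
  ((kappa * M `^ (2 / 3))%:E * coulomb rho <=
   (K_cl q)%:E * 'N[@leb3 R]_((4 / 3)%:E)[EFin \o rho] `^ (4 / 3)
               * 'N[@leb3 R]_1[EFin \o rho] `^ (2 / 3))%E.

Definition optimal_constant (R : realType) (kappa q Nstar : R) : Prop :=
  [/\ 0 < Nstar,
      interpolation_ineq kappa q Nstar
    & forall M, 0 < M -> interpolation_ineq kappa q M -> M <= Nstar].

Definition symmetric_decreasing (R : realType) (rho : 'R3 R -> R) : Prop :=
  forall x y, eucl_norm x <= eucl_norm y -> rho y <= rho x.

(* Topological support. The annotation [R * R * R] selects the usual (product)
   topology. *)
Definition supp (R : realType) (rho : 'R3 R -> R) : set (R * R * R) :=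
  closure [set x : R * R * R | rho x != 0].

Definition has_support_radius (R : realType) (rho : 'R3 R -> R) (r : R) : Prop :=
  compact (supp rho) /\ supp rho = [set x | @eucl_norm R x <= r].

Definition two_sided_O_inv_sqr (R : realType) (f : R -> \bar R) : Prop :=
  exists K1 K2 : R, [/\ 0 < K1, 0 < K2
    & \forall c \near +oo, ((K1 / c ^+ 2)%:E <= f c <= (K2 / c ^+ 2)%:E)%E].

(* Main.v *)
From HB Require Import structures.
Require Import Defs.
From mathcomp Require Import all_boot all_order all_algebra.
From mathcomp Require Import all_classical all_reals all_analysis.
From mathcomp Require Import measurable_realfun.
From mathcomp Require Import ring lra.
Set Implicit Arguments.
Unset Strict Implicit.
Unset Printing Implicit Defensive.
Import Order.TTheory GRing.Theory Num.Theory.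
Import numFieldNormedType.Exports.
Local Open Scope classical_set_scope.
Local Open Scope ring_scope.

(** Put [nu = 1 / c ^ 2]. The relativistic kinetic energy of a particle is then
    [T = |p| ^ 2 / (root + m)] with [root ^ 2 = nu * |p| ^ 2 + m ^ 2], which makes
    sense at [nu = 0], where it is the classical energy; [P = p . grad T] is
    [|p| ^ 2 / root]. For a density [rho] write T, P, D for the integrals of the
    two energy densities [jnu] and [vnu] of [rho] and for its Coulomb form, and J
    for T at [nu = 0], a multiple of the integral of [rho ^ (5 / 3)].

    Virial theorem ([virial]). A minimizer is stationary under dilations that
    preserve the mass, whence [kappa * D = 2 * P], and the minimal energy is [T - P],
    which is nonpositive. At [nu = 0], where [P = 2 * J], it is [- J].

    Part (i). As [T] decreases with [nu], the minimal energy is not larger than at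
    [nu = 0]: the value J_oo of J at the classical minimizer is at most [P - T]. Now
    [P - T <= J] already for the energies of one particle, and the difference, like
    [J - T] and [2 * T - P], is of order [nu * |p| ^ 4]. Hence [J - J_oo] is
    nonnegative and at least the integral of such a gap, which is bounded below by
    a multiple of [nu], since [|p| ^ 4 >= 2 * d * |p| ^ 2 - d ^ 2] makes it linear in
    J and in the mass ([kin_gaps_lower]). The relativistic minimizer is also a
    competitor for the classical problem, which gives [J_oo >= P - J] and with the
    upper bounds of the gaps ([kin_gaps_upper]) the upper bound of [J - J_oo].

    The constants are uniform in [c] because the minimizers are bounded by a
    constant which does not depend on [c]. Removing mass from a minimizer and
    dilating the rest to the original mass cannot lower a nonpositive energy, so
    [jnu rho <= kappa * rho * V] almost everywhere, [V] being the potential of [rho]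
    ([ae_kinetic_le_potential]). As [jnu t] is at least of order [t ^ (4 / 3)], the
    cube root of [rho] is at most [B * (1 + V)], and a bound on the norm of [rho] in
    [L ^ (4 / 3)], which the inequality defining [Nstar] provides for large [c],
    turns into a bound on [V] ([potential_bootstrap]) and then on [rho].

    Part (ii). If the support of a symmetric decreasing minimizer is the ball of
    radius Rad then, by Newton's theorem ([potential_axis]), [V] is [N / Rad] on the
    boundary, and it is continuous there, as [rho] is bounded
    ([potential_unif_cont]). Moving a little mass to a small ball just outside of
    the boundary, or away from one just inside of it, changes the energy to first
    order by two opposite amounts, which must vanish: this gives
    [kappa * N ^ 2 / Rad = (5 / 3) * P - T] ([boundary_identity]). At [nu = 0] the
    right-hand side is [(7 / 3) * J_oo], while
    [(5 / 3) * P - T - (7 / 3) * (P - T) = (2 / 3) * (2 * T - P)] is a nonnegative gap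
    again. So the difference of the inverse radii is nonnegative and bounded from
    both sides by multiples of [nu] ([comparison_two_sided]), and so is the
    difference of the radii. *)

(** * Lebesgue measure on R^3 *)
Section lebesgue3.
Variable R : realType.
Implicit Types a : R.
Local Notation leb := (@lebesgue_measure R).
Local Open Scope ereal_scope.

Lemma measurable_affine a (b : R) :
  measurable_fun setT ((fun t => a * t + b)%R : measurableTypeR R -> measurableTypeR R).
Proof. by apply: measurable_funD => //; exact: mulrl_measurable. Qed.

(** By uniqueness of Lebesgue measure, tested on half-open intervals; the sign of
    [a] decides at which end an interval is open after the change of variables. *)
Lemma lebesgue_affine a (b : R) (f : measurableTypeR R -> \bar R) : (a != 0)%R ->
  measurable_fun setT f -> (forall t, 0 <= f t) ->
  \int[leb]_t f (a * t + b)%R = `|a|^-1%:E * \int[leb]_t f t.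
Proof.
move=> a0 mf f0.
pose phi (t : measurableTypeR R) : measurableTypeR R := (a * t + b)%R.
have mphi : measurable_fun setT phi by exact: measurable_affine.
transitivity (\int[pushforward leb phi]_t f t).
  by rewrite (ge0_integral_pushforward mphi).
have a0' : (0 <= `|a|)%R by [].
have E A : measurable A -> leb A = mscale (NngNum a0') (pushforward leb phi) A.
  apply: lebesgue_measure_unique => // _ [[u v]] _ <-.
  rewrite -[RHS]/(`|a|%:E * leb (phi @^-1` `]u, v])) lebesgue_measure_itv.
  rewrite [X in X = _]/= lte_fin.
  have [a_gt0|] := ltP 0%R a.
    have -> : phi @^-1` `]u, v] = `]((u - b) / a)%R, ((v - b) / a)%R]%classic.
      apply/seteqP; split => t /=; rewrite !in_itv/= /phi => /andP[];
        by rewrite ?ltr_pdivrMr ?ler_pdivlMr// ?ltr_pdivlMr ?ler_pdivrMr//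
          => ? ?; apply/andP; split; lra.
    rewrite lebesgue_measure_itv/= lte_fin ltr_pM2r ?invr_gt0//.
    rewrite ltrD2r; case: ifPn => uv; last by rewrite mule0.
    by rewrite -!EFinB -EFinM gtr0_norm//; congr EFin; field.
  rewrite le_eqVlt (negbTE a0)/= => a_lt0.
  have -> : phi @^-1` `]u, v] = `[((v - b) / a)%R, ((u - b) / a)%R[%classic.
    apply/seteqP; split => t /=; rewrite !in_itv/= /phi => /andP[];
      by rewrite ?ltr_ndivrMr ?ler_ndivlMr// ?ltr_ndivlMr ?ler_ndivrMr//
        => ? ?; apply/andP; split; lra.
  rewrite lebesgue_measure_itv/= lte_fin ltr_nM2r ?invr_lt0//.
  rewrite ltrD2r; case: ifPn => uv; last by rewrite mule0.
  by rewrite -!EFinB -EFinM ltr0_norm//; congr EFin; field.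
rewrite [\int[leb]_t f t](_ : _ = `|a|%:E * \int[pushforward leb phi]_t f t).
  by rewrite muleA -EFinM mulVf ?mul1e// normr_eq0.
rewrite -(ge0_integral_mscale _ measurableT (NngNum a0'))//.
by apply: eq_measure_integral => A mA _; exact: E.
Qed.

Lemma measurable_x1 : measurable_fun setT (fun x : 'R3 R => x.1.1).
Proof. exact: measurableT_comp. Qed.

Lemma measurable_x2 : measurable_fun setT (fun x : 'R3 R => x.1.2).
Proof. exact: measurableT_comp. Qed.

Lemma measurable_x3 : measurable_fun setT (fun x : 'R3 R => x.2).
Proof. exact: measurable_snd. Qed.

(** The two products below carry the sigma-finite structure that Tonelli's
    theorem asks for; as set functions they are the Lebesgue measures of the
    plane and of space. *)
Definition leb2 : set (measurableTypeR R * measurableTypeR R)%type -> \bar R :=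
  (leb \x leb)%E.
HB.instance Definition _ := Measure.on leb2.
Lemma leb2_sigma_finite : sigma_finite setT leb2.
Proof.
have := lebesgue_integral_fubini.measure_function_Measure_isSigmaFinite__to__measure_function_isSigmaFinite leb leb.
by case.
Qed.
HB.instance Definition _ :=
  @Measure_isSigmaFinite.Build _ _ _ leb2 leb2_sigma_finite.

Definition lebR3 : set ('R3 R) -> \bar R := (leb2 \x leb)%E.
HB.instance Definition _ := Measure.on lebR3.
Lemma lebR3_sigma_finite : sigma_finite setT lebR3.
Proof.
have := lebesgue_integral_fubini.measure_function_Measure_isSigmaFinite__to__measure_function_isSigmaFinite leb2 leb.
by case.
Qed.
HB.instance Definition _ :=
  @Measure_isSigmaFinite.Build _ _ _ lebR3 lebR3_sigma_finite.

Lemma leb3E (A : set ('R3 R)) : @leb3 R A = lebR3 A.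
Proof. by []. Qed.

Lemma integral_leb3E (f : 'R3 R -> \bar R) :
  \int[@leb3 R]_x f x = \int[lebR3]_x f x.
Proof. by apply: eq_measure_integral => A _ _; exact: leb3E. Qed.

Lemma leb3_tonelli (f : 'R3 R -> \bar R) :
  measurable_fun setT f -> (forall x, 0 <= f x) ->
  \int[@leb3 R]_x f x = \int[leb]_u \int[leb]_v \int[leb]_w f ((u, v), w).
Proof.
move=> mf f0; rewrite integral_leb3E.
have mF := measurable_fun_fubini_tonelli_F (m2 := leb) f mf f0.
have F0 p : 0 <= fubini_F leb f p by exact: integral_ge0.
rewrite (fubini_tonelli1 (m1 := leb2) (m2 := leb) f mf f0).
by rewrite (fubini_tonelli1 (m1 := leb) (m2 := leb) (fubini_F leb f) mF F0).
Qed.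

Definition affine3 a (b x : 'R3 R) : 'R3 R :=
  ((a * x.1.1 + b.1.1, a * x.1.2 + b.1.2), a * x.2 + b.2)%R.

Lemma measurable_affine3 a (b : 'R3 R) : measurable_fun setT (affine3 a b).
Proof.
apply/measurable_fun_pairP; split; first apply/measurable_fun_pairP; first split.
- apply: measurable_funD => //; apply: measurable_funM => //.
  exact: measurable_x1.
- apply: measurable_funD => //; apply: measurable_funM => //.
  exact: measurable_x2.
- apply: measurable_funD => //; apply: measurable_funM => //.
Qed.

Lemma leb3_affine a (b : 'R3 R) (f : 'R3 R -> \bar R) : (a != 0)%R ->
  measurable_fun setT f -> (forall x, 0 <= f x) ->
  \int[@leb3 R]_x f (affine3 a b x) = (`|a| ^- 3)%:E * \int[@leb3 R]_x f x.
Proof.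
move=> a0 mf f0.
have mF : measurable_fun setT (fun x => f (affine3 a b x)).
  by apply: measurableT_comp => //; exact: measurable_affine3.
rewrite leb3_tonelli// leb3_tonelli//.
have m3 u v : measurable_fun setT (fun w => f (u, v, w)).
  exact: measurableT_comp.
have mg : measurable_fun setT (fun p => \int[leb]_w f (p, w)).
  exact: measurable_fun_fubini_tonelli_F.
have g0 p : 0 <= \int[leb]_w f (p, w) by exact: integral_ge0.
have m2 u : measurable_fun setT (fun v => \int[leb]_w f (u, v, w)).
  exact: measurableT_comp mg _.
have p2 u v : 0 <= \int[leb]_w f (u, v, w) by exact: integral_ge0.
have m1 : measurable_fun setT (fun u => \int[leb]_v \int[leb]_w f (u, v, w)).
  exact: (measurable_fun_fubini_tonelli_F (fun p : (measurableTypeR R * measurableTypeR R)%type => \int[leb]_w f (p, w)) mg g0).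
have p1 u : 0 <= \int[leb]_v \int[leb]_w f (u, v, w) by exact: integral_ge0.
have ia : 0 <= (`|a|^-1)%:E by rewrite lee_fin invr_ge0.
transitivity (\int[leb]_u (`|a|^-1%:E * (`|a|^-1%:E *
    \int[leb]_v \int[leb]_w f (a * u + b.1.1, v, w)%R))).
  apply: eq_integral => u _.
  rewrite -(lebesgue_affine b.1.2 a0 (m2 _) (p2 _)).
  rewrite -ge0_integralZl//; last first.
    exact: (measurableT_comp (m2 _) (measurable_affine a b.1.2)).
  apply: eq_integral => v _.
  by rewrite -(lebesgue_affine b.2 a0 (m3 _ _)).
rewrite (lebesgue_affine b.1.1 a0
  (f := fun u => `|a|^-1%:E * (`|a|^-1%:E * \int[leb]_v \int[leb]_w f (u, v, w)))).
- rewrite ge0_integralZl//; last 2 first.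
    exact: measurable_funeM.
    by move=> u _; rewrite mule_ge0.
  rewrite ge0_integralZl// !muleA -!EFinM; congr (EFin _ * _).
  by rewrite -!invfM !exprS expr0 mulr1 mulrA.
- by apply: measurable_funeM; apply: measurable_funeM.
- by move=> t; rewrite !mule_ge0.
Qed.
End lebesgue3.

(** * The Euclidean norm and its balls *)
Section measurable_sets.
Context d (T : measurableType d) (R : realType).
Implicit Types f g : T -> R.

Lemma measurable_set_lt f g : measurable_fun setT f -> measurable_fun setT g ->
  measurable [set x | f x < g x].
Proof.
move=> mf mg; have := measurable_fun_ltr mf mg measurableT (Y := [set true]) I.
by rewrite setTI; congr measurable; apply/seteqP; split=> x /=.
Qed.

Lemma measurable_set_le f g : measurable_fun setT f -> measurable_fun setT g ->
  measurable [set x | f x <= g x].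
Proof.
move=> mf mg; have := measurable_fun_ler mf mg measurableT (Y := [set true]) I.
by rewrite setTI; congr measurable; apply/seteqP; split=> x /=.
Qed.

End measurable_sets.

Lemma measurable_sqrtr (R : realType) : measurable_fun setT (@Num.sqrt R).
Proof. by apply: continuous_measurable_fun; exact: sqrt_continuous. Qed.

Section norm3.
Variable R : realType.
Implicit Types (x y z : 'R3 R) (a : R).

Lemma measurable_eucl_norm : measurable_fun setT (@eucl_norm R).
Proof.
apply: measurableT_comp; first exact: measurable_sqrtr.
apply: measurable_funD; first apply: measurable_funD; apply: measurable_funX.
- exact: measurable_x1.
- exact: measurable_x2.
- exact: measurable_x3.
Qed.

Lemma eucl_norm_ge0 x : 0 <= eucl_norm x.
Proof. exact: sqrtr_ge0. Qed.

Lemma eucl_norm_sqr x : eucl_norm x ^+ 2 = x.1.1 ^+ 2 + x.1.2 ^+ 2 + x.2 ^+ 2.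
Proof. by rewrite sqr_sqrtr// !addr_ge0// sqr_ge0. Qed.

Lemma eucl_distE x y : eucl_dist x y = eucl_norm (affine3 (- 1) x y).
Proof. by rewrite /eucl_dist /eucl_norm /affine3/=; congr Num.sqrt; ring. Qed.

Lemma eucl_distC x y : eucl_dist x y = eucl_dist y x.
Proof. by rewrite /eucl_dist; congr Num.sqrt; ring. Qed.

Lemma eucl_dist_ge0 x y : 0 <= eucl_dist x y.
Proof. exact: sqrtr_ge0. Qed.

Lemma eucl_norm_scale a x : eucl_norm (affine3 a (0, 0, 0) x) = `|a| * eucl_norm x.
Proof.
rewrite /eucl_norm /affine3/= -(sqrtr_sqr a) -sqrtrM ?sqr_ge0//.
by congr Num.sqrt; ring.
Qed.

Lemma eucl_dist_scale a x y :
  eucl_dist (affine3 a (0, 0, 0) x) (affine3 a (0, 0, 0) y) = `|a| * eucl_dist x y.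
Proof.
rewrite /eucl_dist /affine3/= -(sqrtr_sqr a) -sqrtrM ?sqr_ge0//.
by congr Num.sqrt; ring.
Qed.

Lemma eucl_dist_triangle x y z : eucl_dist x z <= eucl_dist x y + eucl_dist y z.
Proof.
rewrite -(@ler_pXn2r _ 2) ?nnegrE ?addr_ge0 ?eucl_dist_ge0// sqrrD.
rewrite /eucl_dist.
set a1 := x.1.1 - y.1.1; set a2 := x.1.2 - y.1.2; set a3 := x.2 - y.2.
set b1 := y.1.1 - z.1.1; set b2 := y.1.2 - z.1.2; set b3 := y.2 - z.2.
have A0 : 0 <= a1 ^+ 2 + a2 ^+ 2 + a3 ^+ 2 by rewrite !addr_ge0// sqr_ge0.
have B0 : 0 <= b1 ^+ 2 + b2 ^+ 2 + b3 ^+ 2 by rewrite !addr_ge0// sqr_ge0.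
rewrite !sqr_sqrtr//; last by rewrite !addr_ge0// sqr_ge0.
have -> : x.1.1 - z.1.1 = a1 + b1 by rewrite /a1 /b1; ring.
have -> : x.1.2 - z.1.2 = a2 + b2 by rewrite /a2 /b2; ring.
have -> : x.2 - z.2 = a3 + b3 by rewrite /a3 /b3; ring.
rewrite -sqrtrM//.
suff H : a1 * b1 + a2 * b2 + a3 * b3 <=
  Num.sqrt ((a1 ^+ 2 + a2 ^+ 2 + a3 ^+ 2) * (b1 ^+ 2 + b2 ^+ 2 + b3 ^+ 2)) by lra.
apply: le_trans (ler_norm _) _; rewrite -sqrtr_sqr ler_wsqrtr//.
(* Lagrange's identity *)
rewrite -subr_ge0 [leRHS](_ : _ = (a1 * b2 - a2 * b1) ^+ 2 +
  (a1 * b3 - a3 * b1) ^+ 2 + (a2 * b3 - a3 * b2) ^+ 2); last by ring.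
by rewrite !addr_ge0// sqr_ge0.
Qed.

Lemma eucl_dist0 x : eucl_dist x (0, 0, 0) = eucl_norm x.
Proof. by rewrite /eucl_dist /= !subr0. Qed.

Lemma measurable_eucl_dist2 :
  measurable_fun setT (fun p : 'R3 R * 'R3 R => eucl_dist p.1 p.2).
Proof.
apply: measurableT_comp; first exact: measurable_sqrtr.
have m1 : measurable_fun setT (@fst ('R3 R) ('R3 R)) by exact: measurable_fst.
have m2 : measurable_fun setT (@snd ('R3 R) ('R3 R)) by exact: measurable_snd.
apply: measurable_funD; first apply: measurable_funD; apply: measurable_funX;
  apply: measurable_funB.
- exact: measurableT_comp (@measurable_x1 R) m1.
- exact: measurableT_comp (@measurable_x1 R) m2.
- exact: measurableT_comp (@measurable_x2 R) m1.
- exact: measurableT_comp (@measurable_x2 R) m2.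
- exact: measurableT_comp (@measurable_x3 R) m1.
- exact: measurableT_comp (@measurable_x3 R) m2.
Qed.

Lemma measurable_eucl_dist x : measurable_fun setT (eucl_dist x).
Proof. exact: (measurableT_comp measurable_eucl_dist2 (measurable_pair1 x)). Qed.

Definition oball (r : R) : set ('R3 R) := [set x | eucl_norm x < r].

Lemma measurable_oball r : measurable (oball r).
Proof. by apply: measurable_set_lt => //; exact: measurable_eucl_norm. Qed.

Local Notation leb := (@lebesgue_measure R).

Lemma leb3_box (A B C : set (measurableTypeR R)) : measurable A -> measurable B -> measurable C ->
  @leb3 R ((A `*` B) `*` C) = (leb A * leb B * leb C)%E.
Proof.
move=> mA mB mC; have mAB : measurable (A `*` B) by exact: measurableX.
rewrite leb3E; transitivity (@leb2 R (A `*` B) * leb C)%E.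
  exact: (product_measure1E (@leb2 R) leb mAB mC).
by congr (_ * _)%E; exact: (product_measure1E leb leb mA mB).
Qed.

Lemma leb3_oball_fin r : (@leb3 R (oball r) < +oo)%E.
Proof.
pose I := `[- `|r|, `|r| ]%classic : set (measurableTypeR R).
have mI : measurable I by exact: measurable_itv.
apply: (@le_lt_trans _ _ (@leb3 R ((I `*` I) `*` I))).
  apply: le_measure; rewrite ?inE; first exact: measurable_oball.
    exact: (measurableX (measurableX mI mI) mI).
  move=> x /= xr; have r0 : 0 < r := le_lt_trans (eucl_norm_ge0 x) xr.
  have /= := eucl_norm_sqr x.
  have : eucl_norm x ^+ 2 < r ^+ 2 by rewrite ltr_pXn2r// nnegrE ?eucl_norm_ge0 ?ltW.
  move=> h1 h2; rewrite /I/= !in_itv/= -!ler_norml.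
  rewrite -![`|_| <= `|r| ](@ler_pXn2r _ 2) ?nnegrE// !real_normK ?num_real//.
  have := sqr_ge0 x.1.1; have := sqr_ge0 x.1.2; have := sqr_ge0 x.2.
  by move=> ? ? ?; do 2?split; lra.
rewrite leb3_box// lebesgue_measure_itv/=.
by case: ifPn => _; rewrite -?EFinB -?EFinM ?ltry// !mul0e ltry.
Qed.

Lemma leb3_oball_gt0 r : 0 < r -> (0 < @leb3 R (oball r))%E.
Proof.
move=> r0; pose I := `[- (r / 2), r / 2]%classic : set (measurableTypeR R).
have mI : measurable I by exact: measurable_itv.
apply: (@lt_le_trans _ _ (@leb3 R ((I `*` I) `*` I))).
  rewrite leb3_box// lebesgue_measure_itv/= lte_fin gtrN ?divr_gt0//.
  by rewrite -EFinB -!EFinM lte_fin !mulr_gt0//; lra.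
apply: le_measure; rewrite ?inE; last 2 first.
  exact: measurable_oball.
  move=> x [[/= I1 I2] I3].
  rewrite /oball/= -(@ltr_pXn2r _ 2) ?nnegrE ?eucl_norm_ge0 ?ltW// eucl_norm_sqr.
  move: I1 I2 I3; rewrite /I /= !in_itv/= -!ler_norml.
  have le2 a : `|a| <= r / 2 -> a ^+ 2 <= r ^+ 2 / 4.
    move=> h; rewrite -real_normK ?num_real//.
    have -> : r ^+ 2 / 4 = (r / 2) ^+ 2 by field.
    by rewrite ler_sqr ?nnegrE// (le_trans _ h).
  have : 0 < r ^+ 2 by rewrite exprn_gt0.
  by move=> ? /le2 ? /le2 ? /le2 ?; lra.
exact: (measurableX (measurableX mI mI) mI).
Qed.

End norm3.

(** * Integrals of nonnegative real functions *)
Section nonneg_integral.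
Context d (T : measurableType d) (R : realType) (mu : {measure set T -> \bar R}).
Implicit Types f g : T -> R.

Definition nnint f : \bar R := (\int[mu]_x (f x)%:E)%E.

Arguments nnint f%_R.

Lemma nnint_ge0 f : (forall x, 0 <= f x) -> (0 <= nnint f)%E.
Proof. by move=> f0; apply: integral_ge0 => x _; rewrite lee_fin. Qed.

Lemma le_nnint f g : measurable_fun setT f -> measurable_fun setT g ->
  (forall x, 0 <= f x) -> (forall x, f x <= g x) -> (nnint f <= nnint g)%E.
Proof.
move=> mf mg f0 fg; apply: ge0_le_integral => //.
- by move=> x _; rewrite lee_fin.
- exact/measurable_EFinP.
- exact/measurable_EFinP.
- by move=> x _; rewrite lee_fin.
Qed.

Lemma ae_le_nnint f g : measurable_fun setT f -> measurable_fun setT g ->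
  (forall x, 0 <= f x) -> (forall x, 0 <= g x) ->
  {ae mu, forall x, f x <= g x} -> (nnint f <= nnint g)%E.
Proof.
move=> mf mg f0 g0 fg; apply: ae_ge0_le_integral => //.
- by move=> x _; rewrite lee_fin.
- exact/measurable_EFinP.
- by move=> x _; rewrite lee_fin.
- exact/measurable_EFinP.
- by apply: filterS fg => x fgx _; rewrite lee_fin.
Qed.

Lemma nnintD f g : measurable_fun setT f -> measurable_fun setT g ->
  (forall x, 0 <= f x) -> (forall x, 0 <= g x) ->
  nnint (fun x => f x + g x) = (nnint f + nnint g)%E.
Proof.
move=> mf mg f0 g0; rewrite /nnint -ge0_integralD//.
- by move=> x _; rewrite lee_fin.
- exact/measurable_EFinP.
- by move=> x _; rewrite lee_fin.
- exact/measurable_EFinP.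
Qed.

Lemma nnintZ (k : R) f : measurable_fun setT f -> (forall x, 0 <= f x) -> 0 <= k ->
  nnint (fun x => k * f x) = (k%:E * nnint f)%E.
Proof.
move=> mf f0 k0; rewrite /nnint -ge0_integralZl//.
- exact/measurable_EFinP.
- by move=> x _; rewrite lee_fin.
Qed.

Lemma eq_nnint f g : (forall x, f x = g x) -> nnint f = nnint g.
Proof. by move=> fg; congr nnint; apply/funext. Qed.

Lemma nnint_indic (A : set T) : measurable A -> nnint \1_A = mu A.
Proof. by move=> mA; rewrite /nnint integral_indic// setIT. Qed.

End nonneg_integral.

Lemma measurable_inv_ge0 d (T : measurableType d) (R : realType) (f : T -> R) :
  measurable_fun setT f -> (forall x, 0 <= f x) ->
  measurable_fun setT (fun x => (f x)^-1).
Proof.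
move=> mf f0; under eq_fun do rewrite -powR_inv1//.
exact: (measurableT_comp (measurable_powR _) mf).
Qed.

(** * The singularity of the Coulomb kernel *)
Section singularity.
Variable R : realType.
Implicit Types (x y z : 'R3 R).
Local Notation I3 f := (nnint (@leb3 R) f%R).

(** The square of this function is the part of [1 / |z|] inside the unit
    ball; the powers of the square root are what the bootstrap for the
    densities needs. *)
Definition sing z : R := \1_(oball 1) z * Num.sqrt (eucl_norm z)^-1.

Lemma sing_ge0 z : 0 <= sing z.
Proof. by rewrite mulr_ge0// sqrtr_ge0. Qed.

Lemma measurable_sing : measurable_fun setT sing.
Proof.
apply: measurable_funM; first by apply: measurable_indic; exact: measurable_oball.
apply: measurableT_comp; first exact: measurable_sqrtr.
by apply: measurable_inv_ge0; [exact: measurable_eucl_norm|exact: eucl_norm_ge0].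
Qed.

Lemma sing_in z : eucl_norm z < 1 -> sing z = Num.sqrt (eucl_norm z)^-1.
Proof. by move=> z1; rewrite /sing indicE mem_set ?mul1r. Qed.

Lemma sing_out z : 1 <= eucl_norm z -> sing z = 0.
Proof.
move=> z1; rewrite /sing indicE memNset ?mul0r// /oball/= => z2.
by move: z1; rewrite leNgt z2.
Qed.

(** The function vanishes or is at least [1], hence its powers increase. *)
Lemma sing_bool z : sing z = 0 \/ 1 <= sing z.
Proof.
have [z1|/sing_out ->] := ltP (eucl_norm z) 1; last by left.
have [z0|z0] := eqVneq (eucl_norm z) 0.
  by left; rewrite sing_in// z0 invr0 sqrtr0.
right; rewrite sing_in// -[leLHS]sqrtr1 ler_wsqrtr// invf_ge1 ?ltW//.
by rewrite lt_neqAle eq_sym z0 eucl_norm_ge0.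
Qed.

Lemma sing_exp_le (k l : nat) z : (0 < k <= l)%N -> sing z ^+ k <= sing z ^+ l.
Proof.
move=> /andP[k0 kl]; have [->|s1] := sing_bool z; last by rewrite ler_weXn2l.
by rewrite !expr0n !gtn_eqF// (leq_trans k0).
Qed.

Lemma inv_norm_le z : (eucl_norm z)^-1 <= 1 + sing z ^+ 2.
Proof.
have [z1|z1] := ltP (eucl_norm z) 1.
  by rewrite sing_in// sqr_sqrtr ?invr_ge0 ?eucl_norm_ge0// lerDr.
by rewrite (@le_trans _ _ 1) ?lerDl ?sqr_ge0// invf_le1// (lt_le_trans _ z1).
Qed.

(** Integrability of [sing ^ 5] by self-similarity: the truncations have finite
    integrals, and [trunc_le] bounds each of these by a constant plus half of itself. *)
Let trunc (n : nat) z := Num.min (sing z ^+ 5) n%:R.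

Let trunc_ge0 n z : 0 <= trunc n z.
Proof. by rewrite le_min exprn_ge0 ?sing_ge0//=. Qed.

Let measurable_trunc n : measurable_fun setT (trunc n).
Proof.
by apply: measurable_minr => //; apply: measurable_funX; exact: measurable_sing.
Qed.

(** Dilating by 4 doubles [sing], so that a fifth power gains 32 while the
    volume loses 64. *)
Let trunc_le n z : trunc n z <= 32 * \1_(oball 1) z + 32 * trunc n (affine3 4 (0, 0, 0) z).
Proof.
have [z1|z1] := ltP (eucl_norm z) 1; last first.
  rewrite /trunc sing_out// expr0n/= min_l//.
  by rewrite addr_ge0// mulr_ge0// ?trunc_ge0// indicE ler0n.
rewrite indicE mem_set// mulr1.
have [z4|z4] := ltP (eucl_norm z) 4^-1.
  have n4 : eucl_norm (affine3 4 (0, 0, 0) z) = 4 * eucl_norm z.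
    by rewrite eucl_norm_scale gtr0_norm.
  have s4 : sing z = 2 * sing (affine3 4 (0, 0, 0) z).
    rewrite !sing_in// ?n4; last by rewrite mulrC -ltr_pdivlMr// div1r.
    rewrite invfM sqrtrM ?invr_ge0// mulrA; have -> : 4^-1 = (2^-1) ^+ 2 :> R by field.
    by rewrite sqrtr_sqr ger0_norm ?invr_ge0// divff// mul1r.
  apply: ler_wpDl => //; rewrite /trunc s4 exprMn.
  have s0 := sing_ge0 (affine3 4 (0, 0, 0) z).
  have -> : 2 ^+ 5 = 32 :> R by ring.
  rewrite minr_pMr// le_min ge_min lexx/= ge_min; apply/orP; right.
  by rewrite ler_peMl// ler1n.
rewrite ler_wpDr ?mulr_ge0// ge_min; apply/orP; left.
have s2 : sing z <= 2.
  rewrite sing_in//; have -> : 2 = Num.sqrt (2 ^+ 2) :> R by rewrite sqrtr_sqr ger0_norm.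
  rewrite ler_wsqrtr// -[leRHS]invrK lef_pV2 ?posrE ?invr_gt0//; last first.
    exact: lt_le_trans z4.
  by rewrite (le_trans _ z4)// -natrX.
have h : sing z ^+ 5 <= 2 ^+ 5 by apply: lerXn2r => //; rewrite nnegrE ?sing_ge0.
by rewrite (le_trans h)//; lra.
Qed.

Let trunc_int_fin n : (I3 (trunc n) < +oo)%E.
Proof.
apply: (@le_lt_trans _ _ (I3 (fun z => n%:R * \1_(oball 1) z))).
  apply: le_nnint => //.
    by apply: measurable_funM => //; by apply: measurable_indic; exact: measurable_oball.
  move=> z; have [z1|z1] := ltP (eucl_norm z) 1.
    by rewrite indicE mem_set// mulr1 ge_min lexx orbT.
  by rewrite /trunc sing_out// expr0n/= min_l// mulr_ge0.
rewrite nnintZ//; last by apply: measurable_indic; exact: measurable_oball.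
rewrite nnint_indic; last exact: measurable_oball.
by rewrite lte_mul_pinfty// leb3_oball_fin.
Qed.

Let trunc_int_le n : (I3 (trunc n) <= 64%:E * @leb3 R (oball 1))%E.
Proof.
have mB : measurable (oball (1 : R)) by exact: measurable_oball.
have mI : measurable_fun setT (\1_(oball (1 : R)) : _ -> R) by exact: measurable_indic.
have a4 : (4 : R) != 0 by [].
have mt4 : measurable_fun setT (fun z => trunc n (affine3 4 (0, 0, 0) z)).
  exact: (measurableT_comp (measurable_trunc n) (measurable_affine3 _ _)).
have : (I3 (trunc n) <= 32%:E * @leb3 R (oball 1) + 2^-1%:E * I3 (trunc n))%E.
  apply: (@le_trans _ _ (I3 (fun z => 32 * \1_(oball 1) z +
      32 * trunc n (affine3 4 (0, 0, 0) z)))).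
    apply: le_nnint; [exact: measurable_trunc| |exact: trunc_ge0|exact: trunc_le].
    by apply: measurable_funD; apply: measurable_funM.
  rewrite nnintD//; [|exact: measurable_funM|exact: measurable_funM|
    by move=> z; rewrite mulr_ge0].
  have I0 (z : 'R3 R) : 0 <= \1_(oball 1) z :> R by rewrite indicE ler0n.
  rewrite (nnintZ (@leb3 R) mI I0 (ler0n _ 32)) nnint_indic//.
  rewrite (nnintZ (@leb3 R) mt4 (fun z => trunc_ge0 n _) (ler0n _ 32)).
  have -> : I3 (fun z => trunc n (affine3 4 (0, 0, 0) z)) = ((`|4| ^- 3)%:E * I3 (trunc n))%E.
    rewrite /nnint -(leb3_affine (0, 0, 0) a4)//; first exact/measurable_EFinP.
    by move=> z; rewrite lee_fin.
  rewrite muleA -EFinM gtr0_norm//.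
  by have -> : 32 / 4 ^+ 3 = 2^-1 :> R by field.
have Bf : @leb3 R (oball 1) \is a fin_num by rewrite ge0_fin_numE// leb3_oball_fin.
have If : I3 (trunc n) \is a fin_num.
  by rewrite ge0_fin_numE ?trunc_int_fin// nnint_ge0//.
by rewrite -(fineK Bf) -(fineK If) -!EFinM -EFinD !lee_fin; lra.
Qed.

Lemma nnint_sing5_fin : (I3 (fun z => sing z ^+ 5) < +oo)%E.
Proof.
apply: (@le_lt_trans _ _ (64%:E * @leb3 R (oball 1))%E); last first.
  by rewrite lte_mul_pinfty// leb3_oball_fin.
have -> : I3 (fun z => sing z ^+ 5) = (\int[@leb3 R]_z limn (fun n => (trunc n z)%:E))%E.
  apply: eq_integral => z _; apply/esym/cvg_lim => //.
  apply: cvg_near_cst; exists (Num.truncn (sing z ^+ 5)).+1 => // n /= zn.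
  by rewrite /trunc min_l// ltW// (lt_le_trans (truncnS_gt _))// ler_nat.
rewrite monotone_convergence//.
- apply: lime_le; last by apply: nearW => n; exact: trunc_int_le.
  apply: ereal_nondecreasing_is_cvgn => n k nk.
  apply: le_nnint => // z; rewrite /trunc le_min !ge_min lexx/= ler_nat nk.
  by rewrite orbT.
- by move=> n; exact/measurable_EFinP.
- by move=> n z _; rewrite lee_fin.
- move=> z _ n k nk; rewrite lee_fin /trunc le_min !ge_min lexx/= ler_nat nk.
  by rewrite orbT.
Qed.
End singularity.

(** * The Coulomb form and potentials *)
Section coulomb_form.
Variable R : realType.
Local Notation I3 f := (nnint (@leb3 R) f%R).
Implicit Types (f g h : 'R3 R -> R) (x y z : 'R3 R) (a : R).

(** As for [leb2], this name carries the instances that Tonelli's theorem needs. *)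
Definition leb6 : set ('R3 R * 'R3 R)%type -> \bar R := (@lebR3 R \x @lebR3 R)%E.
HB.instance Definition _ := Measure.on leb6.

Lemma leb6_tonelli (u : 'R3 R * 'R3 R -> R) : measurable_fun setT u ->
  (forall p, 0 <= u p) ->
  nnint leb6 u = (\int[@leb3 R]_x \int[@leb3 R]_y (u (x, y))%:E)%E.
Proof.
move=> mu u0; have mu' : measurable_fun setT (EFin \o u) by exact/measurable_EFinP.
have u0' p : (0 <= (EFin \o u) p)%E by rewrite lee_fin.
rewrite /nnint (fubini_tonelli1 (m1 := @lebR3 R) (m2 := @lebR3 R) (EFin \o u) mu' u0').
by rewrite integral_leb3E; apply: eq_integral => x _; rewrite integral_leb3E.
Qed.

Lemma leb6_tonelliC (u : 'R3 R * 'R3 R -> R) : measurable_fun setT u ->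
  (forall p, 0 <= u p) ->
  nnint leb6 u = (\int[@leb3 R]_y \int[@leb3 R]_x (u (x, y))%:E)%E.
Proof.
move=> mu u0; have mu' : measurable_fun setT (EFin \o u) by exact/measurable_EFinP.
have u0' p : (0 <= (EFin \o u) p)%E by rewrite lee_fin.
rewrite /nnint (fubini_tonelli2 (m1 := @lebR3 R) (m2 := @lebR3 R) (EFin \o u) mu' u0').
by rewrite integral_leb3E; apply: eq_integral => x _; rewrite integral_leb3E.
Qed.

Lemma measurable_partial_int (u : 'R3 R * 'R3 R -> R) : measurable_fun setT u ->
  (forall p, 0 <= u p) ->
  measurable_fun setT (fun x => \int[@leb3 R]_y (u (x, y))%:E)%E.
Proof.
move=> mu u0; have mu' : measurable_fun setT (EFin \o u) by exact/measurable_EFinP.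
have u0' p : (0 <= (EFin \o u) p)%E by rewrite lee_fin.
rewrite (_ : (fun x => _) = fubini_F (@lebR3 R) (EFin \o u)).
  exact: measurable_fun_fubini_tonelli_F.
by apply/funext => x; rewrite integral_leb3E.
Qed.

Lemma measurable_inv_dist :
  measurable_fun setT (fun p : 'R3 R * 'R3 R => (eucl_dist p.1 p.2)^-1).
Proof.
apply: measurable_inv_ge0; first exact: measurable_eucl_dist2.
by move=> p; exact: eucl_dist_ge0.
Qed.

Lemma measurable_fst_comp f : measurable_fun setT f ->
  measurable_fun setT (fun p : 'R3 R * 'R3 R => f p.1).
Proof. by move=> mf; exact: (measurableT_comp mf measurable_fst). Qed.

Lemma measurable_snd_comp f : measurable_fun setT f ->
  measurable_fun setT (fun p : 'R3 R * 'R3 R => f p.2).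
Proof. by move=> mf; exact: (measurableT_comp mf measurable_snd). Qed.

Definition coulomb_integrand f g (p : 'R3 R * 'R3 R) : R :=
  f p.1 * g p.2 / eucl_dist p.1 p.2.

(** One integral over pairs of points, so that symmetry and bilinearity follow from
    the properties of an integral; [coulombE] and [coulomb_formE] return to iterated
    integrals. *)
Definition coulomb_form f g : \bar R := nnint leb6 (coulomb_integrand f g).

Definition potential g x : \bar R := I3 (fun y => g y / eucl_dist x y).

Lemma measurable_coulomb_integrand f g : measurable_fun setT f ->
  measurable_fun setT g -> measurable_fun setT (coulomb_integrand f g).
Proof.
move=> mf mg; apply: measurable_funM; last exact: measurable_inv_dist.
by apply: measurable_funM; [exact: measurable_fst_comp|exact: measurable_snd_comp].
Qed.

Lemma coulomb_integrand_ge0 f g : (forall x, 0 <= f x) -> (forall x, 0 <= g x) ->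
  forall p, 0 <= coulomb_integrand f g p.
Proof.
by move=> f0 g0 p; rewrite mulr_ge0 ?invr_ge0 ?eucl_dist_ge0 ?mulr_ge0.
Qed.

Lemma coulomb_form_ge0 f g : (forall x, 0 <= f x) -> (forall x, 0 <= g x) ->
  (0 <= coulomb_form f g)%E.
Proof. by move=> f0 g0; apply: nnint_ge0; exact: coulomb_integrand_ge0. Qed.

Lemma measurable_potential_integrand g x : measurable_fun setT g ->
  measurable_fun setT (fun y => g y / eucl_dist x y).
Proof.
move=> mg; apply: measurable_funM => //; apply: measurable_inv_ge0.
  exact: measurable_eucl_dist.
by move=> y; exact: eucl_dist_ge0.
Qed.

Lemma potential_integrand_ge0 g x : (forall y, 0 <= g y) ->
  forall y, 0 <= g y / eucl_dist x y.
Proof. by move=> g0 y; rewrite mulr_ge0 ?invr_ge0 ?eucl_dist_ge0. Qed.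

Lemma potential_ge0 g x : (forall y, 0 <= g y) -> (0 <= potential g x)%E.
Proof. by move=> g0; apply: nnint_ge0; exact: potential_integrand_ge0. Qed.

Lemma measurable_potential g : measurable_fun setT g -> (forall y, 0 <= g y) ->
  measurable_fun setT (potential g).
Proof.
move=> mg g0.
apply: (measurable_partial_int (u := fun p => g p.2 / eucl_dist p.1 p.2)).
  by apply: measurable_funM; [exact: measurable_snd_comp|exact: measurable_inv_dist].
by move=> p; rewrite mulr_ge0 ?invr_ge0 ?eucl_dist_ge0.
Qed.

Lemma coulomb_formE f g : measurable_fun setT f -> measurable_fun setT g ->
  (forall x, 0 <= f x) -> (forall x, 0 <= g x) ->
  coulomb_form f g = (\int[@leb3 R]_x ((f x)%:E * potential g x))%E.
Proof.
move=> mf mg f0 g0.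
rewrite /coulomb_form (leb6_tonelli (measurable_coulomb_integrand mf mg)
  (coulomb_integrand_ge0 f0 g0)).
apply: eq_integral => x _.
rewrite -(nnintZ _ (measurable_potential_integrand x mg)
  (potential_integrand_ge0 x g0) (f0 x)).
by apply: eq_integral => y _; rewrite /coulomb_integrand/= mulrA.
Qed.

Lemma coulombE f : measurable_fun setT f -> (forall x, 0 <= f x) ->
  coulomb f = ((2^-1)%:E * coulomb_form f f)%E.
Proof.
move=> mf f0; rewrite /coulomb /coulomb_form.
by rewrite (leb6_tonelli (measurable_coulomb_integrand mf mf)
  (coulomb_integrand_ge0 f0 f0)).
Qed.

Lemma coulomb_formC f g : measurable_fun setT f -> measurable_fun setT g ->
  (forall x, 0 <= f x) -> (forall x, 0 <= g x) ->
  coulomb_form f g = coulomb_form g f.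
Proof.
move=> mf mg f0 g0.
have mfg := measurable_coulomb_integrand mf mg.
have mgf := measurable_coulomb_integrand mg mf.
rewrite /coulomb_form (leb6_tonelli mfg (coulomb_integrand_ge0 f0 g0)).
rewrite (leb6_tonelliC mgf (coulomb_integrand_ge0 g0 f0)).
apply: eq_integral => x _; apply: eq_integral => y _.
by rewrite /coulomb_integrand/= eucl_distC (mulrC (f x)).
Qed.

Lemma coulomb_formDl f h g : measurable_fun setT f -> measurable_fun setT h ->
  measurable_fun setT g ->
  (forall x, 0 <= f x) -> (forall x, 0 <= h x) -> (forall x, 0 <= g x) ->
  coulomb_form (fun x => f x + h x) g = (coulomb_form f g + coulomb_form h g)%E.
Proof.
move=> mf mh mg f0 h0 g0.
rewrite /coulomb_form -(nnintD _ (measurable_coulomb_integrand mf mg)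
  (measurable_coulomb_integrand mh mg) (coulomb_integrand_ge0 f0 g0)
  (coulomb_integrand_ge0 h0 g0)).
by apply: eq_nnint => p; rewrite /coulomb_integrand !mulrDl.
Qed.

Lemma coulomb_formZl (k : R) f g : measurable_fun setT f -> measurable_fun setT g ->
  (forall x, 0 <= f x) -> (forall x, 0 <= g x) -> 0 <= k ->
  coulomb_form (fun x => k * f x) g = (k%:E * coulomb_form f g)%E.
Proof.
move=> mf mg f0 g0 k0.
rewrite /coulomb_form -(nnintZ _ (measurable_coulomb_integrand mf mg)
  (coulomb_integrand_ge0 f0 g0) k0).
by apply: eq_nnint => p; rewrite /coulomb_integrand !mulrA.
Qed.

Lemma le_coulomb_form f g f' g' : measurable_fun setT f -> measurable_fun setT g ->
  measurable_fun setT f' -> measurable_fun setT g' ->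
  (forall x, 0 <= f x) -> (forall x, 0 <= g x) ->
  (forall x, f x <= f' x) -> (forall x, g x <= g' x) ->
  (coulomb_form f g <= coulomb_form f' g')%E.
Proof.
move=> mf mg mf' mg' f0 g0 ff gg; apply: le_nnint.
- exact: measurable_coulomb_integrand.
- exact: measurable_coulomb_integrand.
- exact: coulomb_integrand_ge0.
- move=> p; rewrite /coulomb_integrand ler_wpM2r ?invr_ge0 ?eucl_dist_ge0//.
  by rewrite ler_pM.
Qed.

Definition dilate (a : R) f x : R := f (affine3 a (0, 0, 0)%R x).

Lemma measurable_dilate a f : measurable_fun setT f -> measurable_fun setT (dilate a f).
Proof. by move=> mf; exact: (measurableT_comp mf (measurable_affine3 _ _)). Qed.

Lemma nnint_dilate a f : 0 < a -> measurable_fun setT f -> (forall x, 0 <= f x) ->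
  I3 (dilate a f) = ((a ^- 3)%:E * I3 f)%E.
Proof.
move=> a0 mf f0; rewrite -[in RHS](gtr0_norm a0) /nnint.
have mf' : measurable_fun setT (EFin \o f) by exact/measurable_EFinP.
have f0' x : (0 <= (EFin \o f) x)%E by rewrite lee_fin.
by rewrite -(leb3_affine (0, 0, 0) (lt0r_neq0 a0) mf' f0').
Qed.

Lemma potential_dilate a g x : 0 < a -> measurable_fun setT g -> (forall x, 0 <= g x) ->
  potential (dilate a g) x = ((a ^- 2)%:E * potential g (affine3 a (0, 0, 0)%R x))%E.
Proof.
move=> a0 mg g0; have a1 : a != 0 by rewrite gt_eqF.
transitivity (I3 (fun y => a * dilate a (fun y => g y / eucl_dist (affine3 a (0, 0, 0)%R x) y) y)).
  apply: eq_nnint => y; rewrite /dilate eucl_dist_scale gtr0_norm// invfM.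
  by rewrite [RHS]mulrCA (mulrA a) divff// mul1r.
have mG := measurable_potential_integrand (affine3 a (0, 0, 0)%R x) mg.
have G0 := potential_integrand_ge0 (affine3 a (0, 0, 0)%R x) g0.
rewrite (nnintZ _ (measurable_dilate a mG) (fun y => G0 _) (ltW a0)).
rewrite (nnint_dilate a0 mG G0).
rewrite muleA -EFinM; congr (EFin _ * _)%E.
by field.
Qed.

Lemma coulomb_form_dilate a f g : 0 < a -> measurable_fun setT f ->
  measurable_fun setT g -> (forall x, 0 <= f x) -> (forall x, 0 <= g x) ->
  coulomb_form (dilate a f) (dilate a g) = ((a ^- 5)%:E * coulomb_form f g)%E.
Proof.
move=> a0 mf mg f0 g0; have a1 : a != 0 by rewrite gt_eqF.
have mP := measurable_potential mg g0.
have P0 x : (0 <= potential g x)%E by exact: potential_ge0.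
rewrite (coulomb_formE mf mg f0 g0) (coulomb_formE (measurable_dilate a mf)
  (measurable_dilate a mg) (fun=> f0 _) (fun=> g0 _)).
pose F x := ((f x)%:E * potential g x)%E.
have mF : measurable_fun setT F.
  by apply: emeasurable_funM => //; exact/measurable_EFinP.
have F0 x : (0 <= F x)%E by rewrite mule_ge0// lee_fin.
transitivity (\int[@leb3 R]_x ((a ^- 2)%:E * F (affine3 a (0, 0, 0)%R x)))%E.
  by apply: eq_integral => x _; rewrite potential_dilate// muleCA.
have a2 : (0 <= (a ^- 2)%:E)%E by rewrite lee_fin invr_ge0 exprn_ge0// ltW.
rewrite (ge0_integralZl _ measurableT
  (measurableT_comp mF (measurable_affine3 a (0, 0, 0)%R)) (fun _ _ => F0 _) a2).
rewrite (leb3_affine _ a1 mF F0) gtr0_norm// muleA -EFinM; congr (EFin _ * _)%E.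
by field.
Qed.

End coulomb_form.

(** * Bounds on potentials *)
Section potential_bounds.
Variable R : realType.
Local Notation I3 f := (nnint (@leb3 R) f%R).
Implicit Types (f g h r : 'R3 R -> R) (x y z : 'R3 R).

Definition sing2 x y : R := sing (affine3 (- 1) x y).

Lemma sing2_ge0 x y : 0 <= sing2 x y. Proof. exact: sing_ge0. Qed.

Lemma sing2C x y : sing2 x y = sing2 y x.
Proof.
rewrite /sing2 /sing -!eucl_distE eucl_distC !indicE.
by congr (_%:R * _); rewrite /oball; congr (nat_of_bool _); apply/idP/idP;
  rewrite !inE/= -!eucl_distE eucl_distC.
Qed.

Lemma inv_dist_le x y : (eucl_dist x y)^-1 <= 1 + sing2 x y ^+ 2.
Proof. by rewrite eucl_distE; exact: inv_norm_le. Qed.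

Lemma measurable_sing2 : measurable_fun setT (fun p : 'R3 R * 'R3 R => sing2 p.1 p.2).
Proof.
suff m : measurable_fun setT (fun p : 'R3 R * 'R3 R => affine3 (- 1) p.1 p.2).
  exact: (measurableT_comp (@measurable_sing R) m).
have m1 : measurable_fun setT (@fst ('R3 R) ('R3 R)) by exact: measurable_fst.
have m2 : measurable_fun setT (@snd ('R3 R) ('R3 R)) by exact: measurable_snd.
apply: measurable_fun_pair; first apply: measurable_fun_pair;
  apply: measurable_funD; try (apply: measurable_funM => //).
- exact: (measurableT_comp (@measurable_x1 R) m2).
- exact: (measurableT_comp (@measurable_x1 R) m1).
- exact: (measurableT_comp (@measurable_x2 R) m2).
- exact: (measurableT_comp (@measurable_x2 R) m1).
- exact: (measurableT_comp (@measurable_x3 R) m2).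
- exact: (measurableT_comp (@measurable_x3 R) m1).
Qed.

Lemma measurable_sing2r x : measurable_fun setT (sing2 x).
Proof. exact: (measurableT_comp measurable_sing2 (measurable_pair1 x)). Qed.

Definition sing_mass : R := fine (I3 (fun z => sing z ^+ 5)).

Lemma sing_massE : I3 (fun z => sing z ^+ 5) = sing_mass%:E.
Proof.
rewrite /sing_mass fineK// ge0_fin_numE ?nnint_sing5_fin//.
by apply: nnint_ge0 => z; rewrite exprn_ge0// sing_ge0.
Qed.

Lemma sing_mass_ge0 : 0 <= sing_mass.
Proof.
rewrite -lee_fin -sing_massE; apply: nnint_ge0 => z.
by rewrite exprn_ge0// sing_ge0.
Qed.

Lemma nnint_sing2_5 x : I3 (fun y => sing2 x y ^+ 5) = sing_mass%:E.
Proof.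
rewrite -sing_massE /nnint.
have m5 : measurable_fun setT (fun z : 'R3 R => (sing z ^+ 5)%:E).
  by apply/measurable_EFinP/measurable_funX; exact: measurable_sing.
have s5 (z : 'R3 R) : (0 <= (sing z ^+ 5)%:E)%E by rewrite lee_fin exprn_ge0// sing_ge0.
have n1 : - 1 != 0 :> R by rewrite oppr_eq0 oner_eq0.
by rewrite (leb3_affine x n1 m5 s5) normrN normr1 expr1n invr1 mul1e.
Qed.

Lemma nnint_sing2_le (k : nat) x : (0 < k <= 5)%N ->
  (I3 (fun y => sing2 x y ^+ k) <= sing_mass%:E)%E.
Proof.
move=> k5; rewrite -(nnint_sing2_5 x); apply: le_nnint.
- by apply: measurable_funX; exact: measurable_sing2r.
- by apply: measurable_funX; exact: measurable_sing2r.
- by move=> y; rewrite exprn_ge0// sing2_ge0.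
- by move=> y; exact: sing_exp_le.
Qed.

Lemma potential_le_near g x : measurable_fun setT g -> (forall y, 0 <= g y) ->
  (potential g x <= I3 g + I3 (fun y => g y * sing2 x y ^+ 2))%E.
Proof.
move=> mg g0.
have m2 : measurable_fun setT (fun y => g y * sing2 x y ^+ 2).
  by apply: measurable_funM => //; apply: measurable_funX; exact: measurable_sing2r.
have p2 y : 0 <= g y * sing2 x y ^+ 2 by rewrite mulr_ge0// exprn_ge0// sing2_ge0.
rewrite -(nnintD _ mg m2 g0 p2); apply: le_nnint.
- exact: measurable_potential_integrand.
- exact: measurable_funD.
- exact: potential_integrand_ge0.
- move=> y; apply: le_trans (ler_wpM2l (g0 y) (inv_dist_le x y)) _.
  by rewrite mulrDr mulr1.
Qed.

(** The weights [r ^ 4] and [sing ^ 5] split [r ^ 3 * sing ^ 2] according to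
    which of [r] and [sing] is larger. *)
Lemma cube_sing_le (a s : R) : 0 <= a -> 0 <= s -> a ^+ 3 * s ^+ 2 <= a ^+ 4 * s + s ^+ 5.
Proof.
move=> a0 s0; have [sa|/ltW sa] := leP s a.
  rewrite ler_wpDr ?exprn_ge0// [leLHS](_ : _ = a ^+ 3 * s * s); last by ring.
  by rewrite [leRHS](_ : _ = a ^+ 3 * s * a) ?ler_wpM2l ?mulr_ge0 ?exprn_ge0//; ring.
rewrite ler_wpDl ?mulr_ge0 ?exprn_ge0// [leRHS](_ : _ = s ^+ 3 * s ^+ 2); last by ring.
by rewrite ler_wpM2r ?exprn_ge0// lerXn2r.
Qed.

Lemma sing_prod_le (s t : R) : 0 <= s -> 0 <= t -> s ^+ 3 * t ^+ 2 <= s ^+ 5 + t ^+ 5.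
Proof.
move=> s0 t0; have [st|/ltW st] := leP s t.
  rewrite ler_wpDl ?exprn_ge0// [leRHS](_ : _ = t ^+ 3 * t ^+ 2); last by ring.
  by rewrite ler_wpM2r ?exprn_ge0// lerXn2r.
rewrite ler_wpDr ?exprn_ge0// [leRHS](_ : _ = s ^+ 3 * s ^+ 2); last by ring.
by rewrite ler_wpM2l ?exprn_ge0// lerXn2r.
Qed.

(** Jensen's inequality for the cube, from the tangent lines of [t ^ 3]. *)
Lemma cube_of_tangents (A w u : R) : 0 < A -> 0 <= w -> 0 <= u ->
  (forall l, 0 < l -> w <= l * A + u / l ^+ 2) -> w ^+ 3 <= 8 * A ^+ 2 * u.
Proof.
move=> A0; rewrite le_eqVlt => /predU1P[<- u0 _|w0 u0 H].
  by rewrite expr0n/= mulr_ge0// mulr_ge0// sqr_ge0.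
have l0 : 0 < w / (2 * A) by rewrite divr_gt0// mulr_gt0.
have := H _ l0; have An0 : A != 0 by rewrite gt_eqF.
have -> : w / (2 * A) * A = w / 2 by field.
have wn0 : w != 0 by rewrite gt_eqF.
have -> : u / (w / (2 * A)) ^+ 2 = 4 * A ^+ 2 * u / w ^+ 2.
  by field; rewrite wn0.
move=> h; have {}h : w / 2 <= 4 * A ^+ 2 * u / w ^+ 2 by lra.
move: h; rewrite ler_pdivlMr ?exprn_gt0// => h.
have -> : w ^+ 3 = 2 * (w / 2 * w ^+ 2) by field.
by rewrite (le_trans (ler_wpM2l _ h))//; lra.
Qed.

Lemma cube_sum_le (a b : R) : 0 <= a -> 0 <= b -> (a + b) ^+ 3 <= 4 * (a ^+ 3 + b ^+ 3).
Proof.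
move=> a0 b0; rewrite -subr_ge0 [leRHS](_ : _ = 3 * ((a + b) * (a - b) ^+ 2)); last by ring.
by apply: mulr_ge0 => //; apply: mulr_ge0; [exact: addr_ge0|exact: sqr_ge0].
Qed.


(** Tonelli's theorem and [sing_prod_le], which separates the two singularities:
    the inner integral is at most twice the mass of [sing ^ 5]. *)
Lemma nnint_quartic_near r x : measurable_fun setT r -> (forall y, 0 <= r y) ->
  (\int[@leb3 R]_y (I3 (fun z => r z ^+ 4 * sing2 y z ^+ 3) * (sing2 x y ^+ 2)%:E) <=
   I3 (fun z => r z ^+ 4) * (2 * sing_mass)%:E)%E.
Proof.
move=> mr r0.
pose u (p : 'R3 R * 'R3 R) : R := r p.2 ^+ 4 * sing2 p.1 p.2 ^+ 3 * sing2 x p.1 ^+ 2.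
have mr4 : measurable_fun setT (fun p : 'R3 R * 'R3 R => r p.2 ^+ 4).
  by apply: measurable_funX; exact: measurable_snd_comp.
have ms3 : measurable_fun setT (fun p : 'R3 R * 'R3 R => sing2 p.1 p.2 ^+ 3).
  by apply: measurable_funX; exact: measurable_sing2.
have ms2 : measurable_fun setT (fun p : 'R3 R * 'R3 R => sing2 x p.1 ^+ 2).
  apply: measurable_funX; apply: measurable_fst_comp; exact: measurable_sing2r.
have mu : measurable_fun setT u.
  by apply: measurable_funM => //; exact: measurable_funM.
have u0 p : 0 <= u p by rewrite !mulr_ge0 ?exprn_ge0 ?sing2_ge0.
have mrs y : measurable_fun setT (fun z => r z ^+ 4 * sing2 y z ^+ 3).
  apply: measurable_funM; apply: measurable_funX => //; exact: measurable_sing2r.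
have rs0 y z : 0 <= r z ^+ 4 * sing2 y z ^+ 3 by rewrite !mulr_ge0 ?exprn_ge0 ?sing2_ge0.
have mr4' : measurable_fun setT (fun z => r z ^+ 4) by exact: measurable_funX.
have r40 z : 0 <= r z ^+ 4 by rewrite exprn_ge0.
have S0 := sing_mass_ge0.
have -> : (\int[@leb3 R]_y (I3 (fun z => r z ^+ 4 * sing2 y z ^+ 3) * (sing2 x y ^+ 2)%:E))%E
    = nnint (@leb6 R) u.
  rewrite (leb6_tonelli mu u0); apply: eq_integral => y _.
  rewrite muleC -(nnintZ _ (mrs y) (rs0 y) (exprn_ge0 2 (sing2_ge0 x y))).
  by apply: eq_nnint => z; rewrite /u/= mulrC.
rewrite (leb6_tonelliC mu u0).
have mA : measurable_fun setT (fun z => 2 * sing_mass * r z ^+ 4).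
  exact: measurable_funM.
rewrite muleC -(nnintZ _ mr4' r40 (mulr_ge0 (ler0n _ 2) S0)).
apply: ge0_le_integral => //.
- by move=> z _; apply: integral_ge0 => y _; rewrite lee_fin.
- apply: (measurable_partial_int (u := fun p => u (p.2, p.1))) => //.
  have msw : measurable_fun setT (fun p : 'R3 R * 'R3 R => (p.2, p.1)).
    by apply: measurable_fun_pair; [exact: measurable_snd|exact: measurable_fst].
  exact: (measurableT_comp mu msw).
- exact/measurable_EFinP.
move=> z _.
have m5 w : measurable_fun setT (fun y => sing2 w y ^+ 5).
  by apply: measurable_funX; exact: measurable_sing2r.
have p5 w y : 0 <= sing2 w y ^+ 5 by rewrite exprn_ge0 ?sing2_ge0.
apply: (@le_trans _ _ (I3 (fun y => r z ^+ 4 * (sing2 z y ^+ 5 + sing2 x y ^+ 5)))).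
  apply: le_nnint => //.
  - exact: (measurableT_comp mu (pair2_measurable z)).
  - by apply: measurable_funM => //; exact: measurable_funD.
  - move=> y; rewrite /u/= -mulrA ler_wpM2l// (sing2C y).
    by rewrite sing_prod_le ?sing2_ge0.
rewrite (nnintZ _ (measurable_funD (m5 z) (m5 x)) (fun y => addr_ge0 (p5 z y) (p5 x y)) (r40 z)).
rewrite (nnintD _ (m5 z) (m5 x) (p5 z) (p5 x)) !nnint_sing2_5 -EFinD -EFinM lee_fin.
by rewrite mulrC; lra.
Qed.

(** Densities whose cube root is dominated by [1 +] their potential gain
    integrability: one pass takes a bound on the [L^(4/3)] norm to a bound on
    the potential. *)
Lemma potential_bootstrap (N A B : R) : 0 <= N -> 0 < A -> 0 < B ->
  exists2 M, 0 <= M & forall r, measurable_fun setT r -> (forall y, 0 <= r y) ->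
    (I3 (fun y => r y ^+ 3) <= N%:E)%E -> (I3 (fun y => r y ^+ 4) <= A%:E)%E ->
    {ae @leb3 R, forall y, ((r y)%:E <= B%:E * (1 + potential (fun y => r y ^+ 3)%R y))%E} ->
    forall x, (potential (fun y => r y ^+ 3)%R x <= M%:E)%E.
Proof.
move=> N0 A0 B0; have S0 := sing_mass_ge0; set S := sing_mass in S0.
pose k := 1 + N + S; pose C1 := 4 * B ^+ 3 * k ^+ 3; pose C2 := 32 * B ^+ 3 * A ^+ 2.
have k0 : 0 <= k by rewrite /k; lra.
have C10 : 0 <= C1 by rewrite !mulr_ge0 ?exprn_ge0// ltW.
have C20 : 0 < C2 by rewrite !mulr_gt0 ?exprn_gt0.
exists (N + (C1 * S + C2 * (A * (2 * S)))).
  by rewrite !addr_ge0 ?mulr_ge0// ltW.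
move=> r mr r0 r3N r4A rB x.
have mr3 : measurable_fun setT (fun y => r y ^+ 3) by exact: measurable_funX.
have mr4 : measurable_fun setT (fun y => r y ^+ 4) by exact: measurable_funX.
have r30 y : 0 <= r y ^+ 3 by rewrite exprn_ge0.
have r40 y : 0 <= r y ^+ 4 by rewrite exprn_ge0.
have ms i y : measurable_fun setT (fun z => sing2 y z ^+ i).
  by apply: measurable_funX; exact: measurable_sing2r.
have s0 i y z : 0 <= sing2 y z ^+ i by rewrite exprn_ge0// sing2_ge0.
pose W y := I3 (fun z => r z ^+ 4 * sing2 y z ^+ 1).
pose U y := I3 (fun z => r z ^+ 4 * sing2 y z ^+ 3).
have m4s i y : measurable_fun setT (fun z => r z ^+ 4 * sing2 y z ^+ i).
  exact: measurable_funM.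
have p4s i y z : 0 <= r z ^+ 4 * sing2 y z ^+ i by rewrite mulr_ge0.
have W0 y : (0 <= W y)%E by exact: nnint_ge0.
have U0 y : (0 <= U y)%E by exact: nnint_ge0.
(* the singular part of the potential, after the splitting of [cube_sing_le] *)
have potW y : (potential (fun y => r y ^+ 3)%R y <= (N + S)%:E + W y)%E.
  have h : (I3 (fun z => r z ^+ 3 * sing2 y z ^+ 2) <= W y + S%:E)%E.
    have <- : I3 (fun z => sing2 y z ^+ 5) = S%:E by exact: nnint_sing2_5.
    rewrite -(nnintD _ (m4s 1 y) (ms 5 y) (p4s 1 y) (s0 5 y)); apply: le_nnint.
    - exact: measurable_funM.
    - exact: measurable_funD.
    - by move=> z; rewrite mulr_ge0.
    - by move=> z; rewrite expr1; apply: cube_sing_le; rewrite ?sing2_ge0.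
  apply: le_trans (potential_le_near y mr3 r30) _.
  have -> : ((N + S)%:E + W y = N%:E + (W y + S%:E))%E.
    by rewrite EFinD; move: (W y) => w; rewrite -addeA (addeC w).
  exact: leeD r3N h.
(* tangent-line form of Jensen's inequality for the weight [r ^ 4]: [l] is free *)
have WU y l : 0 < l -> (W y <= (l * A)%:E + (l ^- 2)%:E * U y)%E.
  move=> l0; have l20 : 0 <= l ^- 2 by rewrite invr_ge0 exprn_ge0// ltW.
  apply: (@le_trans _ _ (l%:E * I3 (fun z => r z ^+ 4)%R + (l ^- 2)%:E * U y)%E); last first.
    by rewrite leeD2r// EFinM lee_wpmul2l// lee_fin ltW.
  rewrite -(nnintZ _ mr4 r40 (ltW l0)) -(nnintZ _ (m4s 3 y) (p4s 3 y) l20).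
  rewrite -(nnintD _ (measurable_funM (measurable_cst l) mr4)
    (measurable_funM (measurable_cst (l ^- 2)) (m4s 3 y))
    (fun z => mulr_ge0 (ltW l0) (r40 z)) (fun z => mulr_ge0 l20 (p4s 3 y z))).
  apply: le_nnint => //.
    by apply: measurable_funD; exact: measurable_funM.
  move=> z; rewrite /= [leRHS](_ : _ = r z ^+ 4 * (l + l ^- 2 * sing2 y z ^+ 3)); last by ring.
  rewrite ler_wpM2l// expr1; have [sl|/ltW sl] := leP (sing2 y z) l.
    by rewrite ler_wpDr// mulr_ge0.
  apply: ler_wpDl; first exact: ltW.
  rewrite [leRHS]mulrC ler_pdivlMr ?exprn_gt0// [leRHS]exprS.
  by rewrite ler_wpM2l ?sing2_ge0// lerXn2r// nnegrE ?sing2_ge0// ltW.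
(* the hypothesis bounds [r ^ 3] by the cube of its potential, hence linearly by [U] *)
have key y : ((r y)%:E <= B%:E * (1 + potential (fun y => r y ^+ 3)%R y))%E ->
    ((r y ^+ 3)%:E <= C1%:E + C2%:E * U y)%E.
  move=> ry; have := U0 y; case E : (U y) => [u| |]//; last first.
    by move=> _; rewrite gt0_muley ?lte_fin// addey// leey.
  rewrite lee_fin => u0.
  have Wfin : W y \is a fin_num.
    rewrite ge0_fin_numE//; apply: le_lt_trans (WU y 1 ltr01) _.
    by rewrite E -EFinM -EFinD ltry.
  have w0 : 0 <= fine (W y) by rewrite fine_ge0.
  have tang l : 0 < l -> fine (W y) <= l * A + u / l ^+ 2.
    move=> l0; have := WU y l l0; rewrite E -(fineK Wfin) -EFinM -EFinD lee_fin.
    by rewrite [u / _]mulrC.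
  have h := cube_of_tangents A0 w0 u0 tang.
  rewrite -EFinM -EFinD lee_fin.
  have {}ry : r y <= B * (k + fine (W y)).
    rewrite -lee_fin; apply: le_trans ry _; rewrite EFinM lee_wpmul2l ?lee_fin ?(ltW B0)//.
    rewrite /k -(addrA 1) -addrA EFinD leeD2l//; apply: le_trans (potW y) _.
    by rewrite [leRHS]EFinD fineK.
  apply: (@le_trans _ _ ((B * (k + fine (W y))) ^+ 3)).
    by apply: lerXn2r => //; rewrite nnegrE ?r0 ?mulr_ge0 ?addr_ge0 ?(ltW B0).
  rewrite exprMn; apply: le_trans (ler_wpM2l _ (cube_sum_le k0 w0)) _.
    by rewrite exprn_ge0// ltW.
  have -> : C1 + C2 * u = B ^+ 3 * (4 * (k ^+ 3 + 8 * A ^+ 2 * u)).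
    by rewrite /C1 /C2; ring.
  by rewrite ler_wpM2l ?exprn_ge0 ?(ltW B0)// ler_wpM2l// lerD2l.
have mU : measurable_fun setT U.
  apply: (measurable_partial_int (u := fun p => r p.2 ^+ 4 * sing2 p.1 p.2 ^+ 3)).
    apply: measurable_funM; apply: measurable_funX; last exact: measurable_sing2.
    exact: measurable_snd_comp.
  by move=> p; rewrite mulr_ge0// exprn_ge0// sing2_ge0.
apply: le_trans (potential_le_near x mr3 r30) _.
rewrite EFinD leeD//.
have mUs : measurable_fun setT (fun y => (U y * (sing2 x y ^+ 2)%:E)%E).
  by apply: emeasurable_funM => //; exact/measurable_EFinP.
have Us0 y : (0 <= C2%:E * (U y * (sing2 x y ^+ 2)%:E))%E.
  by apply: mule_ge0; [rewrite lee_fin ltW|apply: mule_ge0; rewrite ?lee_fin].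
apply: (@le_trans _ _ (\int[@leb3 R]_y ((C1 * sing2 x y ^+ 2)%:E +
    C2%:E * (U y * (sing2 x y ^+ 2)%:E)))%E).
  apply: ae_ge0_le_integral => //.
  - by move=> y _; rewrite lee_fin mulr_ge0.
  - by apply/measurable_EFinP; exact: measurable_funM.
  - move=> y _; apply: adde_ge0; first by rewrite lee_fin mulr_ge0.
    exact: Us0.
  - apply: emeasurable_funD; last exact: measurable_funeM.
    by apply/measurable_EFinP; exact: measurable_funM.
  apply: filterS rB => y /key h _.
  rewrite EFinM (EFinM C1) muleA -muleDl ?fin_num_adde_defr//.
  by apply: lee_wpmul2r; rewrite ?lee_fin.
have ms2 : measurable_fun setT (fun y => (C1 * sing2 x y ^+ 2)%:E).
  by apply/measurable_EFinP; exact: measurable_funM.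
have p2 y : (0 <= (C1 * sing2 x y ^+ 2)%:E)%E by rewrite lee_fin mulr_ge0.
rewrite (ge0_integralD _ measurableT (fun y _ => p2 y) ms2 (fun y _ => Us0 y)
  (measurable_funeM _ mUs)).
rewrite EFinD; apply: leeD.
  rewrite -/(nnint _ _) (nnintZ _ (ms 2 x) (s0 2 x) C10) [leRHS]EFinM.
  apply: lee_wpmul2l; first by rewrite lee_fin.
  exact: nnint_sing2_le.
have Us1 y : (0 <= U y * (sing2 x y ^+ 2)%:E)%E by rewrite mule_ge0 ?lee_fin.
rewrite ge0_integralZl//; last by rewrite lee_fin ltW.
rewrite [leRHS]EFinM; apply: lee_wpmul2l; first by rewrite lee_fin ltW.
apply: le_trans (nnint_quartic_near x mr r0) _.
by rewrite [leRHS]EFinM; apply: lee_wpmul2r => //; rewrite lee_fin mulr_ge0.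
Qed.

End potential_bounds.

(** * Continuity of potentials *)
Section potential_continuity.
Variable R : realType.
Local Notation I3 f := (nnint (@leb3 R) f%R).
Implicit Types (g : 'R3 R -> R) (x y z : 'R3 R).

(** Outside of the ball of radius [eta] about [x] the kernel is Lipschitz; inside, it
    is [sing ^ 2], and [sing ^ 3] is at least [1 / eta] there. *)
Lemma inv_dist_shift x x' y (eta delta : R) : 0 < eta <= 1 -> 0 <= delta <= eta / 2 ->
  eucl_dist x x' <= delta ->
  (eucl_dist x y)^-1 <=
    (eucl_dist x' y)^-1 + 2 * delta / eta ^+ 2 + eta * sing2 x y ^+ 5.
Proof.
move=> /andP[e0 e1] /andP[d0 de] xx'.
have D0 : 0 <= 2 * delta / eta ^+ 2 by apply: divr_ge0; [exact: mulr_ge0|exact: sqr_ge0].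
have s0 := sing2_ge0 x y.
have i0 : 0 <= (eucl_dist x' y)^-1 by rewrite invr_ge0 eucl_dist_ge0.
have S0 : 0 <= eta * sing2 x y ^+ 5 by rewrite mulr_ge0 ?exprn_ge0// ltW.
have [de0|de0] := eqVneq (eucl_dist x y) 0.
  by rewrite de0 invr0 !addr_ge0.
have dp : 0 < eucl_dist x y by rewrite lt_neqAle eq_sym de0 eucl_dist_ge0.
have [dl|dl] := ltP (eucl_dist x y) eta.
  apply: ler_wpDl; first exact: addr_ge0.
  have d1 : eucl_dist x y < 1 by exact: lt_le_trans dl e1.
  have sE : sing2 x y ^+ 2 = (eucl_dist x y)^-1.
    rewrite /sing2 sing_in -?eucl_distE// sqr_sqrtr// invr_ge0//.
    exact: ltW.
  have s1 : 1 <= sing2 x y.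
    rewrite -(@ler_pXn2r _ 2) ?nnegrE// expr1n sE invf_ge1//; exact: ltW.
  rewrite -sE [leRHS](_ : _ = (eta * sing2 x y ^+ 3) * sing2 x y ^+ 2); last by ring.
  apply: ler_peMl; first exact: exprn_ge0.
  apply: (@le_trans _ _ (eta * sing2 x y ^+ 2)).
    by rewrite sE ler_pdivlMr// mul1r ltW.
  by rewrite ler_wpM2l ?(ltW e0)// ler_weXn2l.
apply: ler_wpDr => //.
have tri := eucl_dist_triangle x x' y.
have tri' := eucl_dist_triangle x' x y.
rewrite (eucl_distC x' x) in tri'.
have d'p : eta / 2 <= eucl_dist x' y by lra.
have d'0 : 0 < eucl_dist x' y by apply: lt_le_trans d'p; rewrite divr_gt0.
rewrite -lerBlDl.
have -> : (eucl_dist x y)^-1 - (eucl_dist x' y)^-1 =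
    (eucl_dist x' y - eucl_dist x y) / (eucl_dist x y * eucl_dist x' y).
  by field; rewrite !gt_eqF.
rewrite ler_pdivrMr ?mulr_gt0//.
apply: (@le_trans _ _ delta); first lra.
rewrite mulrAC ler_pdivlMr ?exprn_gt0//.
have h : eta * (eta / 2) <= eucl_dist x y * eucl_dist x' y.
  by apply: ler_pM => //; rewrite ?divr_ge0 ?(ltW e0).
rewrite [leRHS](_ : _ = delta * (2 * (eucl_dist x y * eucl_dist x' y))); last by ring.
by rewrite ler_wpM2l//; lra.
Qed.

(** Among the densities with a given bound and a given mass the continuity is
    uniform: integrate [inv_dist_shift] against the density, the mass controlling
    the Lipschitz part and the bound the singular one. *)
Lemma potential_unif_cont (M N eps : R) : 0 <= M -> 0 <= N -> 0 < eps ->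
  exists2 delta, 0 < delta & forall g, measurable_fun setT g -> (forall y, 0 <= g y) ->
    (I3 g <= N%:E)%E -> {ae @leb3 R, forall y, g y <= M} ->
    forall x x', eucl_dist x x' <= delta ->
      (potential g x <= potential g x' + eps%:E)%E.
Proof.
move=> M0 N0 eps0; have S0 := sing_mass_ge0 R; set S := sing_mass R in S0.
have MS1 : 0 < 2 * (M * S + 1) by rewrite mulr_gt0// ltr_wpDl// mulr_ge0.
pose eta := Num.min 1 (eps / (2 * (M * S + 1))).
have e0 : 0 < eta by rewrite lt_min ltr01 divr_gt0.
have e1 : eta <= 1 by rewrite ge_min lexx.
have e2 : eta * (M * S) <= eps / 2.
  apply: (@le_trans _ _ (eps / (2 * (M * S + 1)) * (M * S + 1))).
    apply: ler_pM; rewrite ?(ltW e0) ?mulr_ge0 ?lerDl//.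
    by rewrite ge_min lexx orbT.
  by rewrite le_eqVlt; apply/orP; left; apply/eqP; field; rewrite gt_eqF// ltr_wpDl// mulr_ge0.
have N1 : 0 < 4 * (N + 1) by rewrite mulr_gt0// ltr_wpDl.
pose delta := Num.min (eta / 2) (eps * eta ^+ 2 / (4 * (N + 1))).
have d0 : 0 < delta by rewrite lt_min !divr_gt0// mulr_gt0// exprn_gt0.
have d1 : delta <= eta / 2 by rewrite ge_min lexx.
have d2 : 2 * delta / eta ^+ 2 * N <= eps / 2.
  have d3 : delta <= eps * eta ^+ 2 / (4 * (N + 1)) by rewrite ge_min lexx orbT.
  apply: (@le_trans _ _ (2 * (eps * eta ^+ 2 / (4 * (N + 1))) / eta ^+ 2 * (N + 1))).
    apply: ler_pM; rewrite ?lerDl//; first by apply: divr_ge0; [apply: mulr_ge0 => //; exact: ltW|exact: sqr_ge0].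
    by rewrite ler_wpM2r ?invr_ge0 ?exprn_ge0 ?(ltW e0)// ler_wpM2l.
  rewrite le_eqVlt; apply/orP; left; apply/eqP; field.
  by rewrite !gt_eqF// ltr_wpDl.
exists delta => // g mg g0 gN gM x x' xx'.
have mV y : measurable_fun setT (fun z => g z / eucl_dist y z) by exact: measurable_potential_integrand.
have V0 y : forall z, 0 <= g z / eucl_dist y z by exact: potential_integrand_ge0.
have ms5 : measurable_fun setT (fun z => sing2 x z ^+ 5).
  by apply: measurable_funX; exact: measurable_sing2r.
have mgs : measurable_fun setT (fun z => g z * sing2 x z ^+ 5) by exact: measurable_funM.
have s50 z : 0 <= sing2 x z ^+ 5 by rewrite exprn_ge0// sing2_ge0.
have gs0 z : 0 <= g z * sing2 x z ^+ 5 by rewrite mulr_ge0.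
have D0 : 0 <= 2 * delta / eta ^+ 2 by apply: divr_ge0; [apply: mulr_ge0 => //; exact: ltW|exact: sqr_ge0].
have mDg : measurable_fun setT (fun z => 2 * delta / eta ^+ 2 * g z) by exact: measurable_funM.
have Dg0 z : 0 <= 2 * delta / eta ^+ 2 * g z by rewrite mulr_ge0.
have mes : measurable_fun setT (fun z => eta * (g z * sing2 x z ^+ 5)) by exact: measurable_funM.
have es0 z : 0 <= eta * (g z * sing2 x z ^+ 5) by rewrite mulr_ge0 ?(ltW e0).
apply: (@le_trans _ _ (I3 (fun z => (g z / eucl_dist x' z +
   (2 * delta / eta ^+ 2 * g z + eta * (g z * sing2 x z ^+ 5)))))).
  apply: le_nnint => //.
    by apply: measurable_funD => //; exact: measurable_funD.
  move=> z.
  have eta01 : 0 < eta <= 1 by rewrite e0 e1.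
  have del01 : 0 <= delta <= eta / 2 by rewrite d1 ltW.
  apply: le_trans (ler_wpM2l (g0 z) (inv_dist_shift z eta01 del01 xx')) _.
  by rewrite le_eqVlt; apply/orP; left; apply/eqP; ring.
rewrite (nnintD _ (mV x') (measurable_funD mDg mes) (V0 x') (fun z => addr_ge0 (Dg0 z) (es0 z))).
apply: leeD => //.
rewrite (nnintD _ mDg mes Dg0 es0) (nnintZ _ mg g0 D0) (nnintZ _ mgs gs0 (ltW e0)).
have -> : eps%:E = ((eps / 2)%:E + (eps / 2)%:E)%E by rewrite -EFinD; congr EFin; lra.
apply: leeD.
  apply: (@le_trans _ _ ((2 * delta / eta ^+ 2)%:E * N%:E)%E).
    by apply: lee_wpmul2l; rewrite ?lee_fin.
  by rewrite -EFinM lee_fin.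
apply: (@le_trans _ _ (eta%:E * (M * S)%:E)%E); last by rewrite -EFinM lee_fin.
apply: lee_wpmul2l; first by rewrite lee_fin ltW.
rewrite EFinM -(nnint_sing2_5 x) -(nnintZ _ ms5 s50 M0).
apply: ae_le_nnint => //.
- exact: measurable_funM.
- by move=> z; rewrite mulr_ge0.
- by apply: filterS gM => z gz; rewrite ler_wpM2r.
Qed.

End potential_continuity.

(** * Disks and cylindrical coordinates *)
Section disks.
Variable R : realType.
Local Notation leb := (@lebesgue_measure R).
Local Notation leb2 := (@leb2 R).
Local Notation RR := (measurableTypeR R * measurableTypeR R)%type.

Definition sqr_radius (p : RR) : measurableTypeR R := (p.1 : R) ^+ 2 + (p.2 : R) ^+ 2.

Lemma measurable_sqr_radius : measurable_fun setT sqr_radius.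
Proof.
by apply: measurable_funD; apply: measurable_funX;
  [exact: measurable_fst|exact: measurable_snd].
Qed.

Lemma sqr_radius_ge0 p : 0 <= (sqr_radius p : R).
Proof. by rewrite addr_ge0// sqr_ge0. Qed.

Definition disk (t : R) : set RR := [set p | (sqr_radius p : R) <= t].

Lemma measurable_disk t : measurable (disk t).
Proof. by apply: measurable_set_le => //; exact: measurable_sqr_radius. Qed.

Lemma leb2_tonelli (f : RR -> \bar R) : measurable_fun setT f -> (forall p, 0 <= f p)%E ->
  (\int[leb2]_p f p = \int[leb]_u \int[leb]_v f (u, v))%E.
Proof. by move=> mf f0; rewrite (fubini_tonelli1 (m1 := leb) (m2 := leb) f mf f0). Qed.

Lemma leb2_dilate a (f : RR -> \bar R) : 0 < a -> measurable_fun setT f ->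
  (forall p, 0 <= f p)%E ->
  (\int[leb2]_p f (a * p.1, a * p.2)%R = (a ^- 2)%:E * \int[leb2]_p f p)%E.
Proof.
move=> a0 mf f0; have an0 := lt0r_neq0 a0.
have mphi : measurable_fun setT (fun p : RR => (a * p.1, a * p.2) : RR).
  by apply: measurable_fun_pair; apply: measurable_funM.
have mF := measurableT_comp mf mphi.
rewrite (leb2_tonelli mF (fun _ => f0 _)) (leb2_tonelli mf f0).
have m2 u : measurable_fun setT (fun v => f (u, v)).
  exact: (measurableT_comp mf (measurable_pair1 u)).
have mg : measurable_fun setT (fun u => \int[leb]_v f (u, v))%E.
  exact: (measurable_fun_fubini_tonelli_F (m2 := leb) f mf f0).
have g0 u : (0 <= \int[leb]_v f (u, v))%E by exact: integral_ge0.
have ia : (0 <= (a^-1)%:E)%E by rewrite lee_fin invr_ge0 ltW.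
transitivity (\int[leb]_u ((a^-1)%:E * \int[leb]_v f (a * u + 0, v)%R))%E.
  apply: eq_integral => u _.
  have := lebesgue_affine 0 an0 (m2 (a * u + 0)) (fun v => f0 _).
  rewrite gtr0_norm// => <-.
  by apply: eq_integral => v _; rewrite /= !addr0.
rewrite (ge0_integralZl _ measurableT (measurableT_comp mg (measurable_affine a 0))
  (fun u _ => g0 _) ia).
rewrite (lebesgue_affine 0 an0 mg g0) gtr0_norm// muleA -EFinM.
by rewrite -invfM -expr2.
Qed.

Lemma leb2_box (A B : set (measurableTypeR R)) : measurable A -> measurable B ->
  leb2 (A `*` B) = (leb A * leb B)%E.
Proof. by move=> mA mB; exact: (product_measure1E leb leb mA mB). Qed.

(** The number [pi], left unevaluated as it cancels from Newton's theorem. *)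
Definition disk_area : R := fine (leb2 (disk 1)).

Lemma leb2_disk1 : leb2 (disk 1) = disk_area%:E.
Proof.
rewrite /disk_area fineK// ge0_fin_numE//.
pose I := `[- 1, 1]%classic : set (measurableTypeR R).
have mI : measurable I by exact: measurable_itv.
apply: (@le_lt_trans _ _ (leb2 (I `*` I))).
  apply: le_measure; rewrite ?inE; [exact: measurable_disk|exact: measurableX|].
  move=> [u v]; rewrite /disk /sqr_radius /I /= !in_itv/= => h.
  by have := sqr_ge0 u; have := sqr_ge0 v; split; apply/andP; split; nra.
rewrite leb2_box// lebesgue_measure_itv/=.
by case: ifPn => _; rewrite -?EFinB -?EFinM ?ltry// !mul0e ltry.
Qed.

Lemma disk_area_gt0 : 0 < disk_area.
Proof.
rewrite -lte_fin -leb2_disk1.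
pose I := `[- 2^-1, 2^-1]%classic : set (measurableTypeR R).
have mI : measurable I by exact: measurable_itv.
apply: (@lt_le_trans _ _ (leb2 (I `*` I))).
  rewrite leb2_box// lebesgue_measure_itv/= lte_fin gtrN ?invr_gt0//.
  by rewrite -EFinB -!EFinM lte_fin !mulr_gt0//; lra.
apply: le_measure; rewrite ?inE; [exact: measurableX|exact: measurable_disk|].
move=> [u v]; rewrite /disk /sqr_radius /I /= !in_itv/= => -[/andP[? ?] /andP[? ?]].
by nra.
Qed.

(** A disk is a dilation of the unit disk. *)
Lemma leb2_disk t : 0 <= t -> leb2 (disk t) = (t * disk_area)%:E.
Proof.
have pos s : 0 < s -> leb2 (disk s) = (s * disk_area)%:E.
  move=> s0; have q0 : 0 < Num.sqrt s by rewrite sqrtr_gt0.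
  have mD : measurable_fun setT (fun p => (\1_(disk s) p)%:E : \bar R).
    by apply/measurable_EFinP/measurable_indic; exact: measurable_disk.
  have D0 p : (0 <= (\1_(disk s) p)%:E :> \bar R)%E by rewrite lee_fin indicE.
  have := leb2_dilate q0 mD D0.
  rewrite (eq_integral (fun p => (\1_(disk 1) p)%:E)); last first.
    move=> p _; rewrite !indicE; congr (_%:R)%:E; congr nat_of_bool.
    apply/idP/idP; rewrite !inE /disk /sqr_radius/= !exprMn sqr_sqrtr ?(ltW s0)// -mulrDr;
      by rewrite ger_pMr.
  rewrite !integral_indic ?setIT//; [|exact: measurable_disk|exact: measurable_disk].
  move=> h; have {}h : leb2 (disk 1) = ((Num.sqrt s ^- 2)%:E * leb2 (disk s))%E by exact: h.
  rewrite EFinM -leb2_disk1 h sqr_sqrtr ?(ltW s0)// muleA -EFinM divff ?mul1e//.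
  exact: lt0r_neq0.
rewrite le_eqVlt => /predU1P[<-|]; last exact: pos.
rewrite mul0r; apply/eqP; rewrite eq_le measure_ge0 andbT.
apply/lee_addgt0Pr => e e0; rewrite add0e.
have ed : 0 < e / disk_area by rewrite divr_gt0// disk_area_gt0.
have <- : leb2 (disk (e / disk_area)) = e%:E.
  by rewrite pos// divfK// gt_eqF// disk_area_gt0.
apply: le_measure; rewrite ?inE; [exact: measurable_disk|exact: measurable_disk|].
by move=> p; rewrite /disk/= => /le_trans; apply; exact: ltW.
Qed.

End disks.

Section cylindrical.
Variable R : realType.
Local Notation leb := (@lebesgue_measure R).
Local Notation leb2 := (@leb2 R).
Local Notation RR := (measurableTypeR R * measurableTypeR R)%type.
Local Notation alpha := (disk_area R).

Let alphaV_ge0 : 0 <= alpha^-1.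
Proof. by rewrite invr_ge0 ltW// disk_area_gt0. Qed.

Let neg : set (measurableTypeR R) := `]-oo, 0]%classic.
Let mneg : measurable neg. Proof. exact: measurable_itv. Qed.

Lemma leb2_annulus (a b : R) : 0 <= a -> a <= b ->
  leb2 (disk b `\` disk a) = ((b - a) * alpha)%:E.
Proof.
move=> a0 ab; have b0 := le_trans a0 ab.
have F : (leb2 (disk b) < +oo)%E by rewrite (leb2_disk b0) ltry.
have := measureD (measurable_disk b) (measurable_disk a) F.
rewrite setIidr; last by move=> p; rewrite /disk/= => /le_trans; exact.
move=> h; have {}h : leb2 (disk b `\` disk a) = (leb2 (disk b) - leb2 (disk a))%E by exact: h.
by rewrite h (leb2_disk a0) (leb2_disk b0) -EFinB mulrBl.
Qed.

(** The push-forward of the plane's Lebesgue measure under the squared radius is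
    proportional to Lebesgue measure on the half-line; completing it on the
    negative half-line makes uniqueness of Lebesgue measure applicable. *)
Lemma pushforward_sqr_radius (A : set (measurableTypeR R)) : measurable A ->
  A `<=` `[0, +oo[%classic -> leb2 (@sqr_radius R @^-1` A) = (alpha%:E * leb A)%E.
Proof.
move=> mA A0.
pose msr := @measurable_sqr_radius R.
pose nu : {measure set (measurableTypeR R) -> \bar R} := pushforward leb2 (@sqr_radius R).
pose m1 := mscale (NngNum alphaV_ge0) (nu msr).
pose m2 := mrestr leb mneg.
have addE B : measure_add m1 m2 B = (m1 B + m2 B)%E by exact: measure_addE.
have E B : measurable B -> leb B = measure_add m1 m2 B.
  apply: lebesgue_measure_unique => // _ [[u v]] _ <-.
  suff : leb `]u, v]%classic = (m1 `]u, v]%classic + m2 `]u, v]%classic)%E.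
    by move=> ->; exact: esym (addE _).
  have -> : m2 `]u, v]%classic = leb (`]u, v]%classic `&` neg) by [].
  have -> : m1 `]u, v]%classic = ((alpha^-1)%:E * leb2 (@sqr_radius R @^-1` `]u, v]%classic))%E by [].
  have [vu|uv] := leP v u.
    rewrite set_itv_ge; last by rewrite bnd_simp -leNgt.
    by rewrite preimage_set0 set0I !measure0 mule0 adde0.
  have luv (a b : R) : a <= b -> leb `]a, b]%classic = (b - a)%:E.
    rewrite le_eqVlt => /predU1P[->|ab].
      by rewrite set_itv_ge ?measure0 ?subrr// bnd_simp ltxx.
    by rewrite lebesgue_measure_itv/= lte_fin ab EFinB.
  rewrite (luv _ _ (ltW uv)); have alpha0 : alpha != 0 by rewrite gt_eqF// disk_area_gt0.
  have [v0|v0] := ltP v 0.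
    have -> : @sqr_radius R @^-1` `]u, v]%classic = set0.
      rewrite -subset0 => p /=; rewrite in_itv/= => /andP[_ h].
      by have := le_lt_trans (le_trans (sqr_radius_ge0 p) h) v0; rewrite ltxx.
    rewrite measure0 mule0 add0e setIidl ?(luv _ _ (ltW uv))//.
    by move=> t; rewrite /neg/= !in_itv/= => /andP[_ /le_trans]; apply; exact: ltW.
  have [u0|u0] := ltP u 0.
    have -> : @sqr_radius R @^-1` `]u, v]%classic = disk v.
      apply/seteqP; split=> p; rewrite /disk/= in_itv/=; first by case/andP.
      by move=> ->; rewrite (lt_le_trans u0)// sqr_radius_ge0.
    have -> : `]u, v]%classic `&` neg = `]u, 0]%classic.
      apply/seteqP; split=> t; rewrite /neg/= !in_itv/=.
        by move=> [/andP[-> _] ->].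
      by move=> /andP[-> t0]; rewrite t0 (le_trans t0).
    rewrite (luv _ _ (ltW u0)) (leb2_disk v0) -EFinM -EFinD; congr EFin.
    by field.
  have -> : @sqr_radius R @^-1` `]u, v]%classic = disk v `\` disk u.
    apply/seteqP; split=> p; rewrite /disk/= in_itv/=.
      by move=> /andP[h ->]; split => //; apply/negP; rewrite -ltNge.
    by move=> [-> /negP]; rewrite -ltNge => ->.
  have -> : `]u, v]%classic `&` neg = set0.
    rewrite -subset0 => t; rewrite /neg/= !in_itv/= => -[/andP[ut _] t0].
    by have := lt_le_trans (le_lt_trans u0 ut) t0; rewrite ltxx.
  rewrite measure0 adde0 leb2_annulus ?(ltW uv)// -EFinM; congr EFin.
  by field.
have := E A mA; rewrite addE.
have -> : m2 A = leb (A `&` neg) by [].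
have -> : m1 A = ((alpha^-1)%:E * leb2 (@sqr_radius R @^-1` A))%E by [].
have -> : leb (A `&` neg) = 0.
  apply/eqP; rewrite eq_le measure_ge0 andbT -(lebesgue_measure_set1 (0 : R)).
  apply: le_measure; rewrite ?inE//; first exact: measurableI.
  move=> t [/A0]; rewrite /neg /= !in_itv/= andbT => t0 t1.
  by apply/eqP; rewrite eq_le t1 t0.
move=> ->; rewrite adde0 muleA -EFinM divff ?mul1e// gt_eqF// disk_area_gt0//.
Qed.

Lemma integral_sqr_radius (phi : measurableTypeR R -> \bar R) :
  measurable_fun setT phi -> (forall t, 0 <= phi t)%E ->
  (\int[leb2]_p phi (sqr_radius p) = alpha%:E * \int[leb]_(t in `[0%R, +oo[) phi t)%E.
Proof.
move=> mphi phi0; pose msr := @measurable_sqr_radius R.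
have mD : measurable (`[0, +oo[%classic : set (measurableTypeR R)) by exact: measurable_itv.
have mphi' : measurable_fun (`[0, +oo[%classic : set (measurableTypeR R)) phi.
  exact: measurable_funTS.
have -> : (\int[leb2]_p phi (sqr_radius p) =
    \int[pushforward leb2 (@sqr_radius R)]_(t in `[0%R, +oo[) phi t)%E.
  rewrite (ge0_integral_pushforward msr leb2 mD mphi')//.
  suff -> : @sqr_radius R @^-1` `[0%R, +oo[%classic = setT by [].
  by apply/seteqP; split => // p _ /=; rewrite in_itv/= andbT sqr_radius_ge0.
have a0 : 0 <= alpha by rewrite ltW// disk_area_gt0.
rewrite -(ge0_integral_mscale _ mD (NngNum a0) mphi' (fun t _ => phi0 t)).
by apply: eq_measure_integral => A mA A0; exact: pushforward_sqr_radius.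
Qed.

Lemma leb3_cylindrical (psi : measurableTypeR R * measurableTypeR R -> \bar R) :
  measurable_fun setT psi -> (forall p, 0 <= psi p)%E ->
  (\int[@leb3 R]_x psi (sqr_radius x.1, x.2) =
   alpha%:E * \int[leb]_w \int[leb]_(t in `[0%R, +oo[) psi (t, w))%E.
Proof.
move=> mpsi psi0.
have mf : measurable_fun setT (fun x : 'R3 R => psi (sqr_radius x.1, x.2)).
  apply: (measurableT_comp mpsi); apply: measurable_fun_pair => //.
  exact: (measurableT_comp (@measurable_sqr_radius R) measurable_fst).
rewrite integral_leb3E (fubini_tonelli2 (m1 := leb2) (m2 := leb) _ mf (fun _ => psi0 _)).
have m1 w : measurable_fun setT (fun t => psi (t, w)).
  exact: (measurableT_comp mpsi (pair2_measurable w)).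
have mD : measurable (`[0, +oo[%classic : set (measurableTypeR R)) by exact: measurable_itv.
have m2 : measurable_fun setT (fun w => \int[leb]_(t in `[0%R, +oo[) psi (t, w))%E.
  pose psi' (p : measurableTypeR R * measurableTypeR R) := ((\1_`[0%R, +oo[%classic p.1 : R)%:E * psi p)%E.
  have mpsi' : measurable_fun setT psi'.
    apply: emeasurable_funM => //; apply/measurable_EFinP.
    exact: (measurableT_comp (measurable_indic mD) measurable_fst).
  have psi'0 p : (0 <= psi' p)%E by rewrite mule_ge0// lee_fin indicE.
  have := measurable_fun_fubini_tonelli_G (m1 := leb) psi' mpsi' psi'0.
  rewrite (_ : fubini_G _ _ = fun w => \int[leb]_(t in `[0%R, +oo[) psi (t, w))%E//.
  apply/funext => w; rewrite /fubini_G [RHS]integral_mkcond.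
  apply: eq_integral => t _; rewrite /psi' /= patchE indicE.
  by case: ifPn => _; rewrite ?mul1e ?mul0e.
rewrite -(ge0_integralZl _ measurableT m2); last 2 first.
- by move=> w _; exact: integral_ge0.
- by rewrite lee_fin ltW// disk_area_gt0.
apply: eq_integral => w _.
by rewrite /fubini_G (integral_sqr_radius (m1 w) (fun t => psi0 _)).
Qed.

End cylindrical.

(** * Newton's theorem on the axis *)
Section newton.
Variable R : realType.
Local Notation leb := (@lebesgue_measure R).
Local Notation alpha := (disk_area R).
Local Notation I3 f := (nnint (@leb3 R) f%R).
Implicit Types (a s h c : R).

(** [continuous_FTC2], with hypotheses in the form in which they arise here and with
    degenerate intervals allowed. *)
Lemma FTC_closed (f F : R -> R) a b : a <= b ->
  (forall x, a <= x <= b -> {for x, continuous f}) -> continuous F ->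
  (forall x, a < x < b -> derivable F x 1 /\ 'D_1 F x = f x) ->
  (\int[leb]_(x in `[a, b]) (f x)%:E = (F b - F a)%:E)%E.
Proof.
rewrite le_eqVlt => /predU1P[<- _ _ _|ab cf cF dF].
  by rewrite set_itv1 integral_set1 subrr.
rewrite EFinB; apply: continuous_FTC2 => //.
- by apply: continuous_in_subspaceT => x; rewrite inE/= in_itv/= => /cf.
- split.
  + by move=> x; rewrite in_itv/= => /dF [].
  + exact/cvg_at_right_filter/cF.
  + exact/cvg_at_left_filter/cF.
- by move=> x; rewrite in_itv/= => /dF [_ h]; rewrite derive1E.
Qed.

Lemma integral_inv_sqrt h c : 0 < h -> 0 <= c ->
  (\int[leb]_(t in `[0%R, c]) ((Num.sqrt (t + h ^+ 2))^-1)%:E =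
   (2 * Num.sqrt (c + h ^+ 2) - 2 * h)%:E)%E.
Proof.
move=> h0 c0; have h2 : 0 < h ^+ 2 by rewrite exprn_gt0.
have cX : continuous (fun t : R => t + h ^+ 2).
  by move=> t; apply: cvgD; [exact: cvg_id|exact: cvg_cst].
have cS : continuous (fun t : R => Num.sqrt (t + h ^+ 2)).
  move=> t; apply: (@continuous_comp _ _ _ (fun t => t + h ^+ 2) Num.sqrt); first exact: cX.
  exact: sqrt_continuous.
rewrite (FTC_closed (F := fun t => 2 * Num.sqrt (t + h ^+ 2)) c0).
- by rewrite add0r sqrtr_sqr gtr0_norm.
- move=> t /andP[t0 _]; apply: cvgV; last exact: cS.
  by rewrite gt_eqF// sqrtr_gt0 ltr_wpDl.
- by move=> t; apply: cvgM; [exact: cvg_cst|exact: cS].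
move=> t /andP[t0 _].
have p : 0 < t + h ^+ 2 by rewrite addr_gt0.
have ds := is_derive1_sqrt p.
have dx : is_derive t 1 (fun t : R => t + h ^+ 2) (1 + 0) by apply: is_deriveD.
have dc := @is_derive1_comp R Num.sqrt (fun t : R => t + h ^+ 2) t _ _ ds dx.
have dT := is_deriveZ 2 dc; split; first by case: dT.
have n0 : Num.sqrt (t + h ^+ 2) != 0 by rewrite gt_eqF// sqrtr_gt0.
rewrite [LHS](_ : _ = 2 *: ((2 * Num.sqrt (t + h ^+ 2))^-1 * (1 + 0))).
  by rewrite /GRing.scale/=; field.
by case: dT => _ ->.
Qed.

(** The remaining integral over the height [w] in Newton's theorem for a ball: the
    argument of the root is affine in [w]. *)
Lemma integral_outer a s : 0 < s <= a ->
  (\int[leb]_(w in `[(- s)%R, s])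
     (2 * Num.sqrt (s ^+ 2 - w ^+ 2 + (a - w) ^+ 2) - 2 * (a - w))%:E =
   (4 / 3 * s ^+ 3 / a)%:E)%E.
Proof.
move=> /andP[s0 sa]; have a0 : 0 < a by exact: lt_le_trans sa.
pose X w : R := s ^+ 2 + a ^+ 2 - 2 * a * w.
have XE w : s ^+ 2 - w ^+ 2 + (a - w) ^+ 2 = X w by rewrite /X; ring.
under eq_integral do rewrite XE.
have cX : continuous X.
  move=> w; apply: cvgB; first exact: cvg_cst.
  by apply: cvgM; [exact: cvg_cst|exact: cvg_id].
have cS : continuous (fun w => Num.sqrt (X w)).
  move=> w; apply: (@continuous_comp _ _ _ X Num.sqrt); first exact: cX.
  exact: sqrt_continuous.
rewrite (FTC_closed (F := fun w => - (2 / (3 * a)) * Num.sqrt (X w) ^+ 3 + (w ^+ 2 - 2 * a * w))).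
- have -> : X s = (a - s) ^+ 2 by rewrite /X; ring.
  have -> : X (- s) = (a + s) ^+ 2 by rewrite /X; ring.
  rewrite !sqrtr_sqr !ger0_norm ?subr_ge0// ?addr_ge0 ?(ltW s0) ?(ltW a0)//.
  by congr EFin; field; rewrite gt_eqF.
- by rewrite ge0_cp// ltW.
- move=> w _; apply: cvgB; first by apply: cvgM; [exact: cvg_cst|exact: cS].
  by apply: cvgM; [exact: cvg_cst|apply: cvgB; [exact: cvg_cst|exact: cvg_id]].
- move=> w; apply: cvgD.
    apply: cvgM; first exact: cvg_cst.
    apply: (@continuous_comp _ _ _ (fun w => Num.sqrt (X w)) (fun y => y ^+ 3)); first exact: cS.
    exact: exprn_continuous.
  apply: cvgB; first exact: exprn_continuous.
  by apply: cvgM; [exact: cvg_cst|exact: cvg_id].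
move=> w /andP[ws wl].
have p : 0 < X w.
  have -> : X w = (a - s) ^+ 2 + 2 * a * (s - w) by rewrite /X; ring.
  by rewrite ltr_wpDl ?sqr_ge0// !mulr_gt0// subr_gt0.
have ds := is_derive1_sqrt p.
have dw := is_derive_id (w : R) (1 : R).
have dX : is_derive w 1 X (0 - (2 * a) *: 1).
  exact: (is_deriveB (is_derive_cst (s ^+ 2 + a ^+ 2 : R) w 1) (is_deriveZ (2 * a) dw)).
have dc := @is_derive1_comp R Num.sqrt X w _ _ ds dX.
have d3 := is_deriveX 3 dc.
have d3' := is_deriveZ (- (2 / (3 * a))) d3.
have dl := is_deriveB (is_deriveX 2 dw) (is_deriveZ (2 * a) dw).
have dT := is_deriveD d3' dl; split; first by case: dT.
have n0 : Num.sqrt (X w) != 0 by rewrite gt_eqF// sqrtr_gt0.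
case: dT => _ dTE; apply: etrans dTE _; rewrite /GRing.scale/=.
by field; rewrite n0 gt_eqF.
Qed.

Lemma oballE s x : 0 < s -> oball s x <-> ((sqr_radius x.1 : R) + (x.2 : R) ^+ 2 < s ^+ 2).
Proof.
by move=> s0; rewrite /oball/= /sqr_radius -eucl_norm_sqr ltr_pXn2r// nnegrE ?eucl_norm_ge0 ?ltW.
Qed.

(** Integration over a ball by slices at the height [w], the slice being integrated
    over the squared radius [t]. *)
Lemma integral_oball s (g : measurableTypeR R * measurableTypeR R -> R) (J : R -> R) :
  0 < s -> measurable_fun setT g -> (forall p, 0 <= g p) ->
  measurable_fun setT J ->
  (forall w, - s < w < s ->
     (\int[leb]_(t in `[0%R, (s ^+ 2 - w ^+ 2)%R]) (g (t, w))%:E = (J w)%:E)%E) ->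
  (I3 (fun x => \1_(oball s) x * g (sqr_radius x.1, x.2)) =
   alpha%:E * \int[leb]_(w in `[(- s)%R, s]) (J w)%:E)%E.
Proof.
move=> s0 mg g0 mJ gJ.
pose D : set (measurableTypeR R * measurableTypeR R) :=
  [set p | (p.1 : R) + (p.2 : R) ^+ 2 < s ^+ 2].
have mD : measurable D.
  apply: measurable_set_lt => //; apply: measurable_funD; first exact: measurable_fst.
  by apply: measurable_funX; exact: measurable_snd.
pose psi p : \bar R := (\1_D p * g p)%:E.
have mpsi : measurable_fun setT psi.
  by apply/measurable_EFinP/measurable_funM => //; exact: measurable_indic.
have psi0 p : (0 <= psi p)%E by rewrite lee_fin mulr_ge0// indicE.
have -> : I3 (fun x => \1_(oball s) x * g (sqr_radius x.1, x.2)) =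
    (\int[@leb3 R]_x psi (sqr_radius x.1, x.2))%E.
  apply: eq_integral => x _; rewrite /psi !indicE; congr (_%:R * _)%:E.
  congr nat_of_bool; apply/idP/idP; rewrite !inE /D/=.
    by move/(oballE _ s0).
  by move=> h; apply/(oballE _ s0).
rewrite (leb3_cylindrical mpsi psi0); congr (_ * _)%E.
rewrite integral_itv_bndoo; last first.
  by apply/measurable_EFinP; exact: measurable_funTS.
rewrite [RHS]integral_mkcond; apply: eq_integral => w _.
rewrite patchE; case: ifPn => ws.
  have {}ws : - s < w < s by move: ws; rewrite mem_setE in_itv.
  rewrite -gJ// -integral_itv_bndo_bndc; last first.
    by apply/measurable_EFinP/measurable_funTS; exact: (measurableT_comp mg (pair2_measurable w)).
  rewrite integral_mkcond [RHS]integral_mkcond; apply: eq_integral => t _.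
  rewrite !patchE /psi !mem_setE !in_itv/= andbT indicE.
  have -> : ((t, w) \in D) = (t < s ^+ 2 - w ^+ 2).
    by apply/idP/idP; rewrite inE /D/= ltrBrDr.
  by case: leP => //= _; case: ifPn => _; rewrite ?mul1r ?mul0r.
apply: integral0_eq => t; rewrite /= in_itv/= andbT => t0.
rewrite /psi indicE memNset ?mul0r// /D/= => h.
move: ws; rewrite mem_setE in_itv/= -ltr_norml => /negP; apply.
rewrite -(@ltr_pXn2r _ 2) ?nnegrE ?(ltW s0)// real_normK ?num_real//.
by rewrite (le_lt_trans _ h)// lerDr.
Qed.

Lemma leb3_oball s : 0 < s -> @leb3 R (oball s) = (alpha * (4 / 3 * s ^+ 3))%:E.
Proof.
move=> s0; rewrite -nnint_indic; last exact: measurable_oball.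
pose g1 (p : measurableTypeR R * measurableTypeR R) : R := 1.
have -> : nnint (@leb3 R) \1_(oball s) = I3 (fun x => \1_(oball s) x * g1 (sqr_radius x.1, x.2)).
  by apply: eq_nnint => x; rewrite mulr1.
rewrite (integral_oball (g := g1) (J := fun w => s ^+ 2 - w ^+ 2) s0)//.
- rewrite EFinM; congr (_ * _)%E.
  rewrite (FTC_closed (F := fun w => s ^+ 2 * w - 3^-1 * w ^+ 3)).
  + by congr EFin; field.
  + by rewrite ge0_cp// ltW.
  + by move=> w _; apply: cvgB; [exact: cvg_cst|exact: exprn_continuous].
  + move=> w; apply: cvgB; first by apply: cvgM; [exact: cvg_cst|exact: cvg_id].
    by apply: cvgM; [exact: cvg_cst|exact: exprn_continuous].
  move=> w _; have dw := is_derive_id (w : R) (1 : R).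
  have dT := is_deriveB (is_deriveZ (s ^+ 2) dw) (is_deriveZ 3^-1 (is_deriveX 3 dw)).
  split; first by case: dT.
  by case: dT => _ dTE; apply: etrans dTE _; rewrite /GRing.scale/=; field.
- exact: measurable_cst.
- by apply: measurable_funB => //; exact: measurable_funX.
- move=> w /andP[w1 w2].
  rewrite (_ : (\int[leb]_(t in `[0%R, (s ^+ 2 - w ^+ 2)%R]) (g1 (t, w))%:E)%E =
    leb `[0%R, (s ^+ 2 - w ^+ 2)%R]%classic); last first.
    by rewrite -[RHS]mul1e -integral_cst//; exact: measurable_itv.
  rewrite lebesgue_measure_itv/= lte_fin.
  have h : 0 < s ^+ 2 - w ^+ 2 by rewrite subr_sqr mulr_gt0//; lra.
  by rewrite h sube0.
Qed.

(** The slice at the height [w] is integrated with [integral_inv_sqrt], the heights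
    with [integral_outer]. *)
Lemma newton_oball a s : 0 < s <= a ->
  I3 (fun y => \1_(oball s) y / eucl_dist (0, 0, a) y) =
  ((a^-1)%:E * @leb3 R (oball s))%E.
Proof.
move=> /andP[s0 sa]; have a0 : 0 < a by exact: lt_le_trans sa.
pose g (p : measurableTypeR R * measurableTypeR R) : R :=
  (Num.sqrt ((p.1 : R) + (a - p.2) ^+ 2))^-1.
have mg : measurable_fun setT g.
  apply: measurable_inv_ge0; last by move=> p; exact: sqrtr_ge0.
  apply: measurableT_comp; first exact: measurable_sqrtr.
  apply: measurable_funD; first exact: measurable_fst.
  by apply: measurable_funX; apply: measurable_funB => //; exact: measurable_snd.
have -> : I3 (fun y => \1_(oball s) y / eucl_dist (0, 0, a) y) =
    I3 (fun x => \1_(oball s) x * g (sqr_radius x.1, x.2)).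
  apply: eq_nnint => x; congr (_ * _^-1); rewrite /eucl_dist /sqr_radius/=.
  by rewrite !sub0r !sqrrN.
rewrite (integral_oball (J := fun w =>
   2 * Num.sqrt (s ^+ 2 - w ^+ 2 + (a - w) ^+ 2) - 2 * (a - w)) s0 mg).
- rewrite integral_outer ?s0// leb3_oball// -!EFinM; congr EFin; field.
  by rewrite gt_eqF.
- by move=> p; rewrite invr_ge0 sqrtr_ge0.
- apply: measurable_funB; last by apply: measurable_funM => //; exact: measurable_funB.
  apply: measurable_funM => //; apply: measurableT_comp; first exact: measurable_sqrtr.
  apply: measurable_funD; first by apply: measurable_funB => //; exact: measurable_funX.
  by apply: measurable_funX; exact: measurable_funB.
- move=> w /andP[w1 w2].
  have h1 : 0 < a - w by lra.
  have h2 : 0 <= s ^+ 2 - w ^+ 2 by rewrite subr_sqr mulr_ge0//; lra.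
  rewrite -(integral_inv_sqrt h1 h2); apply: eq_integral => t _; rewrite /g/=.
  by [].
Qed.

End newton.

(** * Newton's theorem for symmetric decreasing densities *)
Section newton_radial.
Variable R : realType.
Local Notation leb := (@lebesgue_measure R).
Local Notation I3 f := (nnint (@leb3 R) f%R).
Implicit Types (x y : 'R3 R) (rho k : 'R3 R -> R).

Definition cball3 (r : R) : set ('R3 R) := [set x | eucl_norm x <= r].

Lemma measurable_cball3 r : measurable (cball3 r).
Proof. by apply: measurable_set_le => //; exact: measurable_eucl_norm. Qed.

(** The open balls of slightly larger radius exceed the given one by little. *)
Lemma leb3_sphere s : 0 <= s -> @leb3 R (cball3 s `\` oball s) = 0%E.
Proof.
move=> s0; apply/eqP; rewrite eq_le measure_ge0 andbT; apply/lee_addgt0Pr => e e0.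
rewrite add0e; pose K := disk_area R * (4 / 3).
have K0 : 0 < K by rewrite mulr_gt0// disk_area_gt0.
have vol r : 0 <= r -> @leb3 R (oball r) = (K * r ^+ 3)%:E.
  rewrite le_eqVlt => /predU1P[<-|r0]; last by rewrite leb3_oball// mulrA.
  rewrite expr0n mulr0 (_ : oball 0 = set0) ?measure0// -subset0 => x; rewrite /oball/=.
  by rewrite ltNge eucl_norm_ge0.
pose L := K * (3 * s ^+ 2 + 3 * s + 1).
have L0 : 0 < L.
  rewrite mulr_gt0// ltr_wpDl// addr_ge0 ?mulr_ge0 ?sqr_ge0//.
pose d := Num.min 1 (e / L).
have d0 : 0 < d by rewrite lt_min ltr01 divr_gt0.
have d1 : d <= 1 by rewrite ge_min lexx.
have d2 : L * d <= e.
  by rewrite mulrC -ler_pdivlMr// ge_min lexx orbT.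
have sd0 : 0 <= s + d by rewrite addr_ge0// ltW.
apply: (@le_trans _ _ (@leb3 R (oball (s + d) `\` oball s))).
  apply: le_measure; rewrite ?inE.
  - by apply: measurableD; [exact: measurable_cball3|exact: measurable_oball].
  - by apply: measurableD; exact: measurable_oball.
  - move=> x [h1 h2]; split => //; rewrite /oball/= (le_lt_trans h1)// ltrDl//.
have F : (@leb3 R (oball (s + d)) < +oo)%E by rewrite leb3_oball_fin.
have := measureD (measurable_oball (s + d)) (measurable_oball s) F.
rewrite setIidr; last by move=> x; rewrite /oball/= => /lt_le_trans; apply; rewrite lerDl ltW.
move=> h; have {}h : @leb3 R (oball (s + d) `\` oball s) =
  (@leb3 R (oball (s + d)) - @leb3 R (oball s))%E by exact: h.
rewrite h (vol _ sd0) (vol _ s0) -EFinB lee_fin.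
apply: le_trans d2; rewrite -mulrBr /L -mulrA ler_wpM2l ?(ltW K0)//.
have d3 : d ^+ 2 <= d by rewrite expr2 ger_pMr.
have d4 : d ^+ 3 <= d by rewrite exprS ger_pMr// (le_trans d3).
rewrite [leLHS](_ : _ = 3 * s ^+ 2 * d + 3 * s * d ^+ 2 + d ^+ 3); last by ring.
have : s * d ^+ 2 <= s * d by rewrite ler_wpM2l.
by lra.
Qed.

(** The bounding sphere of a ball is null. *)
Lemma nnint_indic_ball (S : set ('R3 R)) s k : 0 <= s -> measurable S ->
  measurable_fun setT k -> (forall y, 0 <= k y) ->
  oball s `<=` S -> S `<=` cball3 s ->
  I3 (fun y => \1_S y * k y) = I3 (fun y => \1_(oball s) y * k y).
Proof.
move=> s0 mS mk k0 sub1 sub2.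
have mo := measurable_oball s.
have i0 (A : set ('R3 R)) y : 0 <= \1_A y * k y by rewrite mulr_ge0// indicE.
have mi (A : set ('R3 R)) : measurable A -> measurable_fun setT (fun y => \1_A y * k y).
  by move=> mA; apply: measurable_funM => //; exact: measurable_indic.
have le1 y : \1_(oball s) y <= \1_S y :> R.
  rewrite !indicE; have [/set_mem h|_] := boolP (y \in oball s) => //.
  by rewrite (mem_set (sub1 _ h)).
apply/eqP; rewrite eq_le; apply/andP; split; last first.
  by apply: le_nnint; [exact: mi|exact: mi|exact: i0|move=> y; rewrite ler_wpM2r].
apply: ae_le_nnint; [exact: mi|exact: mi|exact: i0|exact: i0|].
exists (cball3 s `\` oball s); split.
- by apply: measurableD => //; exact: measurable_cball3.
- exact: leb3_sphere.
- move=> y /= h; split.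
    apply: contrapT => ny; apply: h; rewrite indicE memNset ?mul0r ?i0//.
    by move=> /sub2.
  by move=> yo; apply: h; rewrite !indicE (mem_set yo) (mem_set (sub1 _ yo)).
Qed.

(** The superlevel sets of a symmetric decreasing density are balls, open or closed. *)
Lemma newton_downset (S : set ('R3 R)) a : 0 < a -> measurable S ->
  (forall x y, S y -> eucl_norm x <= eucl_norm y -> S x) -> S `<=` cball3 a ->
  I3 (fun y => \1_S y / eucl_dist (0, 0, a) y) = I3 (fun y => \1_S y * a^-1).
Proof.
move=> a0 mS dS Sa.
have md : measurable_fun setT (fun y => (eucl_dist (0, 0, a) y)^-1).
  apply: measurable_inv_ge0; first exact: measurable_eucl_dist.
  by move=> y; exact: eucl_dist_ge0.
have d0 y : 0 <= (eucl_dist (0, 0, a) y)^-1 by rewrite invr_ge0 eucl_dist_ge0.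
have ai : 0 <= a^-1 by rewrite invr_ge0 ltW.
have [->|/set0P[y0 Sy0]] := eqVneq S set0.
  by apply: eq_nnint => y; rewrite indicE in_set0 !mul0r.
pose E := [set eucl_norm y | y in S].
have hE : has_sup E.
  split; first by exists (eucl_norm y0), y0.
  by exists a => _ [y /Sa h <-].
pose s := sup E.
have sub y : S y -> eucl_norm y <= s by move=> Sy; apply: (sup_ubound hE.2); exists y.
have s0 : 0 <= s by exact: le_trans (eucl_norm_ge0 y0) (sub _ Sy0).
have sa : s <= a by apply: ge_sup; [exact: hE.1|move=> _ [y /Sa h <-]].
have sub1 : oball s `<=` S.
  move=> x xs; have e0 : 0 < s - eucl_norm x by rewrite subr_gt0.
  have [_ [y Sy <-] xy] := sup_adherent e0 hE.
  by apply: (dS _ _ Sy); rewrite -/s in xy; lra.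
rewrite (nnint_indic_ball s0 mS md d0 sub1 sub).
rewrite (nnint_indic_ball s0 mS (measurable_cst a^-1) (fun=> ai) sub1 sub).
move: s0; rewrite le_eqVlt => /predU1P[s0|s0].
  apply: eq_nnint => y; rewrite -s0 indicE memNset ?mul0r//.
  by rewrite /oball/=; apply/negP; rewrite -leNgt eucl_norm_ge0.
rewrite newton_oball ?s0//.
transitivity (I3 (fun y => a^-1 * \1_(oball s) y)); last first.
  by apply: eq_nnint => y; rewrite mulrC.
have mi : measurable_fun setT (\1_(oball s) : _ -> R) by apply: measurable_indic; exact: measurable_oball.
have i0 (y : 'R3 R) : 0 <= \1_(oball s) y :> R by rewrite indicE.
by rewrite (nnintZ _ mi i0 ai) nnint_indic//; exact: measurable_oball.
Qed.

Lemma layer_cake rho k : measurable_fun setT rho -> (forall y, 0 <= rho y) ->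
  measurable_fun setT k -> (forall y, 0 <= k y) ->
  I3 (fun y => rho y * k y) =
  (\int[leb]_(t in `[0%R, +oo[) I3 (fun y => \1_[set y | t < rho y]%R y * k y))%E.
Proof.
move=> mr r0 mk k0.
pose E : set ('R3 R * measurableTypeR R) := [set p | 0 <= (p.2 : R)] `&` [set p | (p.2 : R) < rho p.1].
have mrho : measurable_fun setT (fun p : 'R3 R * measurableTypeR R => rho p.1).
  exact: (measurableT_comp mr measurable_fst).
have mE : measurable E.
  apply: measurableI.
    by apply: measurable_set_le => //; exact: measurable_snd.
  by apply: measurable_set_lt => //; exact: measurable_snd.
pose u (p : 'R3 R * measurableTypeR R) : \bar R := (\1_E p * k p.1)%:E.
have mu : measurable_fun setT u.
  apply/measurable_EFinP/measurable_funM; first exact: measurable_indic.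
  exact: (measurableT_comp mk measurable_fst).
have u0 p : (0 <= u p)%E by rewrite lee_fin mulr_ge0// indicE.
have := fubini_tonelli (m1 := @lebR3 R) (m2 := leb) u mu u0.
have -> : (\int[@lebR3 R]_y \int[leb]_t u (y, t) = I3 (fun y => rho y * k y))%E.
  rewrite /nnint integral_leb3E; apply: eq_integral => y _.
  have mI : measurable (`[0, rho y[%classic : set (measurableTypeR R)) by exact: measurable_itv.
  have -> : (\int[leb]_t u (y, t) = \int[leb]_t ((k y)%:E * (\1_(`[0%R, rho y[%classic) t)%:E))%E.
    apply: eq_integral => t _; rewrite /u /= EFinM muleC; congr (_ * _%:E)%E.
    rewrite !indicE; congr (_%:R); congr nat_of_bool.
    by apply/idP/idP; rewrite !inE /E/= in_itv/= => /andP.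
  rewrite ge0_integralZl ?lee_fin//; last by apply/measurable_EFinP; exact: measurable_indic.
  rewrite [X in (_ * X)%E](_ : _ = leb `[0%R, rho y[%classic); last exact: nnint_indic.
  rewrite lebesgue_measure_itv/= lte_fin EFinM muleC.
  have [h|h] := ltP 0 (rho y); first by rewrite sube0.
  by have -> : rho y = 0 by apply/eqP; rewrite eq_le h r0.
move=> ->; rewrite [RHS]integral_mkcond; apply: eq_integral => t _.
rewrite patchE mem_setE in_itv/= andbT -integral_leb3E /nnint; case: ifPn => t0.
  apply: eq_integral => y _; rewrite /u !indicE; congr (_%:R * _)%:E.
  by congr nat_of_bool; apply/idP/idP; rewrite !inE /E/=; [case|split].
apply: integral0_eq => y _; rewrite /u indicE memNset ?mul0r// /E/= => -[h _].
by rewrite h in t0.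
Qed.

(** Newton's theorem: outside of its support a radial mass distribution attracts as
    if it were concentrated at the origin. By layers it suffices to know this for
    balls. *)
Lemma potential_axis rho a : 0 < a -> measurable_fun setT rho -> (forall y, 0 <= rho y) ->
  symmetric_decreasing rho -> (forall y, a < eucl_norm y -> rho y = 0) ->
  potential rho (0, 0, a) = ((a^-1)%:E * I3 rho)%E.
Proof.
move=> a0 mr r0 sr ra.
have md : measurable_fun setT (fun y => (eucl_dist (0, 0, a) y)^-1).
  apply: measurable_inv_ge0; first exact: measurable_eucl_dist.
  by move=> y; exact: eucl_dist_ge0.
have d0 y : 0 <= (eucl_dist (0, 0, a) y)^-1 by rewrite invr_ge0 eucl_dist_ge0.
have ai : 0 <= a^-1 by rewrite invr_ge0 ltW.
rewrite /potential (layer_cake mr r0 md d0) -(nnintZ _ mr r0 ai).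
transitivity (I3 (fun y => rho y * (fun=> a^-1) y)); last first.
  by apply: eq_nnint => y; rewrite mulrC.
rewrite (layer_cake mr r0 (measurable_cst a^-1) (fun=> ai)).
apply: eq_integral => t; rewrite inE/= in_itv/= andbT => t0.
apply: newton_downset => //.
- by apply: measurable_set_lt.
- by move=> x y /= h xy; rewrite (lt_le_trans h)// sr.
- move=> y /= h; rewrite /cball3/= leNgt; apply/negP => /ra ry.
  by move: h; rewrite ry ltNge t0.
Qed.

End newton_radial.

(** * Kinetic energy densities *)
Section kinetic.
Variable R : realType.
Variable q : R.
Hypothesis q0 : 0 < q.
Implicit Types (h : 'R3 R -> R) (p : 'R3 R) (t : R).
Local Notation kin := (fermi_kinetic q).
Local Notation kF := (fermi_momentum q).

(** The class of dispersion relations for which all the integrals over Fermi balls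
    converge and which is stable under the operations below. *)
Definition quad_bounded h := measurable_fun setT h /\
  exists C, forall p, `|h p| <= C * (1 + eucl_norm p ^+ 2).

Lemma quad_boundedD h1 h2 : quad_bounded h1 -> quad_bounded h2 ->
  quad_bounded (fun p => h1 p + h2 p).
Proof.
move=> [m1 [C1 b1]] [m2 [C2 b2]]; split; first exact: measurable_funD.
exists (C1 + C2) => p; rewrite mulrDl; apply: le_trans (ler_normD _ _) _.
exact: lerD.
Qed.

Lemma quad_boundedZ a h : quad_bounded h -> quad_bounded (fun p => a * h p).
Proof.
move=> [mh [C b]]; split; first exact: measurable_funM.
by exists (`|a| * C) => p; rewrite normrM -mulrA ler_wpM2l.
Qed.

Lemma quad_bounded_cst a : quad_bounded (fun=> a).
Proof.
split; first exact: measurable_cst.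
by exists `|a| => p; rewrite ler_peMr// lerDl sqr_ge0.
Qed.

Lemma quad_bounded_sqr : quad_bounded (fun p => eucl_norm p ^+ 2).
Proof.
split; first by apply: measurable_funX; exact: measurable_eucl_norm.
by exists 1 => p; rewrite mul1r ger0_norm ?sqr_ge0// lerDr.
Qed.

Lemma fermi_momentum_ge0 t : 0 <= kF t.
Proof. exact: powR_ge0. Qed.

Let u : R := 6 * pi ^+ 2 / q.
Let u0 : 0 < u. Proof. by rewrite divr_gt0// mulr_gt0// exprn_gt0// pi_gt0. Qed.

Lemma fermi_momentumE t : kF t = (u * t) `^ 3^-1.
Proof. by rewrite /fermi_momentum /u mulrAC. Qed.

Lemma fermi_momentum_cube t : 0 <= t -> kF t ^+ 3 = u * t.
Proof.
move=> t0; rewrite fermi_momentumE -powR_mulrn ?powR_ge0// -powRrM mulVf// powRr1//.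
by rewrite mulr_ge0// ltW.
Qed.

Lemma fermi_momentum_le t t' : 0 <= t -> t <= t' -> kF t <= kF t'.
Proof.
move=> t0 tt; rewrite -(@ler_pXn2r _ 3) ?nnegrE ?fermi_momentum_ge0//.
by rewrite !fermi_momentum_cube ?(le_trans t0)// ler_wpM2l// ltW.
Qed.

Lemma fermi_momentum_scale l t : 0 <= l -> 0 <= t -> kF (l ^+ 3 * t) = l * kF t.
Proof.
move=> l0 t0; apply/eqP; rewrite -(@eqrXn2 _ 3) ?fermi_momentum_ge0 ?mulr_ge0 ?fermi_momentum_ge0//.
rewrite exprMn !fermi_momentum_cube// ?mulr_ge0 ?exprn_ge0//.
by apply/eqP; ring.
Qed.

Lemma fermi_momentum_gt0 t : 0 < t -> 0 < kF t.
Proof. by move=> t0; rewrite fermi_momentumE powR_gt0// mulr_gt0. Qed.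

Let cq : R := q / (8 * pi ^+ 3).
Let cq0 : 0 < cq.
Proof. by rewrite divr_gt0// mulr_gt0// exprn_gt0// pi_gt0. Qed.

Lemma quad_bounded_integrable h r : quad_bounded h ->
  (@leb3 R).-integrable (oball r) (EFin \o h).
Proof.
move=> [mh [C b]]; apply: measurable_bounded_integrable.
- exact: measurable_oball.
- exact: leb3_oball_fin.
- exact: measurable_funTS.
exists (`|C| * (1 + r ^+ 2)); split; first exact: num_real.
move=> M CM p /= pr; apply: le_trans (b p) _; apply: le_trans (ltW CM).
apply: (@le_trans _ _ (`|C| * (1 + eucl_norm p ^+ 2))).
  by rewrite ler_wpM2r ?ler_norm// addr_ge0// sqr_ge0.
rewrite ler_wpM2l// lerD2l lerXn2r ?nnegrE ?eucl_norm_ge0//; last exact: ltW.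
by rewrite (le_trans (eucl_norm_ge0 p))// ltW.
Qed.

Lemma le_kin h1 h2 t : quad_bounded h1 -> quad_bounded h2 ->
  (forall p, eucl_norm p < kF t -> h1 p <= h2 p) -> kin h1 t <= kin h2 t.
Proof.
move=> b1 b2 h12; rewrite ler_wpM2l ?(ltW cq0)//.
apply: le_Rintegral; [exact: measurable_oball|exact: quad_bounded_integrable|
  exact: quad_bounded_integrable|exact: h12].
Qed.

Lemma kin_ge0 h t : (forall p, 0 <= h p) -> 0 <= kin h t.
Proof. by move=> h0; rewrite mulr_ge0 ?(ltW cq0)//; apply: Rintegral_ge0. Qed.

Lemma kinD h1 h2 t : quad_bounded h1 -> quad_bounded h2 ->
  kin (fun p => h1 p + h2 p) t = kin h1 t + kin h2 t.
Proof.
move=> b1 b2; rewrite /fermi_kinetic -mulrDr; congr (_ * _).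
apply: RintegralD; [exact: measurable_oball|exact: quad_bounded_integrable|
  exact: quad_bounded_integrable].
Qed.

Lemma kinZ a h t : quad_bounded h -> kin (fun p => a * h p) t = a * kin h t.
Proof.
move=> b; rewrite /fermi_kinetic -/cq [RHS]mulrCA; congr (cq * _).
exact: (RintegralZl a (measurable_oball _) (quad_bounded_integrable _ b)).
Qed.

Lemma kinE h t : (forall p, 0 <= h p) -> kin h t =
  cq * fine (nnint (@leb3 R) (fun p => \1_(oball (kF t)) p * h p)).
Proof.
move=> h0; congr (_ * fine _); rewrite integral_mkcond; apply: eq_integral => p _.
by rewrite patchE indicE /oball; case: ifPn => _; rewrite ?mul1r ?mul0r.
Qed.

Lemma nnint_oball_fin h r : quad_bounded h ->
  nnint (@leb3 R) (fun p => \1_(oball r) p * h p) \is a fin_num.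
Proof.
move=> b; have mB := measurable_oball (r : R).
have := integrable_fin_num mB (quad_bounded_integrable r b).
rewrite integral_mkcond (_ : (\int[@leb3 R]_x _)%E =
  nnint (@leb3 R) (fun p => \1_(oball r) p * h p))//.
apply: eq_integral => p _.
by rewrite patchE indicE; case: ifPn => _; rewrite ?mul1r ?mul0r.
Qed.

Lemma kin0 h : kin h 0 = 0.
Proof.
rewrite /fermi_kinetic; set A := [set p | _]; suff -> : A = set0.
  by rewrite Rintegral_set0 mulr0.
rewrite -subset0 => p; rewrite /A/= /fermi_momentum mulr0 mul0r powR0 ?invr_eq0//.
by rewrite ltNge eucl_norm_ge0.
Qed.

(** A dilation by [l] of momentum space multiplies the density by [l ^ 3]. *)
Lemma kin_scale h l t : quad_bounded h -> (forall p, 0 <= h p) -> 0 < l -> 0 <= t ->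
  kin h (l ^+ 3 * t) = l ^+ 3 * kin (fun p => h (affine3 l (0, 0, 0) p)) t.
Proof.
move=> qh h0 l0 t0; have [mh _] := qh; rewrite !kinE// [RHS]mulrCA; congr (cq * _).
rewrite fermi_momentum_scale ?(ltW l0)//; set r := kF t.
pose F p : \bar R := (\1_(oball (l * r)) p * h p)%:E.
have mF : measurable_fun setT F.
  apply/measurable_EFinP/measurable_funM => //.
  by apply: measurable_indic; exact: measurable_oball.
have F0 p : (0 <= F p)%E by rewrite lee_fin mulr_ge0// indicE.
have := leb3_affine (0, 0, 0) (lt0r_neq0 l0) mF F0.
rewrite gtr0_norm// (_ : (\int[@leb3 R]_x F (affine3 l (0, 0, 0)%R x))%E =
  nnint (@leb3 R) (fun p => \1_(oball r) p * h (affine3 l (0, 0, 0) p))); last first.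
  apply: eq_integral => p _; rewrite /F !indicE; congr (_%:R * _)%:E; congr nat_of_bool.
  by apply/idP/idP; rewrite !inE /oball/= eucl_norm_scale gtr0_norm// ltr_pM2l.
move=> ->; rewrite fineM//; last exact: nnint_oball_fin.
by rewrite /= mulrA divff ?mul1r// expf_neq0// gt_eqF.
Qed.

Lemma quad_bounded_dilate l h : quad_bounded h ->
  quad_bounded (fun p => h (affine3 l (0, 0, 0) p)).
Proof.
move=> [mh [C b]]; split; first exact: (measurableT_comp mh (measurable_affine3 _ _)).
exists (`|C| * (1 + l ^+ 2)) => p; apply: le_trans (b _) _.
rewrite eucl_norm_scale exprMn real_normK ?num_real//.
apply: le_trans (ler_wpM2r _ (ler_norm C)) _.
  by rewrite addr_ge0// mulr_ge0 ?sqr_ge0.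
have := sqr_ge0 l; have := sqr_ge0 (eucl_norm p).
set A := l ^+ 2; set B := _ ^+ 2 => A0 B0.
rewrite -[leRHS]mulrA; apply: ler_wpM2l => //.
by rewrite mulrDl mul1r mulrDr mulr1; lra.
Qed.

Lemma le_kin_density h t t' : quad_bounded h -> (forall p, 0 <= h p) ->
  0 <= t -> t <= t' -> kin h t <= kin h t'.
Proof.
move=> qh h0 t0 tt; rewrite (kinE t h0) (kinE t' h0); apply: ler_wpM2l; first exact: ltW.
apply: fine_le; [exact: nnint_oball_fin|exact: nnint_oball_fin|].
have mi r : measurable_fun setT (fun p => \1_(oball r) p * h p).
  by apply: measurable_funM; [apply: measurable_indic; exact: measurable_oball|exact: qh.1].
apply: le_nnint => // p; first by rewrite mulr_ge0// indicE.
rewrite ler_wpM2r// !indicE; have [/set_mem h1|_] := boolP (p \in oball (kF t)) => //.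
by rewrite mem_set// /oball/= (lt_le_trans h1)// fermi_momentum_le.
Qed.

(** Monotonicity in the density; the maximum only serves to have a function on the
    whole line. *)
Lemma measurable_kin h (rho : 'R3 R -> R) : quad_bounded h -> (forall p, 0 <= h p) ->
  measurable_fun setT rho -> (forall x, 0 <= rho x) ->
  measurable_fun setT (fun x => kin h (rho x)).
Proof.
move=> qh h0 mr r0.
pose f t := kin h (Num.max t 0).
have mf : measurable_fun [set: R] f.
  apply: nondecreasing_measurable; first exact: measurableT.
  move=> x y xy; apply: (le_kin_density qh h0).
    by rewrite le_max lexx orbT.
  by rewrite ge_max !le_max xy lexx !orbT.
rewrite (_ : (fun x => _) = f \o rho); first exact: measurableT_comp.
by apply/funext => x; rewrite /f/= max_l.
Qed.

Definition kin_cst : R := kin (fun=> 1) 1.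
Definition kin_sqr : R := kin (fun p => eucl_norm p ^+ 2) 1.

Lemma kin_cstE t : 0 <= t -> kin (fun=> 1) t = kin_cst * t.
Proof.
rewrite le_eqVlt => /predU1P[<-|t0]; first by rewrite kin0 mulr0.
have l0 : 0 < t `^ 3^-1 by rewrite powR_gt0.
have l3 : (t `^ 3^-1) ^+ 3 = t.
  by rewrite -powR_mulrn ?powR_ge0// -powRrM mulVf// powRr1// ltW.
rewrite -{1}[t]mulr1 -{1}l3 kin_scale//; last exact: quad_bounded_cst.
by rewrite l3 mulrC.
Qed.

Lemma kin_sqrE t : 0 <= t ->
  kin (fun p => eucl_norm p ^+ 2) t = kin_sqr * t `^ (5 / 3).
Proof.
rewrite le_eqVlt => /predU1P[<-|t0].
  by rewrite kin0 powR0 ?mulr0// mulf_neq0.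
set l := t `^ 3^-1; have l0 : 0 < l by rewrite powR_gt0.
have l3 : l ^+ 3 = t.
  by rewrite -powR_mulrn ?powR_ge0// -powRrM mulVf// powRr1// ltW.
have -> : t `^ (5 / 3) = l ^+ 5.
  by rewrite -powR_mulrn ?powR_ge0// -powRrM mulrC.
have sq0 (p : 'R3 R) : 0 <= eucl_norm p ^+ 2 by exact: sqr_ge0.
rewrite -{1}[t]mulr1 -{1}l3 (kin_scale quad_bounded_sqr sq0 l0 ler01).
rewrite (_ : (fun p => _) = fun p => l ^+ 2 * eucl_norm p ^+ 2); last first.
  by apply/funext => p; rewrite eucl_norm_scale gtr0_norm// exprMn.
by rewrite (kinZ _ _ quad_bounded_sqr) mulrA -exprD mulrC.
Qed.

Lemma kin_cst_gt0 : 0 < kin_cst.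
Proof.
rewrite /kin_cst (kinE 1 (fun=> ler01)) mulr_gt0// fine_gt0//.
have k0 : 0 < kF 1 by exact: fermi_momentum_gt0.
have -> : nnint (@leb3 R) (fun p => \1_(oball (kF 1)) p * 1) = @leb3 R (oball (kF 1)).
  rewrite -nnint_indic; last exact: measurable_oball.
  by apply: eq_nnint => p; rewrite mulr1.
by rewrite leb3_oball_gt0// leb3_oball_fin.
Qed.

Lemma kin_sqr_gt0 : 0 < kin_sqr.
Proof.
have k0 : 0 < kF 1 by exact: fermi_momentum_gt0.
pose r := kF 1 / 2; have r0 : 0 < r by rewrite divr_gt0.
have kr : kF 1 = 2 * r by rewrite /r; field.
have sq0 (p : 'R3 R) : 0 <= eucl_norm p ^+ 2 by exact: sqr_ge0.
rewrite /kin_sqr (kinE 1 sq0); apply: mulr_gt0 => //.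
have Bf s : @leb3 R (oball s) \is a fin_num by rewrite ge0_fin_numE// leb3_oball_fin.
have XE := fineK (nnint_oball_fin (kF 1) quad_bounded_sqr).
move: (fine _) XE => X /esym XE.
have mi s : measurable_fun setT (\1_(oball s) : 'R3 R -> R).
  by apply: measurable_indic; exact: measurable_oball.
have i0 s (p : 'R3 R) : 0 <= \1_(oball s) p :> R by rewrite indicE.
have : (nnint (@leb3 R) (fun p => r ^+ 2 * \1_(oball (kF 1)) p)%R <=
  nnint (@leb3 R) (fun p => \1_(oball (kF 1)) p * eucl_norm p ^+ 2 + r ^+ 2 * \1_(oball r) p)%R)%E.
  apply: le_nnint.
  - exact: measurable_funM.
  - apply: measurable_funD; apply: measurable_funM => //.
    by apply: measurable_funX; exact: measurable_eucl_norm.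
  - by move=> p; rewrite mulr_ge0 ?sqr_ge0.
  move=> p; have [pr|pr] := ltP (eucl_norm p) r.
    rewrite [\1_(oball r) p]indicE (mem_set (pr : oball r p)) mulr1.
    apply: ler_wpDl; first by rewrite mulr_ge0.
    by rewrite ler_piMr ?sqr_ge0// indicE lern1 leq_b1.
  apply: ler_wpDr; first by rewrite mulr_ge0 ?sqr_ge0.
  rewrite mulrC ler_wpM2l// lerXn2r ?nnegrE ?eucl_norm_ge0//; exact: ltW.
rewrite nnintD; [|apply: measurable_funM => //; apply: measurable_funX; exact: measurable_eucl_norm
  |exact: measurable_funM|by move=> p; rewrite mulr_ge0|by move=> p; rewrite mulr_ge0 ?sqr_ge0].
rewrite !(nnintZ _ (mi _) (i0 _) (sqr_ge0 r)) !nnint_indic; try exact: measurable_oball.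
rewrite (leb3_oball k0) (leb3_oball r0) XE -!EFinM -EFinD lee_fin kr.
have a0 := disk_area_gt0 R.
have : 0 < r ^+ 2 * (disk_area R * (4 / 3 * (7 * r ^+ 3))).
  by rewrite !mulr_gt0// exprn_gt0.
move=> h1 h2.
have : r ^+ 2 * (disk_area R * (4 / 3 * (2 * r) ^+ 3)) = r ^+ 2 * (disk_area R * (4 / 3 * (7 * r ^+ 3)))
  + r ^+ 2 * (disk_area R * (4 / 3 * r ^+ 3)) by ring.
by lra.
Qed.

End kinetic.

(** * The relativistic and classical kinetic energies as one family *)
Section relativistic.
Variable R : realType.
Variables (q m : R).
Hypothesis q0 : 0 < q.
Hypothesis m0 : 0 < m.
Implicit Types (p : 'R3 R) (t nu l A s : R).
Local Notation kin := (fermi_kinetic q).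
Local Notation kF := (fermi_momentum q).

(** With [nu] for [1 / c ^ 2] the relativistic kinetic energy is
    [|p| ^ 2 / (root + m)], which makes sense, and is the classical one, at
    [nu = 0]. *)
Definition rel_root nu p : R := Num.sqrt (nu * eucl_norm p ^+ 2 + m ^+ 2).
Definition Tnu nu p : R := eucl_norm p ^+ 2 / (rel_root nu p + m).
(** The radial derivative [p . grad T]. *)
Definition Pnu nu p : R := eucl_norm p ^+ 2 / rel_root nu p.
Definition jnu nu : R -> R := kin (Tnu nu).
Definition vnu nu : R -> R := kin (Pnu nu).

Lemma rel_root_sqr nu p : 0 <= nu -> rel_root nu p ^+ 2 = nu * eucl_norm p ^+ 2 + m ^+ 2.
Proof.
move=> n0; rewrite sqr_sqrtr//; apply: addr_ge0; last exact: sqr_ge0.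
by apply: mulr_ge0 => //; exact: sqr_ge0.
Qed.

Lemma rel_root_ge nu p : 0 <= nu -> m <= rel_root nu p.
Proof.
move=> n0; rewrite -[leLHS](ger0_norm (ltW m0)) -sqrtr_sqr ler_wsqrtr// lerDr.
by rewrite mulr_ge0// sqr_ge0.
Qed.

Lemma rel_root_gt0 nu p : 0 <= nu -> 0 < rel_root nu p.
Proof. by move=> n0; exact: lt_le_trans (rel_root_ge p n0). Qed.

Lemma rel_root0 p : rel_root 0 p = m.
Proof. by rewrite /rel_root mul0r add0r sqrtr_sqr ger0_norm// ltW. Qed.

Lemma Tnu_ge0 nu p : 0 <= Tnu nu p.
Proof. by rewrite divr_ge0 ?sqr_ge0// addr_ge0 ?sqrtr_ge0// ltW. Qed.

Lemma Pnu_ge0 nu p : 0 <= Pnu nu p.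
Proof. by rewrite divr_ge0 ?sqr_ge0// sqrtr_ge0. Qed.

Lemma Tnu0E p : Tnu 0 p = eucl_norm p ^+ 2 / (2 * m).
Proof. by rewrite /Tnu rel_root0; congr (_ / _); ring. Qed.

Lemma measurable_rel_root nu : measurable_fun setT (rel_root nu).
Proof.
apply: measurableT_comp; first exact: measurable_sqrtr.
apply: measurable_funD => //; apply: measurable_funM => //.
by apply: measurable_funX; exact: measurable_eucl_norm.
Qed.

Lemma quad_bounded_Tnu nu : 0 <= nu -> quad_bounded (Tnu nu).
Proof.
move=> n0; split.
  apply: measurable_funM; first by apply: measurable_funX; exact: measurable_eucl_norm.
  apply: measurable_inv_ge0; first by apply: measurable_funD => //; exact: measurable_rel_root.
  by move=> p; rewrite addr_ge0 ?sqrtr_ge0// ltW.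
exists m^-1 => p; rewrite ger0_norm ?Tnu_ge0// mulrC.
have A0 := sqr_ge0 (eucl_norm p); have r0 := rel_root_gt0 p n0.
apply: ler_pM; [exact: A0|by rewrite invr_ge0 addr_ge0// ltW|by rewrite lerDr|].
by rewrite lef_pV2 ?posrE ?addr_gt0// lerDr ltW.
Qed.

Lemma quad_bounded_Pnu nu : 0 <= nu -> quad_bounded (Pnu nu).
Proof.
move=> n0; split.
  apply: measurable_funM; first by apply: measurable_funX; exact: measurable_eucl_norm.
  apply: measurable_inv_ge0; first exact: measurable_rel_root.
  by move=> p; rewrite sqrtr_ge0.
exists m^-1 => p; rewrite ger0_norm ?Pnu_ge0// mulrC.
have A0 := sqr_ge0 (eucl_norm p); have r0 := rel_root_gt0 p n0.
apply: ler_pM; [exact: A0|by rewrite invr_ge0 ltW|by rewrite lerDr|].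
by rewrite lef_pV2 ?posrE// rel_root_ge.
Qed.

Lemma Tnu_le_Pnu nu p : 0 <= nu -> Tnu nu p <= Pnu nu p.
Proof.
move=> n0; rewrite ler_wpM2l ?sqr_ge0// lef_pV2 ?posrE ?addr_gt0 ?rel_root_gt0//.
by rewrite lerDl ltW.
Qed.

Lemma Pnu_le_Tnu2 nu p : 0 <= nu -> Pnu nu p <= 2 * Tnu nu p.
Proof.
move=> n0; rewrite /Tnu mulrCA ler_wpM2l ?sqr_ge0//.
have r0 := rel_root_gt0 p n0; have rm := rel_root_ge p n0.
by rewrite ler_pdivlMr ?addr_gt0// mulrC ler_pdivrMr//; lra.
Qed.

Lemma Tnu_antitone nu nu' p : 0 <= nu -> nu <= nu' -> Tnu nu' p <= Tnu nu p.
Proof.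
move=> n0 nn; have n0' := le_trans n0 nn.
rewrite ler_wpM2l ?sqr_ge0// lef_pV2 ?posrE ?addr_gt0 ?rel_root_gt0//.
by rewrite lerD2r ler_wsqrtr// lerD2r ler_wpM2r// sqr_ge0.
Qed.

(** As a function of [|p| ^ 2] the energy is concave, with slope [Pnu / (2 * |p| ^ 2)]. *)
Lemma Tnu_scale nu l p : 0 <= nu -> 0 < l ->
  Tnu nu (affine3 l (0, 0, 0) p) <= Tnu nu p + (l ^+ 2 - 1) / 2 * Pnu nu p.
Proof.
move=> n0 l0; rewrite /Tnu /Pnu.
have r0 := rel_root_gt0 p n0; have rsq := rel_root_sqr p n0.
have r0' := rel_root_gt0 (affine3 l (0, 0, 0) p) n0.
have := rel_root_sqr (affine3 l (0, 0, 0) p) n0.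
rewrite eucl_norm_scale gtr0_norm// exprMn.
set A := eucl_norm p ^+ 2 in rsq *; set s := rel_root nu p in r0 rsq *.
set s' := rel_root nu _ in r0' *; move=> rsq'.
have A0 : 0 <= A by exact: sqr_ge0.
have sn0 : s + m != 0 by rewrite gt_eqF// addr_gt0.
have sn0' : s' + m != 0 by rewrite gt_eqF// addr_gt0.
move: n0; rewrite le_eqVlt => /predU1P[n0|n0].
  move: rsq rsq'; rewrite -n0 !mul0r add0r => rsq rsq'.
  have -> : s = m.
    by apply/eqP; rewrite -(@eqrXn2 _ 2) ?rsq// ltW.
  have -> : s' = m.
    by apply/eqP; rewrite -(@eqrXn2 _ 2) ?rsq'// ltW.
  rewrite le_eqVlt; apply/orP; left; apply/eqP; field.
  by rewrite ?gt_eqF ?addr_gt0 ?mulr_gt0.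
have TE B r : 0 < r -> r ^+ 2 = nu * B + m ^+ 2 -> B / (r + m) = (r - m) / nu.
  move=> r1 rE; have rn : r + m != 0 by rewrite gt_eqF// addr_gt0.
  have BE : B = (r - m) * (r + m) / nu.
    have -> : (r - m) * (r + m) = nu * B by rewrite -subr_sqr rE; ring.
    by field; rewrite gt_eqF.
  by rewrite BE; field; rewrite rn gt_eqF.
rewrite (TE _ _ r0' rsq') (TE _ _ r0 rsq).
have -> : (l ^+ 2 - 1) / 2 * (A / s) = (s' ^+ 2 - s ^+ 2) / (2 * s) / nu.
  by rewrite rsq rsq'; field; rewrite !gt_eqF.
rewrite -mulrDl ler_wpM2r ?invr_ge0 ?(ltW n0)//.
rewrite -lerBlDl ler_pdivlMr ?mulr_gt0//.
by rewrite -subr_ge0 [leRHS](_ : _ = (s' - s) ^+ 2) ?sqr_ge0//; ring.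
Qed.

Lemma jnu_scale nu l t : 0 <= nu -> 0 < l -> 0 <= t ->
  jnu nu (l ^+ 3 * t) <= l ^+ 3 * (jnu nu t + (l ^+ 2 - 1) / 2 * vnu nu t).
Proof.
move=> n0 l0 t0; have qT := quad_bounded_Tnu n0; have qP := quad_bounded_Pnu n0.
rewrite /jnu (kin_scale q0 qT (Tnu_ge0 nu) l0 t0).
apply: ler_wpM2l; first by rewrite exprn_ge0// ltW.
rewrite /vnu -(kinZ q _ _ qP) -(kinD q _ qT (quad_boundedZ _ qP)).
apply: (le_kin q0).
- exact: quad_bounded_dilate.
- exact: quad_boundedD qT (quad_boundedZ _ qP).
- by move=> p _; exact: Tnu_scale.
Qed.

Lemma jnu_ge0 nu t : 0 <= jnu nu t.
Proof. by apply: kin_ge0 => // p; exact: Tnu_ge0. Qed.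

Lemma vnu_ge0 nu t : 0 <= vnu nu t.
Proof. by apply: kin_ge0 => // p; exact: Pnu_ge0. Qed.

Lemma le_jnu nu t t' : 0 <= nu -> 0 <= t -> t <= t' -> jnu nu t <= jnu nu t'.
Proof.
by move=> n0 t0 tt; apply: (le_kin_density q0 (quad_bounded_Tnu n0) (Tnu_ge0 nu)).
Qed.

Lemma jnu_at0 nu : jnu nu 0 = 0.
Proof. exact: kin0. Qed.

Lemma jnu_le_vnu nu t : 0 <= nu -> jnu nu t <= vnu nu t.
Proof.
move=> n0; apply: (le_kin q0 (quad_bounded_Tnu n0) (quad_bounded_Pnu n0)) => p _.
exact: Tnu_le_Pnu.
Qed.

Lemma vnu_le_jnu2 nu t : 0 <= nu -> vnu nu t <= 2 * jnu nu t.
Proof.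
move=> n0; rewrite /jnu -(kinZ q _ _ (quad_bounded_Tnu n0)).
apply: (le_kin q0 (quad_bounded_Pnu n0) (quad_boundedZ _ (quad_bounded_Tnu n0))) => p _.
exact: Pnu_le_Tnu2.
Qed.

Lemma jnu_antitone nu nu' t : 0 <= nu -> nu <= nu' -> jnu nu' t <= jnu nu t.
Proof.
move=> n0 nn; have n0' := le_trans n0 nn.
apply: (le_kin q0 (quad_bounded_Tnu n0') (quad_bounded_Tnu n0)) => p _.
exact: Tnu_antitone.
Qed.

Lemma measurable_jnu nu (rho : 'R3 R -> R) : 0 <= nu -> measurable_fun setT rho ->
  (forall x, 0 <= rho x) -> measurable_fun setT (fun x => jnu nu (rho x)).
Proof.
by move=> n0 mr r0; apply: (measurable_kin q0 (quad_bounded_Tnu n0) (Tnu_ge0 nu)).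
Qed.

Lemma measurable_vnu nu (rho : 'R3 R -> R) : 0 <= nu -> measurable_fun setT rho ->
  (forall x, 0 <= rho x) -> measurable_fun setT (fun x => vnu nu (rho x)).
Proof.
by move=> n0 mr r0; apply: (measurable_kin q0 (quad_bounded_Pnu n0) (Pnu_ge0 nu)).
Qed.

(** The constant of the Thomas-Fermi kinetic energy. *)
Definition TF_cst : R := kin_sqr q / (2 * m).

Lemma TF_cst_gt0 : 0 < TF_cst.
Proof. by rewrite divr_gt0 ?kin_sqr_gt0// mulr_gt0. Qed.

Lemma kin_sqr_j0 t : kin (fun p => eucl_norm p ^+ 2) t = 2 * m * jnu 0 t.
Proof.
rewrite /jnu -(kinZ q _ _ (quad_bounded_Tnu (lexx 0))); congr (kin _ t).
by apply/funext => p; rewrite Tnu0E mulrC divfK// gt_eqF// mulr_gt0.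
Qed.

Lemma j0E t : 0 <= t -> jnu 0 t = TF_cst * t `^ (5 / 3).
Proof.
move=> t0; have := kin_sqr_j0 t; rewrite (kin_sqrE q0 t0) /TF_cst => E.
by rewrite mulrAC E mulrAC divff ?mul1r// gt_eqF// mulr_gt0.
Qed.

Lemma v0E t : vnu 0 t = 2 * jnu 0 t.
Proof.
rewrite /jnu -(kinZ q _ _ (quad_bounded_Tnu (lexx 0))); congr (kin _ t).
apply/funext => p; rewrite /Pnu rel_root0 Tnu0E; field; rewrite gt_eqF//.
Qed.

(** The root of the relativistic energy is [c ^ 2] times [rel_root]; multiply by the
    conjugate. *)
Lemma j_mcE c : 0 < c -> j_mc q m c = jnu (c ^- 2).
Proof.
move=> c0; apply/funext => t; congr (kin _ t); apply/funext => p.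
have n0 : 0 <= c ^- 2 by rewrite invr_ge0 sqr_ge0.
rewrite /T_rel.
have -> : c ^+ 2 * eucl_norm p ^+ 2 + m ^+ 2 * c ^+ 4 =
  (c ^+ 2) ^+ 2 * (c ^- 2 * eucl_norm p ^+ 2 + m ^+ 2).
  by field; rewrite gt_eqF.
rewrite sqrtrM ?sqr_ge0// sqrtr_sqr ger0_norm ?sqr_ge0// -/(rel_root _ p) /Tnu.
have r0 := rel_root_gt0 p n0; have rsq := rel_root_sqr p n0.
set s := rel_root _ p in r0 rsq *.
have sn : s + m != 0 by rewrite gt_eqF// addr_gt0.
apply/eqP; rewrite eq_sym -[X in _ == X]divr1 eqr_div ?oner_eq0// mulr1; apply/eqP.
have -> : eucl_norm p ^+ 2 = c ^+ 2 * (s ^+ 2 - m ^+ 2).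
  by rewrite rsq; field; rewrite gt_eqF.
by ring.
Qed.

Lemma j_ooE : j_oo q m = jnu 0.
Proof.
by apply/funext => t; congr (kin _ t); apply/funext => p; rewrite Tnu0E.
Qed.

End relativistic.

(** * Gaps between the kinetic energies *)
Section kinetic_gaps.
Variable R : realType.
Variables (q m : R).
Hypothesis q0 : 0 < q.
Hypothesis m0 : 0 < m.
Implicit Types (p : 'R3 R) (t nu l A s : R).
Local Notation kin := (fermi_kinetic q).
Local Notation kF := (fermi_momentum q).
Local Notation jnu := (jnu q m).
Local Notation vnu := (vnu q m).

Lemma gap_classical A s : 0 < s -> A / (2 * m) - A / (s + m) =
  A * (s ^+ 2 - m ^+ 2) / (2 * m * (s + m) ^+ 2).
Proof. by move=> s0; field; rewrite !gt_eqF// addr_gt0. Qed.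

Lemma gap_virial A s : 0 < s -> A / (2 * m) - (A / s - A / (s + m)) =
  A * (s ^+ 2 - m ^+ 2) * (s + 2 * m) / (2 * m * s * (s + m) ^+ 2).
Proof. by move=> s0; field; rewrite !gt_eqF// addr_gt0. Qed.

Lemma gap_double A s : 0 < s -> 2 * (A / (s + m)) - A / s =
  A * (s ^+ 2 - m ^+ 2) / (s * (s + m) ^+ 2).
Proof. by move=> s0; field; rewrite !gt_eqF// addr_gt0. Qed.

(** The gaps are of size [nu * |p| ^ 4]: from above ... *)
Lemma gaps_upper nu p : 0 <= nu ->
  let e := nu * (eucl_norm p ^+ 2) ^+ 2 / m ^+ 3 in
  Tnu m 0 p <= Tnu m nu p + e /\ Tnu m 0 p <= Pnu m nu p - Tnu m nu p + e.
Proof.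
move=> n0 e; rewrite Tnu0E// /Tnu /Pnu.
have r0 := rel_root_gt0 m0 p n0; have rm := rel_root_ge m0 p n0.
have rsq := rel_root_sqr m p n0.
rewrite /e; set A := eucl_norm p ^+ 2 in rsq *; set s := rel_root _ _ p in r0 rm rsq *.
have A0 : 0 <= A by exact: sqr_ge0.
have E : A * (s ^+ 2 - m ^+ 2) = nu * A ^+ 2 by rewrite rsq; ring.
have nA : 0 <= nu * A ^+ 2 by rewrite mulr_ge0// sqr_ge0.
have m3 : 0 < m ^+ 3 by rewrite exprn_gt0.
have sm : 0 < s + m by rewrite addr_gt0.
have sm2 : (2 * m) ^+ 2 <= (s + m) ^+ 2 by rewrite lerXn2r// ?nnegrE ?mulr_ge0 ?(ltW m0) ?(ltW sm)//; lra.
have m2 : 0 < m ^+ 2 by rewrite exprn_gt0.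
have bound D : 0 < D -> m ^+ 3 <= D -> nu * A ^+ 2 / D <= nu * A ^+ 2 / m ^+ 3.
  by move=> D0 mD; rewrite ler_wpM2l// lef_pV2 ?posrE.
have D1 : 4 * m ^+ 3 <= m * (s + m) ^+ 2.
  rewrite [leLHS](_ : _ = m * (2 * m) ^+ 2); last by ring.
  by rewrite ler_wpM2l// ltW.
split.
- rewrite -lerBlDl gap_classical// E; apply: bound; first by rewrite !mulr_gt0// exprn_gt0.
  by rewrite -mulrA; lra.
- rewrite -lerBlDl gap_virial// E.
  apply: (@le_trans _ _ (nu * A ^+ 2 * (3 * s) / (2 * m * s * (s + m) ^+ 2))).
    apply: ler_wpM2r; last by apply: ler_wpM2l => //; lra.
    by rewrite invr_ge0 ltW// !mulr_gt0// exprn_gt0.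
  have -> : nu * A ^+ 2 * (3 * s) / (2 * m * s * (s + m) ^+ 2) =
      nu * A ^+ 2 / (2 / 3 * (m * (s + m) ^+ 2)).
    by field; rewrite !gt_eqF.
  by apply: bound; [rewrite !mulr_gt0// exprn_gt0|lra].
Qed.

(** ... and, on bounded sets of momenta, from below. *)
Lemma gaps_lower nu p S : 0 <= nu -> rel_root m nu p <= S ->
  let e := nu * (eucl_norm p ^+ 2) ^+ 2 / ((2 * m + S) * (S + m) ^+ 2) in
  Pnu m nu p - Tnu m nu p + e <= Tnu m 0 p /\ Pnu m nu p + e <= 2 * Tnu m nu p.
Proof.
move=> n0 rS e; rewrite Tnu0E// /Tnu /Pnu.
have r0 := rel_root_gt0 m0 p n0; have rm := rel_root_ge m0 p n0.
have rsq := rel_root_sqr m p n0.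
rewrite /e; set A := eucl_norm p ^+ 2 in rsq *; set s := rel_root _ _ p in r0 rm rsq rS *.
have S0 : 0 < S by exact: lt_le_trans rS.
have E : A * (s ^+ 2 - m ^+ 2) = nu * A ^+ 2 by rewrite rsq; ring.
have nA : 0 <= nu * A ^+ 2 by rewrite mulr_ge0// sqr_ge0.
have sm : 0 < s + m by rewrite addr_gt0.
have Sm : (s + m) ^+ 2 <= (S + m) ^+ 2.
  by rewrite lerXn2r// ?nnegrE ?addr_ge0 ?(ltW m0) ?(ltW r0) ?(ltW S0)// lerD2r.
have bound D : 0 < D -> D <= (2 * m + S) * (S + m) ^+ 2 ->
    nu * A ^+ 2 / ((2 * m + S) * (S + m) ^+ 2) <= nu * A ^+ 2 / D.
  by move=> D0 DS; rewrite ler_wpM2l// lef_pV2 ?posrE// (lt_le_trans D0).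
have sq0 : 0 <= (s + m) ^+ 2 by exact: sqr_ge0.
split; rewrite -lerBrDl.
- rewrite gap_virial// E.
  apply: (@le_trans _ _ (nu * A ^+ 2 * s / (2 * m * s * (s + m) ^+ 2))); last first.
    apply: ler_wpM2r; last by apply: ler_wpM2l => //; rewrite lerDl mulr_ge0// ltW.
    by rewrite invr_ge0 ltW// !mulr_gt0// exprn_gt0.
  have -> : nu * A ^+ 2 * s / (2 * m * s * (s + m) ^+ 2) = nu * A ^+ 2 / (2 * m * (s + m) ^+ 2).
    by field; rewrite !gt_eqF.
  apply: bound; first by rewrite !mulr_gt0// exprn_gt0.
  by apply: ler_pM => //; [rewrite mulr_ge0// ltW|rewrite lerDl ltW].
- rewrite gap_double// E; apply: bound; first by rewrite !mulr_gt0// exprn_gt0.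
  by apply: ler_pM => //; [rewrite ltW|rewrite ler_wpDl// mulr_ge0// ltW].
Qed.

Lemma kin_gaps_upper M : 0 <= M -> exists2 C, 0 <= C & forall nu t,
  0 <= nu -> 0 <= t <= M ->
  jnu 0 t <= jnu nu t + C * nu * t /\ jnu 0 t <= vnu nu t - jnu nu t + C * nu * t.
Proof.
move=> M0; pose K := (kF M ^+ 2) ^+ 2 / m ^+ 3.
have K0 : 0 <= K by rewrite divr_ge0 ?sqr_ge0// exprn_ge0// ltW.
have kc := kin_cst_gt0 q0.
exists (K * kin_cst q); first by rewrite mulr_ge0// ltW.
move=> nu t n0 /andP[t0 tM].
have -> : K * kin_cst q * nu * t = kin (fun=> nu * K * 1) t.
  by rewrite (kinZ _ _ _ (quad_bounded_cst (1 : R))) (kin_cstE q0 t0); ring.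
have qT := quad_bounded_Tnu m0 n0; have qT0 := quad_bounded_Tnu m0 (lexx 0).
have qP := quad_bounded_Pnu m0 n0; have qK := quad_bounded_cst (nu * K * 1).
have qN := quad_boundedZ (-1) qT.
have eb p : eucl_norm p < kF t -> nu * (eucl_norm p ^+ 2) ^+ 2 / m ^+ 3 <= nu * K * 1.
  move=> pt; rewrite mulr1 /K -mulrA ler_wpM2l// ler_wpM2r ?invr_ge0 ?exprn_ge0 ?(ltW m0)//.
  have pM : eucl_norm p <= kF M by rewrite (le_trans (ltW pt))// fermi_momentum_le.
  have h : eucl_norm p ^+ 2 <= kF M ^+ 2.
    by rewrite lerXn2r ?nnegrE ?eucl_norm_ge0 ?fermi_momentum_ge0.
  by rewrite lerXn2r ?nnegrE ?sqr_ge0.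
split.
- rewrite -(kinD q _ qT qK); apply: (le_kin q0 qT0 (quad_boundedD qT qK)) => p /eb h.
  by have [h1 _] := gaps_upper p n0; apply: le_trans h1 _; rewrite lerD2l.
- have -> : vnu nu t - jnu nu t = kin (fun p => Pnu m nu p + -1 * Tnu m nu p) t.
    by rewrite (kinD q _ qP qN) (kinZ q _ _ qT) mulN1r.
  rewrite -(kinD q _ (quad_boundedD qP qN) qK).
  apply: (le_kin q0 qT0 (quad_boundedD (quad_boundedD qP qN) qK)) => p /eb h.
  by have [_ h1] := gaps_upper p n0; apply: le_trans h1 _; rewrite mulN1r lerD2l.
Qed.

(** The square of [|p| ^ 2 - d] is nonnegative, so that [|p| ^ 4] may be replaced with
    [2 * d * |p| ^ 2 - d ^ 2], whose integral over the Fermi ball is known. *)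
Lemma kin_gaps_lower M : 0 <= M -> exists2 C, 0 < C & forall nu t d,
  0 <= nu <= 1 -> 0 <= t <= M -> 
  let e := C * nu * (2 * d * (2 * m * jnu 0 t) - d ^+ 2 * (kin_cst q * t)) in
  vnu nu t - jnu nu t + e <= jnu 0 t /\ vnu nu t + e <= 2 * jnu nu t.
Proof.
move=> M0; pose S := Num.sqrt (kF M ^+ 2 + m ^+ 2).
have S0 : 0 < S by rewrite sqrtr_gt0 ltr_wpDl ?sqr_ge0// exprn_gt0.
pose C := ((2 * m + S) * (S + m) ^+ 2)^-1.
have C0 : 0 < C by rewrite invr_gt0 mulr_gt0 ?exprn_gt0 ?addr_gt0 ?mulr_gt0.
exists C => // nu t d /andP[n0 n1] /andP[t0 tM] e.
pose w (p : 'R3 R) := C * nu * (2 * d) * eucl_norm p ^+ 2 + - (C * nu * d ^+ 2) * 1.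
have qs := quad_boundedZ (C * nu * (2 * d)) (quad_bounded_sqr R).
have q1 := quad_boundedZ (- (C * nu * d ^+ 2)) (quad_bounded_cst (1 : R)).
have qw : quad_bounded w by exact: quad_boundedD qs q1.
have -> : e = kin w t.
  rewrite /w (kinD q _ qs q1) (kinZ q _ _ (quad_bounded_sqr R)).
  rewrite (kinZ q _ _ (quad_bounded_cst (1 : R))) (kin_cstE q0 t0) (kin_sqr_j0 q m0) /e.
  by ring.
have qT := quad_bounded_Tnu m0 n0; have qT0 := quad_bounded_Tnu m0 (lexx 0).
have qP := quad_bounded_Pnu m0 n0; have qN := quad_boundedZ (-1) qT.
have wle p : eucl_norm p < kF t -> rel_root m nu p <= S /\
    w p <= nu * (eucl_norm p ^+ 2) ^+ 2 / ((2 * m + S) * (S + m) ^+ 2).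
  move=> pt; have pM : eucl_norm p <= kF M.
    by rewrite (le_trans (ltW pt))// fermi_momentum_le.
  have h : eucl_norm p ^+ 2 <= kF M ^+ 2.
    by rewrite lerXn2r ?nnegrE ?eucl_norm_ge0 ?fermi_momentum_ge0.
  split.
    by rewrite ler_wsqrtr// lerD2r (le_trans _ h)// ler_piMl// sqr_ge0.
  rewrite /w -/C -subr_ge0.
  rewrite [leRHS](_ : _ = C * nu * (eucl_norm p ^+ 2 - d) ^+ 2); last by ring.
  apply: mulr_ge0; last exact: sqr_ge0.
  by apply: mulr_ge0 => //; exact: ltW.
split.
- have -> : vnu nu t - jnu nu t = kin (fun p => Pnu m nu p + -1 * Tnu m nu p) t.
    by rewrite (kinD q _ qP qN) (kinZ q _ _ qT) mulN1r.
  rewrite -(kinD q _ (quad_boundedD qP qN) qw).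
  apply: (le_kin q0 (quad_boundedD (quad_boundedD qP qN) qw) qT0) => p /wle[rS h].
  by have [h1 _] := gaps_lower n0 rS; apply: le_trans h1; rewrite mulN1r lerD2l.
- rewrite /jnu -(kinZ q _ _ qT) -(kinD q _ qP qw).
  apply: (le_kin q0 (quad_boundedD qP qw) (quad_boundedZ 2 qT)) => p /wle[rS h].
  by have [_ h1] := gaps_lower n0 rS; apply: le_trans h1; rewrite lerD2l.
Qed.

(** [gaps_lower] with its positive remainder dropped. *)
Lemma virial_gap_le nu t : 0 <= nu -> vnu nu t - jnu nu t <= jnu 0 t.
Proof.
move=> n0; have qT := quad_bounded_Tnu m0 n0; have qT0 := quad_bounded_Tnu m0 (lexx 0).
have qP := quad_bounded_Pnu m0 n0.
rewrite lerBlDr -(kinD q _ qT0 qT); apply: (le_kin q0 qP (quad_boundedD qT0 qT)) => p _.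
have [h _] := gaps_lower n0 (lexx (rel_root m nu p)).
rewrite -lerBlDr; apply: le_trans h; rewrite lerDl.
have r0 := rel_root_gt0 m0 p n0.
apply: divr_ge0; first by apply: mulr_ge0 => //; exact: sqr_ge0.
by rewrite ltW// mulr_gt0 ?exprn_gt0 ?addr_gt0// mulr_gt0.
Qed.

Lemma fermi_momentum_pow t : 0 <= t -> kF t = kF 1 * t `^ 3^-1.
Proof.
move=> t0; rewrite !fermi_momentumE mulr1 powRM//.
by rewrite ltW// divr_gt0// mulr_gt0// exprn_gt0// pi_gt0.
Qed.

Lemma powR43 t : 0 <= t -> t `^ (4 / 3) = t * t `^ 3^-1.
Proof.
move=> t0; have -> : (4 / 3 : R) = 1 + 3^-1 by field.
by rewrite powRD ?powRr1//; apply/implyP => /eqP h; lra.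
Qed.

(** [Tnu] is at most [|p| / sqrt nu]. *)
Lemma jnu_le_43 nu t : 0 < nu -> 0 <= t ->
  jnu nu t <= kF 1 * kin_cst q / Num.sqrt nu * t `^ (4 / 3).
Proof.
move=> n0 t0; have n0' := ltW n0.
have sn : 0 < Num.sqrt nu by rewrite sqrtr_gt0.
have -> : kF 1 * kin_cst q / Num.sqrt nu * t `^ (4 / 3) =
    kin (fun=> kF t / Num.sqrt nu * 1) t.
  rewrite (kinZ _ _ _ (quad_bounded_cst (1 : R))) (kin_cstE q0 t0) powR43//.
  by rewrite (fermi_momentum_pow t0); ring.
apply: (le_kin q0 (quad_bounded_Tnu m0 n0') (quad_bounded_cst _)) => p pt.
rewrite mulr1 /Tnu; have A0 := eucl_norm_ge0 p.
have r1 : Num.sqrt nu * eucl_norm p <= rel_root m nu p.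
  by rewrite -[X in _ * X](ger0_norm A0) -sqrtr_sqr -sqrtrM// ler_wsqrtr// lerDl sqr_ge0.
have r0 := rel_root_gt0 m0 p n0'.
rewrite ler_pdivrMr ?addr_gt0// mulrAC ler_pdivlMr// expr2.
rewrite -mulrA ler_pM ?mulr_ge0 ?(ltW sn)//; first exact: ltW.
by rewrite mulrC (le_trans r1)// lerDl ltW.
Qed.

(** [Tnu] is at least [c * |p| - m * c ^ 2], and [|p| >= |p| ^ 2 / kF] in the Fermi
    ball. *)
Lemma jnu_ge_43 c t : 0 < c -> 0 <= t ->
  c * (kin_sqr q / kF 1) * t `^ (4 / 3) <= jnu (c ^- 2) t + c ^+ 2 * m * kin_cst q * t.
Proof.
move=> c0; rewrite le_eqVlt => /predU1P[<-|t0].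
  by rewrite powR0 ?mulf_neq0// !mulr0 addr0 jnu_ge0.
have n0 : 0 <= c ^- 2 by rewrite invr_ge0 sqr_ge0.
have k1 := fermi_momentum_gt0 q0 ltr01; have kt := fermi_momentum_gt0 q0 t0.
have t3 : 0 < t `^ 3^-1 by rewrite powR_gt0.
have E : t `^ (5 / 3) = t `^ (4 / 3) * t `^ 3^-1.
  rewrite -powRD; last by apply/implyP => _; rewrite gt_eqF.
  by congr (_ `^ _); field.
have -> : c * (kin_sqr q / kF 1) * t `^ (4 / 3) = kin (fun p => c / kF t * eucl_norm p ^+ 2) t.
  rewrite (kinZ _ _ _ (quad_bounded_sqr _)) (kin_sqrE q0 (ltW t0)) E.
  by rewrite (fermi_momentum_pow (ltW t0)); field; rewrite !gt_eqF.
have -> : c ^+ 2 * m * kin_cst q * t = kin (fun=> c ^+ 2 * m * 1) t.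
  by rewrite (kinZ _ _ _ (quad_bounded_cst (1 : R))) (kin_cstE q0 (ltW t0)); ring.
have qT := quad_bounded_Tnu m0 n0; have qc := quad_bounded_cst (c ^+ 2 * m * 1).
rewrite -(kinD q _ qT qc).
apply: (le_kin q0 (quad_boundedZ _ (quad_bounded_sqr _)) (quad_boundedD qT qc)) => p pt.
apply: (@le_trans _ _ (c * eucl_norm p)).
  rewrite -mulrA ler_wpM2l ?(ltW c0)// mulrC ler_pdivrMr// expr2.
  by rewrite ler_wpM2l ?eucl_norm_ge0// ltW.
rewrite mulr1 /Tnu; have r0 := rel_root_gt0 m0 p n0.
have rsq := rel_root_sqr m p n0.
set s := rel_root _ _ p in r0 rsq *.
have sn : s + m != 0 by rewrite gt_eqF// addr_gt0.
have -> : eucl_norm p ^+ 2 = c ^+ 2 * (s ^+ 2 - m ^+ 2).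
  by rewrite rsq; field; rewrite gt_eqF.
have -> : c ^+ 2 * (s ^+ 2 - m ^+ 2) / (s + m) + c ^+ 2 * m = c ^+ 2 * s by field.
rewrite expr2 -mulrA ler_wpM2l ?(ltW c0)//.
rewrite -(@ler_pXn2r _ 2) ?nnegrE ?eucl_norm_ge0 ?mulr_ge0 ?(ltW c0) ?(ltW r0)//.
rewrite exprMn rsq mulrDr mulrA divff ?mul1r ?expf_neq0 ?gt_eqF// lerDl.
by apply: mulr_ge0; exact: sqr_ge0.
Qed.

End kinetic_gaps.

(** * Densities in terms of integrals *)
Section densities.
Variable R : realType.
Local Notation I3 f := (nnint (@leb3 R) f%R).
Implicit Types (rho : 'R3 R -> R) (p : R).

Lemma Lnorm1_nnint rho : (forall x, 0 <= rho x) -> ('N[@leb3 R]_1[EFin \o rho] = I3 rho)%E.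
Proof.
by move=> r0; rewrite Lnorm1; apply: eq_integral => x _; rewrite /= ger0_norm.
Qed.

Lemma Lnorm_nnint p rho : 0 < p -> (forall x, 0 <= rho x) ->
  ('N[@leb3 R]_(p%:E)[EFin \o rho] `^ p = I3 (fun x => rho x `^ p))%E.
Proof.
move=> p0 r0; rewrite (poweR_Lnorm _ _ (lt0r_neq0 p0)); apply: eq_integral => x _.
by rewrite /= ger0_norm.
Qed.

Lemma densityP p rho : 0 < p -> density p rho <->
  [/\ forall x, 0 <= rho x, measurable_fun setT rho, (I3 rho < +oo)%E &
      (I3 (fun x => rho x `^ p) < +oo)%E].
Proof.
move=> p0; split.
  move=> [r0 h1 hp].
  move: h1; rewrite inE => /andP[/[!inE] mr i1].
  move: hp; rewrite inE => /andP[_ /[!inE] ip]; split; [exact: r0|exact: mr| |].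
  - by rewrite -(Lnorm1_nnint r0); exact: i1.
  - by rewrite -(Lnorm_nnint p0 r0); apply: poweR_lty; exact: ip.
move=> [r0 mr i1 ip]; split; first exact: r0.
  rewrite inE; apply/andP; split; rewrite !inE; first exact: mr.
  by rewrite /finite_norm/= (Lnorm1_nnint r0).
rewrite inE; apply/andP; split; rewrite !inE; first exact: mr.
apply: (lty_poweRy (lt0r_neq0 p0)); rewrite (Lnorm_nnint p0 r0); exact: ip.
Qed.

(** Where [rho <= 1] the mass controls the power [4 / 3], elsewhere the power [5 / 3]
    does. *)
Lemma density53_43 rho : density (5 / 3) rho -> density (4 / 3) rho.
Proof.
have p0 (n : nat) : (0 : R) < n.+1%:R / 3 by rewrite divr_gt0.
move=> /(densityP _ (p0 4))[r0 mr i1 i5]; apply/(densityP _ (p0 3)).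
split; [exact: r0|exact: mr|exact: i1|].
have mp s : measurable_fun setT (fun x => rho x `^ s).
  exact: (measurableT_comp (measurable_powR _) mr).
apply: (@le_lt_trans _ _ (I3 rho + I3 (fun x => rho x `^ (5 / 3)))%E); last exact: lte_add_pinfty.
rewrite -(nnintD _ mr (mp _) r0 (fun=> powR_ge0 _ _)); apply: le_nnint.
- exact: mp.
- exact: (measurable_funD mr (mp _)).
- by move=> x; exact: powR_ge0.
move=> x; have [x1|x1] := leP (rho x) 1.
  apply: (ler_wpDr (powR_ge0 _ _)).
  have := r0 x; rewrite le_eqVlt => /predU1P[<-|xp].
    by rewrite powR0// gt_eqF// p0.
  by apply: ge1r_powR; rewrite ?xp// ler_pdivlMr// mul1r ler_nat.
apply: (ler_wpDl (r0 x)); apply: (ler_powR (ltW x1)).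
by rewrite ler_pM2r ?invr_gt0// ler_nat.
Qed.

End densities.

(** * First-order conditions for minimizers *)

(** Test with the set where the conclusion fails. *)
Lemma ae_le_of_set_integrals d (T : measurableType d) (R : realType)
    (mu : {measure set T -> \bar R}) (f : T -> R) (u : T -> \bar R) :
  measurable_fun setT f -> (forall x, 0 <= f x) ->
  measurable_fun setT u -> (forall x, 0 <= u x)%E ->
  (\int[mu]_x u x < +oo)%E ->
  (forall A, measurable A -> (\int[mu]_(x in A) (f x)%:E <= \int[mu]_(x in A) u x)%E) ->
  {ae mu, forall x, ((f x)%:E <= u x)%E}.
Proof.
move=> mf f0 mu_ u0 ufin fu.
pose A := [set x | (u x < (f x)%:E)%E].
have mEf : measurable_fun setT (fun x => (f x)%:E) by exact/measurable_EFinP.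
have mA : measurable A.
  by have := measurable_lte measurableT mu_ mEf; rewrite setTI.
pose dd x := ((f x)%:E - u x)%E.
have mdd : measurable_fun setT dd by exact: emeasurable_funB.
have uA x : A x -> u x \is a fin_num.
  by move=> Ax; rewrite ge0_fin_numE// (lt_trans Ax)// ltry.
have dd0 x : A x -> (0 <= dd x)%E by move=> Ax; rewrite /dd sube_ge0 ?(uA _ Ax)// ltW.
have uAfin : (\int[mu]_(x in A) u x < +oo)%E.
  by apply: le_lt_trans ufin; apply: ge0_subset_integral => //; exact: measurable_funTS.
have E : (\int[mu]_(x in A) dd x = 0)%E.
  have : (\int[mu]_(x in A) (f x)%:E =
      \int[mu]_(x in A) dd x + \int[mu]_(x in A) u x)%E.
    rewrite -ge0_integralD//; first last.
    - exact: measurable_funTS.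
    - exact: measurable_funTS.
    by apply: eq_integral => x; rewrite inE => Ax; rewrite /dd subeK// uA.
  have := fu A mA; move=> /[swap] ->.
  have fi : (\int[mu]_(x in A) u x)%E \is a fin_num.
    by rewrite ge0_fin_numE// integral_ge0.
  rewrite -[leRHS]add0e leeD2rE// => h.
  by apply/eqP; rewrite eq_le h/= integral_ge0.
have : ae_eq mu A dd (cst 0%E).
  apply/(ae_eq_integral_abs _ mA (measurable_funTS mdd)).
  by rewrite -[RHS]E; apply: eq_integral => x; rewrite inE => Ax; rewrite gee0_abs// dd0.
apply: filterS => x hx; rewrite leNgt; apply/negP => Ax.
have : (0 < dd x)%E by rewrite /dd sube_gt0.
by rewrite (hx Ax) ltxx.
Qed.

Lemma cuberoot (R : realType) (s : R) : 0 < s -> exists2 l, 0 < l & l ^+ 3 = s.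
Proof.
move=> s0; exists (s `^ 3^-1); first exact: powR_gt0.
by rewrite -powR_mulrn ?powR_ge0// -powRrM mulVf// powRr1// ltW.
Qed.

(** The form in which the first-order conditions are extracted from competitors. *)
Lemma le_of_affine (R : realType) (a b c : R) :
  (forall s, 0 < s < 1 -> a <= b + s * c) -> a <= b.
Proof.
move=> h; rewrite leNgt; apply/negP => ba.
have e0 : 0 < a - b by rewrite subr_gt0.
have c0 := normr_ge0 c.
have d0 : 0 < 2 * (a - b + `|c|) by lra.
pose s := (a - b) / (2 * (a - b + `|c|)).
have s0 : 0 < s by rewrite divr_gt0.
have s1 : s < 1 by rewrite /s ltr_pdivrMr// mul1r; lra.
have sc : s * c <= s * `|c| by rewrite ler_pM2l// ler_norm.
have se : s * (2 * (a - b + `|c|)) = a - b by rewrite /s divfK// gt_eqF.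
have p0 : 0 <= s * (a - b) by rewrite mulr_ge0 // ltW.
have := h s; rewrite s0 s1 => /(_ isT); nra.
Qed.

(** Linear arithmetic of the variations, with abstract reals for the integrals. *)
Lemma half_half_le (R : realType) (a b c : R) : a <= b -> c + 2^-1 * a + 2^-1 * b <= c + b.
Proof. lra. Qed.

Lemma half_cut_arith (R : realType) (kappa a t p f d cf ca : R) :
  f + 2^-1 * a <= t -> t - p <= f - kappa / 2 * cf ->
  kappa * d <= kappa * cf + kappa * ca -> kappa * d = 2 * p -> a <= kappa * ca.
Proof. lra. Qed.

(** Concavity of [s ^ (2 / 3)] at [s = 1]. *)
Lemma square_le_cube (R : realType) (l : R) : 0 <= l ->
  (l ^+ 2 - 1) / 2 <= (l ^+ 3 - 1) / 3.
Proof.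
move=> l0; have h : 0 <= (l - 1) ^+ 2 * (2 * l + 1).
  by rewrite mulr_ge0 ?sqr_ge0// addr_ge0// mulr_ge0.
rewrite -subr_ge0; apply: (le_trans (divr_ge0 h (ler0n _ 6))).
by rewrite le_eqVlt; apply/orP; left; apply/eqP; field.
Qed.

Lemma outer_arith (R : realType) (kappa t p d c k s l h j : R) :
  0 < s -> 0 < kappa -> 0 <= d -> t - kappa / 2 * d <= j - kappa / 2 * h ->
  j <= (1 - s) * (t - s / 3 * p) + s * (l ^+ 2 * k) ->
  (1 - s) ^+ 2 * d + 2 * (s * (1 - s)) * c <= h ->
  t + p / 3 + kappa * c <= kappa * d + (s * (p / 3 + kappa * c) + l ^+ 2 * k).
Proof.
move=> s0 k0 d0 h1 h2 h3; rewrite -(ler_pM2l s0) -subr_ge0.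
have k2 : 0 < kappa / 2 by rewrite divr_gt0.
have h4 := ler_wpM2l (ltW k2) h3.
have h5 : 0 <= kappa / 2 * s ^+ 2 * d by rewrite !mulr_ge0 ?sqr_ge0// ltW.
have h6 : (1 - s) * (t - s / 3 * p) + s * (l ^+ 2 * k) -
  kappa / 2 * ((1 - s) ^+ 2 * d + 2 * (s * (1 - s)) * c) - (t - kappa / 2 * d) >= 0.
  lra.
apply: (le_trans (addr_ge0 h5 h6)).
by rewrite le_eqVlt; apply/orP; left; apply/eqP; field.
Qed.

Lemma inner_arith (R : realType) (kappa t p d c s h j : R) :
  0 < s -> 0 < kappa -> 0 <= d -> t - kappa / 2 * d <= j - kappa / 2 * h ->
  j <= (1 + s) * (t + s / 3 * p) ->
  (1 + s) ^+ 2 * d <= h + 2 * (s * (1 + s)) * c ->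
  kappa * d <= t + p / 3 + kappa * c + s * (p / 3 + kappa * c).
Proof.
move=> s0 k0 d0 h1 h2 h3; rewrite -(ler_pM2l s0) -subr_ge0.
have k2 : 0 < kappa / 2 by rewrite divr_gt0.
have h4 := ler_wpM2l (ltW k2) h3; rewrite mulrDr in h4.
have h5 : 0 <= kappa / 2 * s ^+ 2 * d by rewrite !mulr_ge0 ?sqr_ge0// ltW.
have h6 : (1 + s) * (t + s / 3 * p) - kappa / 2 * (1 + s) ^+ 2 * d +
   kappa / 2 * (2 * (s * (1 + s)) * c) - (t - kappa / 2 * d) >= 0.
  by rewrite -mulrA; lra.
apply: (le_trans (addr_ge0 h5 h6)).
by rewrite le_eqVlt; apply/orP; left; apply/eqP; field.
Qed.

(** What the variational arguments use of the kinetic density [jn] and of its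
    virial [vn], which is the derivative of [jn] under dilations; [pe] is the
    exponent of the space of admissible densities. *)
Record kinetic_law (R : realType) (pe : R) (jn vn : R -> R) : Prop := KineticLaw {
  law_ge0 : forall t, 0 <= jn t;
  law_vge0 : forall t, 0 <= vn t;
  law_0 : jn 0 = 0;
  law_le : forall t t', 0 <= t -> t <= t' -> jn t <= jn t';
  law_jv : forall t, jn t <= vn t;
  law_vj : forall t, vn t <= 2 * jn t;
  law_scale : forall l t, 0 < l -> 0 <= t ->
    jn (l ^+ 3 * t) <= l ^+ 3 * (jn t + (l ^+ 2 - 1) / 2 * vn t);
  law_measurable : forall f : 'R3 R -> R, measurable_fun setT f -> (forall x, 0 <= f x) ->
    measurable_fun setT (fun x => jn (f x));
  law_vmeasurable : forall f : 'R3 R -> R, measurable_fun setT f -> (forall x, 0 <= f x) ->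
    measurable_fun setT (fun x => vn (f x));
  law_bound : exists2 C, 0 <= C & forall t, 0 <= t -> jn t <= C * t `^ pe }.

Section variations.
Variable R : realType.
Variables (kappa N pe : R) (jn vn : R -> R).
Hypothesis kappa0 : 0 < kappa.
Hypothesis N0 : 0 < N.
Hypothesis pe0 : 0 < pe.
Local Notation I3 f := (nnint (@leb3 R) f%R).
Implicit Types (f g h : 'R3 R -> R).

Hypothesis law : kinetic_law pe jn vn.
Hypothesis coulomb_fin : forall f, density pe f -> (coulomb_form f f < +oo)%E.

Definition Kin f : R := fine (I3 (fun x => jn (f x))).
Definition Vir f : R := fine (I3 (fun x => vn (f x))).
Definition Cou f g : R := fine (coulomb_form f g).

Lemma admissibleP f : admissible pe N f <->
  [/\ forall x, 0 <= f x, measurable_fun setT f, I3 f = N%:E &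
      (I3 (fun x => f x `^ pe) < +oo)%E].
Proof.
split.
  by move=> [/(densityP _ pe0)[f0 mf _ fp] fN].
move=> [f0 mf fN fp]; split => //; apply/(densityP _ pe0); split => //.
by rewrite fN ltry.
Qed.

Lemma Kin_fin f : admissible pe N f -> I3 (fun x => jn (f x)) = (Kin f)%:E.
Proof.
move=> /admissibleP[f0 mf fN fp]; rewrite /Kin fineK// ge0_fin_numE; last first.
  by apply: nnint_ge0 => x; apply: (law_ge0 law).
have [C C0 jC] := law_bound law.
have mfp : measurable_fun setT (fun x => f x `^ pe).
  exact: (measurableT_comp (measurable_powR _) mf).
have fp0 x : 0 <= f x `^ pe by exact: powR_ge0.
apply: (@le_lt_trans _ _ (C%:E * I3 (fun x => f x `^ pe))%E).
  rewrite -(nnintZ _ mfp fp0 C0); apply: le_nnint.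
  - exact: (law_measurable law mf f0).
  - exact: measurable_funM.
  - by move=> x; apply: (law_ge0 law).
  - by move=> x; exact: jC.
by rewrite lte_mul_pinfty// lee_fin.
Qed.

Lemma Vir_fin f : admissible pe N f -> I3 (fun x => vn (f x)) = (Vir f)%:E.
Proof.
move=> af; have /admissibleP[f0 mf fN fp] := af.
rewrite /Vir fineK// ge0_fin_numE; last by apply: nnint_ge0 => x; apply: (law_vge0 law).
have mj := law_measurable law mf f0.
have j0 x : 0 <= jn (f x) by apply: (law_ge0 law).
apply: (@le_lt_trans _ _ (2%:E * I3 (fun x => jn (f x)))%E).
  rewrite -(nnintZ _ mj j0 (ler0n _ 2)); apply: le_nnint.
  - exact: (law_vmeasurable law mf f0).
  - exact: measurable_funM.
  - by move=> x; apply: (law_vge0 law).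
  - by move=> x; apply: (law_vj law).
by rewrite (Kin_fin af) -EFinM ltry.
Qed.

Lemma Cou_fin f : admissible pe N f -> coulomb_form f f = (Cou f f)%:E.
Proof.
move=> af; have [df _] := af; have [f0 mf _ _] := (densityP _ pe0).1 df.
by rewrite /Cou fineK// ge0_fin_numE ?coulomb_fin// coulomb_form_ge0.
Qed.

Lemma energyE f : admissible pe N f ->
  energy kappa jn f = (Kin f - kappa / 2 * Cou f f)%:E.
Proof.
move=> af; have /admissibleP[f0 mf _ _] := af.
rewrite /energy -/(nnint _ _) (Kin_fin af) (coulombE mf f0) (Cou_fin af) -!EFinM -EFinB.
by congr EFin; field.
Qed.

Lemma Cou_ge0 f g : (forall x, 0 <= f x) -> (forall x, 0 <= g x) -> 0 <= Cou f g.
Proof. by move=> f0 g0; rewrite fine_ge0// coulomb_form_ge0. Qed.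

Lemma Kin_ge0 f : 0 <= Kin f.
Proof. by rewrite fine_ge0// nnint_ge0// => x; apply: (law_ge0 law). Qed.

Lemma Vir_ge0 f : 0 <= Vir f.
Proof. by rewrite fine_ge0// nnint_ge0// => x; apply: (law_vge0 law). Qed.

Lemma Kin_le_Vir f : admissible pe N f -> Kin f <= Vir f.
Proof.
move=> af; have /admissibleP[f0 mf _ _] := af.
have : (I3 (fun x => jn (f x)) <= I3 (fun x => vn (f x)))%E.
  apply: le_nnint.
  - exact: (law_measurable law mf f0).
  - exact: (law_vmeasurable law mf f0).
  - by move=> x; apply: (law_ge0 law).
  - by move=> x; apply: (law_jv law).
by rewrite (Kin_fin af) (Vir_fin af) lee_fin.
Qed.

Lemma Kin_scale f l : admissible pe N f -> 0 < l ->
  (I3 (fun x => jn (l ^+ 3 * f x)) <=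
   (l ^+ 3 * (Kin f + (l ^+ 2 - 1) / 2 * Vir f))%:E)%E.
Proof.
move=> af l0; have /admissibleP[f0 mf _ _] := af.
have l30 : 0 <= l ^+ 3 by rewrite exprn_ge0// ltW.
have l50 : 0 <= l ^+ 5 / 2 by rewrite divr_ge0// exprn_ge0// ltW.
have l320 : 0 <= l ^+ 3 / 2 by rewrite divr_ge0.
have mlf : measurable_fun setT (fun x => l ^+ 3 * f x) by exact: measurable_funM.
have lf0 x : 0 <= l ^+ 3 * f x by rewrite mulr_ge0.
have mjl := law_measurable law mlf lf0.
have mj := law_measurable law mf f0; have mv := law_vmeasurable law mf f0.
have j0 t : 0 <= jn t by apply: (law_ge0 law).
have v0 t : 0 <= vn t by apply: (law_vge0 law).
have : (I3 (fun x => jn (l ^+ 3 * f x) + l ^+ 3 / 2 * vn (f x)) <=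
    I3 (fun x => l ^+ 3 * jn (f x) + l ^+ 5 / 2 * vn (f x)))%E.
  apply: le_nnint.
  - by apply: measurable_funD => //; exact: measurable_funM.
  - by apply: measurable_funD; exact: measurable_funM.
  - by move=> x; rewrite addr_ge0// mulr_ge0.
  move=> x; have := law_scale law l0 (f0 x).
  rewrite -(lerD2r (l ^+ 3 / 2 * vn (f x))) => /le_trans; apply.
  by rewrite le_eqVlt; apply/orP; left; apply/eqP; field.
rewrite (nnintD _ mjl (measurable_funM (measurable_cst _) mv) (fun=> j0 _) (fun=> mulr_ge0 l320 (v0 _))).
rewrite (nnintD _ (measurable_funM (measurable_cst _) mj) (measurable_funM (measurable_cst _) mv)
  (fun=> mulr_ge0 l30 (j0 _)) (fun=> mulr_ge0 l50 (v0 _))).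
rewrite (nnintZ _ mv (fun=> v0 _) l320) (nnintZ _ mv (fun=> v0 _) l50) (nnintZ _ mj (fun=> j0 _) l30).
rewrite (Kin_fin af) (Vir_fin af) -!EFinM -EFinD.
case: (I3 _) => [a| |]//=; rewrite -?EFinD ?lee_fin ?leNye//.
by move=> h; rewrite -(lerD2r (l ^+ 3 / 2 * Vir f)) (le_trans h)// le_eqVlt; apply/orP; left; apply/eqP; field.
Qed.

Definition rescale l f : 'R3 R -> R := fun x => l ^+ 3 * dilate l f x.

Lemma rescale_adm l f : 0 < l -> admissible pe N f -> admissible pe N (rescale l f).
Proof.
move=> l0 /admissibleP[f0 mf fN fp]; apply/admissibleP.
have l3 : 0 < l ^+ 3 by rewrite exprn_gt0.
have md := measurable_dilate l mf; have d0 x : 0 <= dilate l f x by exact: f0.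
split.
- by move=> x; rewrite mulr_ge0// ltW.
- exact: measurable_funM.
- rewrite (nnintZ _ md d0 (ltW l3)) (nnint_dilate l0 mf f0) fN -!EFinM.
  by rewrite mulrA divff ?mul1r// gt_eqF.
have mfp : measurable_fun setT (fun x => f x `^ pe).
  exact: (measurableT_comp (measurable_powR _) mf).
have fp0 x : 0 <= f x `^ pe by exact: powR_ge0.
rewrite (_ : I3 _ = I3 (fun x => (l ^+ 3) `^ pe * dilate l (fun x => f x `^ pe) x)); last first.
  by apply: eq_nnint => x; rewrite /rescale powRM// ltW.
rewrite (nnintZ _ (measurable_dilate l mfp) (fun=> fp0 _) (powR_ge0 _ _)).
rewrite (nnint_dilate l0 mfp fp0) muleA -EFinM lte_mul_pinfty// lee_fin.
by rewrite mulr_ge0 ?powR_ge0// invr_ge0 ltW.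
Qed.

Lemma Kin_rescale l f : 0 < l -> admissible pe N f ->
  Kin (rescale l f) <= Kin f + (l ^+ 2 - 1) / 2 * Vir f.
Proof.
move=> l0 af; have /admissibleP[f0 mf fN fp] := af.
have l3 : 0 < l ^+ 3 by rewrite exprn_gt0.
rewrite -lee_fin -(Kin_fin (rescale_adm l0 af)).
have mlf : measurable_fun setT (fun x => l ^+ 3 * f x) by exact: measurable_funM.
have lf0 x : 0 <= l ^+ 3 * f x by rewrite mulr_ge0// ltW.
have mjl := law_measurable law mlf lf0.
have -> : I3 (fun x => jn (rescale l f x)) = ((l ^- 3)%:E * I3 (fun x => jn (l ^+ 3 * f x)))%E.
  rewrite -(nnint_dilate l0 mjl); first exact: eq_nnint.
  by move=> x; apply: (law_ge0 law).
apply: (@le_trans _ _ ((l ^- 3)%:E * (l ^+ 3 * (Kin f + (l ^+ 2 - 1) / 2 * Vir f))%:E)%E).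
  by apply: lee_wpmul2l; [rewrite lee_fin invr_ge0 ltW|exact: Kin_scale].
by rewrite -EFinM mulrA mulVf ?mul1r// gt_eqF.
Qed.

Lemma Cou_rescale l f : 0 < l -> admissible pe N f ->
  Cou (rescale l f) (rescale l f) = l * Cou f f.
Proof.
move=> l0 af; have /admissibleP[f0 mf fN fp] := af.
have l3 : 0 < l ^+ 3 by rewrite exprn_gt0.
have md := measurable_dilate l mf; have d0 x : 0 <= dilate l f x by exact: f0.
have mr : measurable_fun setT (rescale l f) by exact: measurable_funM.
have r0 x : 0 <= rescale l f x by rewrite mulr_ge0// ltW.
have E : coulomb_form (rescale l f) (rescale l f) = (l * Cou f f)%:E.
  rewrite (coulomb_formZl md mr d0 r0 (ltW l3)) (coulomb_formC md mr d0 r0).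
  rewrite (coulomb_formZl md md d0 d0 (ltW l3)) (coulomb_form_dilate l0 mf mf f0 f0).
  rewrite (Cou_fin af) -!EFinM; congr EFin; field.
  by rewrite gt_eqF.
by rewrite /Cou E.
Qed.

Variable rho : 'R3 R -> R.
Hypothesis rho_adm : admissible pe N rho.
Hypothesis rho_min : forall f, admissible pe N f -> (energy kappa jn rho <= energy kappa jn f)%E.
Local Notation T := (Kin rho).
Local Notation P := (Vir rho).
Local Notation D := (Cou rho rho).

Let rho0 : forall x, 0 <= rho x. Proof. by have /admissibleP[] := rho_adm. Qed.
Let mrho : measurable_fun setT rho. Proof. by have /admissibleP[] := rho_adm. Qed.
Let rhoN : I3 rho = N%:E. Proof. by have /admissibleP[] := rho_adm. Qed.

Lemma min_le f : admissible pe N f -> T - kappa / 2 * D <= Kin f - kappa / 2 * Cou f f.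
Proof.
by move=> af; have := rho_min af; rewrite (energyE rho_adm) (energyE af) lee_fin.
Qed.

(** Dilations preserve the mass, multiply [D] by [l] and have derivative [P] on
    the kinetic energy: stationarity at [l = 1] is the virial theorem. *)
Lemma virial : kappa * D = 2 * P.
Proof.
have key l : 0 < l -> (l - 1) * (kappa * D) <= (l - 1) * ((l + 1) * P).
  move=> l0; have := min_le (rescale_adm l0 rho_adm).
  rewrite (Cou_rescale l0 rho_adm) => h.
  have := le_trans h (lerB (Kin_rescale l0 rho_adm) (lexx _)).
  move=> {}h; move: (Kin rho) (Vir rho) (Cou rho rho) h => t p d h; nra.
apply/eqP; rewrite eq_le; apply/andP; split.
- apply: (@le_of_affine _ _ _ P) => s /andP[s0 s1].
  have s10 : 0 < 1 + s by rewrite addr_gt0.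
  have := key _ s10; rewrite (_ : 1 + s - 1 = s); last by ring.
  by rewrite (ler_pM2l s0) (_ : 1 + s + 1 = 2 + s) ?mulrDl//; ring.
- apply: (@le_of_affine _ _ _ P) => s /andP[s0 s1].
  have s10 : 0 < 1 - s by rewrite subr_gt0.
  have := key _ s10; rewrite (_ : 1 - s - 1 = - s); last by ring.
  rewrite !mulNr lerN2 (ler_pM2l s0) => h.
  by rewrite -lerBlDr -mulrBl (_ : 2 - s = 1 - s + 1)//; ring.
Qed.

Lemma energy_min : T - kappa / 2 * D = T - P.
Proof. by have := virial; move: T P D => t p d; lra. Qed.

Lemma energy_min_le0 : T - P <= 0.
Proof. by rewrite subr_le0; exact: Kin_le_Vir. Qed.

Let cut (A : set ('R3 R)) : 'R3 R -> R := fun x => \1_A x * rho x.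

Let cut0 A x : 0 <= cut A x.
Proof. by rewrite /cut mulr_ge0// indicE. Qed.

Let mcut A : measurable A -> measurable_fun setT (cut A).
Proof. by move=> mA; apply: measurable_funM mrho; exact: measurable_indic. Qed.

(** Removing half of the mass above [A] and dilating what remains to the original
    mass cannot lower the energy, because the minimal energy is nonpositive. *)
Lemma half_cut A : measurable A ->
  (I3 (fun x => \1_A x * jn (rho x)) <= kappa%:E * coulomb_form (cut A) rho)%E.
Proof.
move=> mA.
pose w x : R := 1 - 2^-1 * \1_A x.
have w12 x : 2^-1 <= w x <= 1 by rewrite /w indicE; case: (x \in A) => /=; lra.
pose f x := w x * rho x.
have f0 x : 0 <= f x by rewrite mulr_ge0//; have /andP[] := w12 x; lra.
have mw : measurable_fun setT w.
  apply: measurable_funB => //; apply: measurable_funM => //; exact: measurable_indic.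
have mf : measurable_fun setT f by exact: measurable_funM.
have fE x : rho x = f x + 2^-1 * cut A x by rewrite /f /w /cut; ring.
have f_le x : f x <= rho x by rewrite ler_piMl//; have /andP[] := w12 x.
have c_le x : cut A x <= rho x by rewrite /cut ler_piMl// indicE; case: (x \in A).
have mc := mcut mA.
have h20 : (0 : R) <= 2^-1 by [].
have fN : (I3 f <= N%:E)%E by rewrite -rhoN; exact: le_nnint.
have I3f0 : (0 <= I3 f)%E by exact: nnint_ge0.
have I3f : I3 f = (fine (I3 f))%:E by rewrite fineK// ge0_fin_numE// (le_lt_trans fN)// ltry.
set m1 := fine (I3 f) in I3f.
have m1N : m1 <= N by rewrite -lee_fin -I3f.
have m12 : N / 2 <= m1.
  rewrite -lee_fin -I3f mulrC EFinM -rhoN -(nnintZ (@leb3 R) mrho rho0 h20).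
  apply: le_nnint => //.
  - exact: measurable_funM.
  - by move=> x; rewrite mulr_ge0.
  - by move=> x; rewrite /f ler_wpM2r//; have /andP[] := w12 x.
have m10 : 0 < m1 by rewrite (lt_le_trans _ m12)// divr_gt0.
have [l l0 lE] := cuberoot (divr_gt0 N0 m10).
have li0 : 0 < l^-1 by rewrite invr_gt0.
have l31 : 1 <= l ^+ 3 by rewrite lE ler_pdivlMr// mul1r.
pose f2 := dilate l^-1 f.
have lV : (l^-1)^- 3 = l ^+ 3 by rewrite exprVn invrK.
have lV5 : (l^-1)^- 5 = l ^+ 5 by rewrite exprVn invrK.
have mfp : measurable_fun setT (fun x => rho x `^ pe).
  exact: (measurableT_comp (measurable_powR _) mrho).
have mffp : measurable_fun setT (fun x => f x `^ pe).
  exact: (measurableT_comp (measurable_powR _) mf).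
have adm2 : admissible pe N f2.
  apply/admissibleP; split.
  - by move=> x; exact: f0.
  - exact: measurable_dilate.
  - by rewrite (nnint_dilate li0 mf f0) lV I3f -EFinM lE divfK// gt_eqF.
  rewrite (_ : I3 _ = I3 (dilate l^-1 (fun x => f x `^ pe)))//.
  rewrite (nnint_dilate li0 mffp (fun=> powR_ge0 _ _)).
  rewrite lte_mul_pinfty//; first by rewrite lee_fin invr_ge0 exprn_ge0// ltW.
  have /admissibleP[_ _ _ h] := rho_adm; apply: le_lt_trans h.
  apply: le_nnint => //; first by move=> x; exact: powR_ge0.
  by move=> x; rewrite ge0_ler_powR// ?nnegrE ?(ltW pe0).
have mj := law_measurable law mrho rho0; have mjf := law_measurable law mf f0.
have j0 t : 0 <= jn t by exact: (law_ge0 law).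
have mjA : measurable_fun setT (fun x => \1_A x * jn (rho x)).
  by apply: measurable_funM mj; exact: measurable_indic.
have jA0 x : 0 <= \1_A x * jn (rho x) by rewrite mulr_ge0// indicE.
have jhalf t : 0 <= t -> jn (2^-1 * t) <= 2^-1 * jn t.
  move=> t0; have [k k0 kE] := @cuberoot R 2^-1 ltac:(by []).
  have := law_scale law k0 t0; rewrite kE => /le_trans; apply.
  rewrite ler_pM2l// gerDl; apply: mulr_le0_ge0; last exact: (law_vge0 law).
  have k1 : k < 1.
    rewrite ltNge; apply/negP => k1; have := exprn_ege1 3 k1.
    by rewrite kE leNgt invf_lt1// ltr1n.
  by rewrite pmulr_lle0 ?invr_gt0// subr_le0 expr_le1// ltW.
have T1 : (I3 (fun x => jn (f x)) + (2^-1)%:E * I3 (fun x => \1_A x * jn (rho x)) <= T%:E)%E.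
  rewrite -(nnintZ _ mjA jA0 h20) -(nnintD _ mjf (measurable_funM (measurable_cst _) mjA) (fun=> j0 _) (fun=> mulr_ge0 h20 (jA0 _))).
  rewrite -(Kin_fin rho_adm); apply: le_nnint.
  - exact: (measurable_funD mjf (measurable_funM (measurable_cst _) mjA)).
  - exact: mj.
  - by move=> x; apply: addr_ge0; [exact: j0|apply: mulr_ge0].
  move=> x; suff : forall a : R, a = 0 \/ a = 1 ->
      jn ((1 - 2^-1 * a) * rho x) + 2^-1 * (a * jn (rho x)) <= jn (rho x).
    by apply; rewrite indicE; case: (x \in A); [right|left].
  move=> a [|] ->; first by rewrite mulr0 subr0 !mul1r mul0r mulr0 addr0.
  rewrite mulr1 mul1r (_ : 1 - 2^-1 = 2^-1 :> R); last by field.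
  have := jhalf _ (rho0 x); move: (jn (2^-1 * rho x)) (jn (rho x)) => y z h.
  by rewrite -lerBrDr (le_trans h)// le_eqVlt; apply/orP; left; apply/eqP; field.
have CA : (coulomb_form (cut A) rho <= D%:E)%E.
  by rewrite -(Cou_fin rho_adm); exact: le_coulomb_form.
have CA0 : (0 <= coulomb_form (cut A) rho)%E by exact: coulomb_form_ge0.
have CAE : coulomb_form (cut A) rho = (Cou (cut A) rho)%:E.
  by rewrite /Cou fineK// ge0_fin_numE// (le_lt_trans CA)// ltry.
have C1 : (coulomb_form f f <= D%:E)%E.
  by rewrite -(Cou_fin rho_adm); exact: le_coulomb_form.
have C10 : (0 <= coulomb_form f f)%E by exact: coulomb_form_ge0.
have C1E : coulomb_form f f = (Cou f f)%:E.
  by rewrite /Cou fineK// ge0_fin_numE// (le_lt_trans C1)// ltry.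
have D1 : D <= Cou f f + Cou (cut A) rho.
  have mhc := measurable_funM (measurable_cst (2^-1 : R)) mc.
  have hc0 x : 0 <= 2^-1 * cut A x by apply: mulr_ge0.
  have := coulomb_formDl mf mhc mrho f0 hc0 rho0.
  rewrite (_ : (fun x => f x + _) = rho); last by apply/funext => x; rewrite -fE.
  rewrite (Cou_fin rho_adm) (coulomb_formZl mc mrho (cut0 A) rho0 h20) CAE.
  rewrite (coulomb_formC mf mrho f0 rho0).
  have := coulomb_formDl mf mhc mf f0 hc0 f0.
  rewrite (_ : (fun x => f x + _) = rho); last by apply/funext => x; rewrite -fE.
  rewrite (coulomb_formZl mc mf (cut0 A) f0 h20) C1E => ->.
  have : (coulomb_form (cut A) f <= coulomb_form (cut A) rho)%E by exact: le_coulomb_form.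
  have : (0 <= coulomb_form (cut A) f)%E by exact: coulomb_form_ge0.
  rewrite CAE; case: (coulomb_form (cut A) f) => [a| |]//= _.
  rewrite lee_fin => ha /eqP; rewrite -!EFinM -!EFinD eqe => /eqP ->; exact: half_half_le.
have jf_fin : (I3 (fun x => jn (f x)) <= T%:E)%E.
  rewrite -(Kin_fin rho_adm); apply: le_nnint => //.
  by move=> x; apply: (law_le law).
have jf0 : (0 <= I3 (fun x => jn (f x)))%E by exact: nnint_ge0.
have jA_fin : (I3 (fun x => \1_A x * jn (rho x)) <= T%:E)%E.
  rewrite -(Kin_fin rho_adm); apply: le_nnint => //.
  by move=> x; rewrite ler_piMl// indicE; case: (x \in A).
have jAge0 : (0 <= I3 (fun x => \1_A x * jn (rho x)))%E by exact: nnint_ge0.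
have K2 : I3 (fun x => jn (f2 x)) = ((l ^+ 3)%:E * I3 (fun x => jn (f x)))%E.
  by rewrite -lV -(nnint_dilate li0 mjf (fun=> j0 _)).
have C2 : coulomb_form f2 f2 = ((l ^+ 5)%:E * (Cou f f)%:E)%E.
  by rewrite -lV5 -C1E -(coulomb_form_dilate li0 mf mf f0 f0).
have := min_le adm2; rewrite energy_min.
have -> : Kin f2 = l ^+ 3 * Kin f.
  rewrite /Kin K2; case: (I3 (fun x => jn (f x))) jf_fin jf0 => [a| |]//=.
have -> : Cou f2 f2 = l ^+ 5 * Cou f f by rewrite {1}/Cou C2.
have KfE : I3 (fun x => jn (f x)) = (Kin f)%:E.
  by rewrite /Kin fineK// ge0_fin_numE// (le_lt_trans jf_fin)// ltry.
move: T1; rewrite KfE CAE.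
case: (I3 (fun x => \1_A x * jn (rho x))) jA_fin jAge0 => [a| |]//= _ _.
rewrite -!EFinM -!EFinD !lee_fin => T1 hmin.
have Cf0 : 0 <= Cou f f by exact: Cou_ge0.
have l2 : 1 <= l ^+ 2.
  rewrite leNgt; apply/negP => l21.
  have l1 : l < 1 by rewrite ltNge; apply/negP => /(exprn_ege1 2); rewrite leNgt l21.
  have : l ^+ 3 < 1 by rewrite exprn_ilt1// ltW.
  by rewrite ltNge l31.
have E1 : T - P <= Kin f - kappa / 2 * Cou f f.
  have E0 := energy_min_le0.
  have [//|h] := leP (T - P) (Kin f - kappa / 2 * Cou f f).
  have hh : T - P <= l ^+ 3 * (Kin f - kappa / 2 * Cou f f).
    apply: le_trans hmin _; rewrite mulrBr lerD2l lerN2.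
    rewrite [l ^+ 5](_ : _ = l ^+ 3 * l ^+ 2); last by rewrite -exprD.
    have k0 : 0 <= kappa / 2 * Cou f f by rewrite mulr_ge0// divr_ge0// ltW.
    have l32 : l ^+ 3 <= l ^+ 3 * l ^+ 2 by rewrite ler_peMr// (le_trans _ l31).
    have := ler_wpM2r k0 l32; congr (_ <= _).
    by rewrite mulrCA.
  have : l ^+ 3 * (Kin f - kappa / 2 * Cou f f) <= Kin f - kappa / 2 * Cou f f.
    by rewrite ger_nMl//; exact: lt_le_trans h E0.
  by move=> h2; have := le_trans hh h2; rewrite leNgt h.
have := virial; have := ler_wpM2l (ltW kappa0) D1; rewrite mulrDr.
exact: half_cut_arith T1 E1.
Qed.

(** The sets [A] of [half_cut] are arbitrary. *)
Lemma ae_kinetic_le_potential :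
  {ae @leb3 R, forall x, ((jn (rho x))%:E <= kappa%:E * ((rho x)%:E * potential rho x))%E}.
Proof.
have V0 x : (0 <= potential rho x)%E by exact: potential_ge0.
have mV : measurable_fun setT (fun x => ((rho x)%:E * potential rho x)%E).
  by apply: emeasurable_funM; [exact/measurable_EFinP|exact: measurable_potential].
have rV0 x : (0 <= (rho x)%:E * potential rho x)%E by rewrite mule_ge0// lee_fin.
apply: ae_le_of_set_integrals.
- exact: (law_measurable law mrho rho0).
- by move=> x; exact: (law_ge0 law).
- by apply: measurable_funeM.
- by move=> x; rewrite mule_ge0// lee_fin ltW.
- rewrite (ge0_integralZl _ measurableT mV (fun x _ => rV0 x)); last by rewrite lee_fin ltW.
  by rewrite -(coulomb_formE mrho mrho rho0 rho0) (Cou_fin rho_adm) -EFinM ltry.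
move=> A mA.
rewrite (ge0_integralZl _ mA (measurable_funTS mV) (fun x _ => rV0 x)); last first.
  by rewrite lee_fin ltW.
have := half_cut mA; rewrite (coulomb_formE (mcut mA) mrho (cut0 A) rho0).
rewrite (integral_mkcond A (fun x => (jn (rho x))%:E)).
rewrite (integral_mkcond A (fun x => ((rho x)%:E * potential rho x)%E)).
congr (_ <= _ * _)%E.
- apply: eq_integral => x _; rewrite patchE indicE; case: ifP => /= _.
    by rewrite mul1r.
  by rewrite mul0r.
- apply: eq_integral => x _; rewrite patchE /cut indicE; case: ifP => /= _.
    by rewrite mul1r.
  by rewrite mul0r mul0e.
Qed.

(** With [s = l ^ 3] the slope [(l ^ 2 - 1) / 2] is at most [(s - 1) / 3]. *)
Lemma Kin_multiple s : 0 < s -> (I3 (fun x => jn (s * rho x)) <= (s * (T + (s - 1) / 3 * P))%:E)%E.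
Proof.
move=> s0; have [l l0 lE] := cuberoot s0.
have := Kin_scale rho_adm l0; rewrite lE => /le_trans; apply.
rewrite lee_fin ler_pM2l// lerD2l ler_wpM2r ?Vir_ge0// -lE.
exact: square_le_cube (ltW l0).
Qed.

(** Moving a small part of the mass of [rho] outside of its support. The kinetic
    energy of the mass moved is negligible, as it is of order [s ^ (5 / 3)]. *)
Lemma outer_variation g K : (forall x, 0 <= g x) -> measurable_fun setT g ->
  I3 g = N%:E -> (I3 (fun x => g x `^ pe) < +oo)%E -> (forall x, rho x * g x = 0) ->
  (forall l, 0 < l -> (I3 (fun x => jn (l ^+ 3 * g x)) <= (l ^+ 5 * K)%:E)%E) ->
  0 <= K ->
  T + P / 3 + kappa * Cou rho g <= kappa * D.
Proof.
move=> g0 mg gN gp rg gK K0.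
have C0 : 0 <= Cou rho g by exact: Cou_ge0.
have D0 : 0 <= D by exact: Cou_ge0.
have P0 : 0 <= P by exact: Vir_ge0.
have rg_cases x : rho x = 0 \/ g x = 0.
  by have /eqP := rg x; rewrite mulf_eq0 => /orP[] /eqP; [left|right].
apply: (@le_of_affine _ _ _ (P / 3 + kappa * Cou rho g + K)) => l /andP[l0 l1].
set s := l ^+ 3.
have s0 : 0 < s by rewrite exprn_gt0.
have s1 : s < 1 by rewrite exprn_ilt1// ltW.
have s10 : 0 < 1 - s by rewrite subr_gt0.
pose h x := (1 - s) * rho x + s * g x.
have m1 : measurable_fun setT (fun x => (1 - s) * rho x) by exact: measurable_funM.
have m2 : measurable_fun setT (fun x => s * g x) by exact: measurable_funM.
have p1 x : 0 <= (1 - s) * rho x by rewrite mulr_ge0// ltW.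
have p2 x : 0 <= s * g x by rewrite mulr_ge0// ltW.
have mh : measurable_fun setT h by exact: measurable_funD.
have h0 x : 0 <= h x by exact: addr_ge0.
have mpow f : measurable_fun setT f -> measurable_fun setT (fun x => f x `^ pe).
  by move=> mf; exact: (measurableT_comp (measurable_powR _) mf).
have ah : admissible pe N h.
  apply/admissibleP; split; [exact: h0|exact: mh| |].
  - rewrite (nnintD _ m1 m2 p1 p2) (nnintZ _ mrho rho0 (ltW s10)) (nnintZ _ mg g0 (ltW s0)).
    by rewrite rhoN gN -!EFinM -EFinD -mulrDl subrK mul1r.
  apply: (@le_lt_trans _ _ (I3 (fun x => rho x `^ pe) + I3 (fun x => g x `^ pe))%E); last first.
    by apply: lte_add_pinfty; [have /admissibleP[_ _ _] := rho_adm|exact: gp].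
  rewrite -(nnintD _ (mpow _ mrho) (mpow _ mg) (fun=> powR_ge0 _ _) (fun=> powR_ge0 _ _)).
  apply: le_nnint.
  - exact: mpow.
  - exact: (measurable_funD (mpow _ mrho) (mpow _ mg)).
  - by move=> x; exact: powR_ge0.
  move=> x; rewrite /h; have [e|e] := rg_cases x.
    rewrite e mulr0 add0r powR0 ?gt_eqF// add0r ge0_ler_powR// ?nnegrE ?(ltW pe0)//.
    by rewrite ler_piMl// ltW.
  rewrite e mulr0 addr0 [0 `^ _]powR0 ?gt_eqF// addr0 ge0_ler_powR// ?nnegrE ?(ltW pe0)//.
  by rewrite ler_piMl// gerBl ltW.
have j1 := law_measurable law m1 p1; have j2 := law_measurable law m2 p2.
have j0 t : 0 <= jn t by exact: (law_ge0 law).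
have Kh : Kin h <= (1 - s) * (T - s / 3 * P) + s * (l ^+ 2 * K).
  have E : I3 (fun x => jn (h x)) =
      (I3 (fun x => jn ((1 - s) * rho x)) + I3 (fun x => jn (s * g x)))%E.
    rewrite -(nnintD _ j1 j2 (fun=> j0 _) (fun=> j0 _)); apply: eq_nnint => x.
    rewrite /h; have [e|e] := rg_cases x; rewrite e mulr0.
      by rewrite (law_0 law) !add0r.
    by rewrite (law_0 law) !addr0.
  have := leeD (Kin_multiple s10) (gK l l0).
  rewrite -E (Kin_fin ah) -EFinD lee_fin => /le_trans; apply.
  rewrite -/s (_ : l ^+ 5 = s * l ^+ 2); last by rewrite -exprD.
  by rewrite le_eqVlt; apply/orP; left; apply/eqP; field.
have Ch : (1 - s) ^+ 2 * D + 2 * (s * (1 - s)) * Cou rho g <= Cou h h.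
  have := coulomb_formDl m1 m2 mh p1 p2 h0; rewrite -/h.
  rewrite (coulomb_formC m1 mh p1 h0) (coulomb_formC m2 mh p2 h0).
  have -> := coulomb_formDl m1 m2 m1 p1 p2 p1.
  have -> := coulomb_formDl m1 m2 m2 p1 p2 p2.
  have s1' := ltW s10; have s0' := ltW s0.
  rewrite (coulomb_formZl mrho m1 rho0 p1 s1') (coulomb_formC mrho m1 rho0 p1).
  rewrite (coulomb_formZl mrho mrho rho0 rho0 s1') (coulomb_formZl mg m1 g0 p1 s0').
  rewrite (coulomb_formC mg m1 g0 p1) (coulomb_formZl mrho mg rho0 g0 s1').
  rewrite (coulomb_formZl mrho m2 rho0 p2 s1') (coulomb_formC mrho m2 rho0 p2).
  rewrite (coulomb_formZl mg mrho g0 rho0 s0') (coulomb_formC mg mrho g0 rho0).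
  rewrite (Cou_fin ah) (Cou_fin rho_adm).
  have c0 : (0 <= coulomb_form rho g)%E by exact: coulomb_form_ge0.
  have q0 : (0 <= coulomb_form (fun x => (s * g x)%R) (fun x => (s * g x)%R))%E.
    exact: coulomb_form_ge0.
  rewrite [Cou rho g]/Cou; move: c0 q0.
  case: (coulomb_form rho g) => [c| |]//; last first.
    rewrite !gt0_muley ?lte_fin// => _ q0.
    by rewrite -!EFinM addey// addye//; move: q0; case: coulomb_form.
  move=> _; case: (coulomb_form (fun x => (s * g x)%R) _) => [e| |]//.
  rewrite lee_fin -!EFinM -!EFinD => e0 /eqP; rewrite eqe => /eqP ->; rewrite /=.
  by rewrite -subr_ge0 (le_trans e0)// le_eqVlt; apply/orP; left; apply/eqP; ring.
apply: (le_trans (outer_arith s0 kappa0 D0 (min_le ah) Kh Ch)).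
rewrite lerD2l [leRHS]mulrDr; apply: lerD.
  rewrite ler_wpM2r//; first by rewrite addr_ge0// ?divr_ge0// mulr_ge0// ltW.
  by rewrite /s exprS ler_piMr ?(ltW l0)// expr_le1// ltW.
by rewrite ler_wpM2r// expr2 ler_piMr// ltW.
Qed.

(** Removing mass from [A] and restoring it by a multiple of [rho]. The decrease of
    the kinetic energy on [A] is dropped. *)
Lemma inner_variation A b : measurable A -> 0 < b -> I3 (cut A) = (N / b)%:E ->
  kappa * D <= T + P / 3 + kappa * (b * Cou (cut A) rho).
Proof.
move=> mA b0 cN; have mc := mcut mA.
set c := b * _.
have D0 : 0 <= D by exact: Cou_ge0.
apply: (@le_of_affine _ _ _ (b^-1 * (P / 3 + kappa * c))) => r /andP[r0 r1].
set s := r / b.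
have s0 : 0 < s by rewrite divr_gt0.
have s10 : 0 < 1 + s by rewrite addr_gt0.
pose h x := (1 + s - r * \1_A x) * rho x.
have hE x : (1 + s) * rho x = h x + r * cut A x by rewrite /h /cut; ring.
have h0 x : 0 <= h x.
  rewrite /h mulr_ge0// subr_ge0 indicE; case: (x \in A) => /=.
    by rewrite mulr1 (le_trans (ltW r1))// lerDl ltW.
  by rewrite mulr0 ltW.
have h_le x : h x <= (1 + s) * rho x by rewrite hE lerDl mulr_ge0 ?cut0// ltW.
have mh : measurable_fun setT h.
  apply: measurable_funM => //; apply: measurable_funB => //.
  by apply: measurable_funM => //; exact: measurable_indic.
have mrc : measurable_fun setT (fun x => r * cut A x) by exact: measurable_funM.
have rc0 x : 0 <= r * cut A x by rewrite mulr_ge0// ?cut0// ltW.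
have m1 : measurable_fun setT (fun x => (1 + s) * rho x) by exact: measurable_funM.
have p1 x : 0 <= (1 + s) * rho x by rewrite mulr_ge0// ltW.
have hF : (fun x => h x + r * cut A x) = (fun x => (1 + s) * rho x).
  by apply/funext => x; rewrite hE.
have s10' := ltW s10; have r0' := ltW r0.
have mpow f : measurable_fun setT f -> measurable_fun setT (fun x => f x `^ pe).
  by move=> mf; exact: (measurableT_comp (measurable_powR _) mf).
have ah : admissible pe N h.
  apply/admissibleP; split; [exact: h0|exact: mh| |].
  - have := nnintD (@leb3 R) mh mrc h0 rc0; rewrite hF.
    rewrite (nnintZ _ mrho rho0 s10') (nnintZ _ mc (cut0 A) r0') rhoN cN -!EFinM.
    have : (0 <= I3 h)%E by exact: nnint_ge0.
    case: (I3 h) => [n| |]//= _ /eqP; rewrite -EFinD eqe => /eqP e; congr EFin.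
    apply: (@addIr _ (r * (N / b))); rewrite -e /s; field.
    by rewrite gt_eqF.
  apply: (@le_lt_trans _ _ (((1 + s) `^ pe)%:E * I3 (fun x => rho x `^ pe))%E); last first.
    apply: lte_mul_pinfty; [by rewrite lee_fin powR_ge0|by []|].
    by have /admissibleP[_ _ _] := rho_adm.
  rewrite -(nnintZ _ (mpow _ mrho) (fun=> powR_ge0 _ _) (powR_ge0 _ _)).
  apply: le_nnint.
  - exact: mpow.
  - exact: (measurable_funM (measurable_cst _) (mpow _ mrho)).
  - by move=> x; exact: powR_ge0.
  by move=> x; rewrite -powRM// ge0_ler_powR// ?nnegrE ?(ltW pe0).
have Kh : Kin h <= (1 + s) * (T + s / 3 * P).
  rewrite -lee_fin -(Kin_fin ah); have := Kin_multiple s10.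
  rewrite (_ : (1 + s - 1) = s); last by ring.
  apply: le_trans; apply: le_nnint.
  - exact: (law_measurable law mh h0).
  - exact: (law_measurable law m1 p1).
  - by move=> x; exact: (law_ge0 law).
  - by move=> x; apply: (law_le law).
have CA : (coulomb_form (cut A) rho <= D%:E)%E.
  rewrite -(Cou_fin rho_adm); apply: le_coulomb_form => //.
  by move=> x; rewrite /cut ler_piMl// indicE; case: (x \in A).
have CA0 : (0 <= coulomb_form (cut A) rho)%E by exact: coulomb_form_ge0.
have CAE : coulomb_form (cut A) rho = (Cou (cut A) rho)%:E.
  by rewrite /Cou fineK// ge0_fin_numE// (le_lt_trans CA)// ltry.
have Ch : (1 + s) ^+ 2 * D <= Cou h h + 2 * (s * (1 + s)) * c.
  have := coulomb_formDl mh mrc m1 h0 rc0 p1; rewrite hF.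
  rewrite (coulomb_formC mh m1 h0 p1).
  have := coulomb_formDl mh mrc mh h0 rc0 h0; rewrite hF => ->.
  rewrite (coulomb_formZl mrho m1 rho0 p1 s10') (coulomb_formC mrho m1 rho0 p1).
  rewrite (coulomb_formZl mrho mrho rho0 rho0 s10').
  rewrite (coulomb_formZl mc m1 (cut0 A) p1 r0') (coulomb_formC mc m1 (cut0 A) p1).
  rewrite (coulomb_formZl mrho mc rho0 (cut0 A) s10') (coulomb_formC mrho mc rho0 (cut0 A)).
  rewrite (coulomb_formZl mc mh (cut0 A) h0 r0') CAE (Cou_fin ah) (Cou_fin rho_adm).
  have : (coulomb_form (cut A) h <= ((1 + s) * Cou (cut A) rho)%:E)%E.
    apply: (@le_trans _ _ (coulomb_form (cut A) (fun x => (1 + s) * rho x))).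
      exact: le_coulomb_form.
    rewrite (coulomb_formC mc m1 (cut0 A) p1) (coulomb_formZl mrho mc rho0 (cut0 A) s10').
    by rewrite (coulomb_formC mrho mc rho0 (cut0 A)) CAE.
  have : (0 <= coulomb_form (cut A) h)%E by exact: coulomb_form_ge0.
  case: (coulomb_form (cut A) h) => [e| |]// _.
  rewrite lee_fin -!EFinM -!EFinD => he /eqP; rewrite eqe => /eqP E.
  have -> : (1 + s) ^+ 2 * D = (1 + s) * ((1 + s) * D) by ring.
  rewrite E -addrA lerD2l.
  have -> : 2 * (s * (1 + s)) * c = r * ((1 + s) * Cou (cut A) rho) + r * ((1 + s) * Cou (cut A) rho).
    by rewrite /s /c; field; rewrite gt_eqF.
  by rewrite lerD2r ler_wpM2l.
have := inner_arith s0 kappa0 D0 (min_le ah) Kh Ch.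
by rewrite [r * _]mulrA.
Qed.

End variations.

(** * Uniform bounds for minimizers *)
Section bounded.
Variable R : realType.
Local Notation I3 f := (nnint (@leb3 R) f%R).

(** The hypotheses bound the cube root of [rho] by a multiple of [1 + potential rho]
    almost everywhere, which is what [potential_bootstrap] starts from. *)
Lemma unif_bounded (N A a b kappa : R) : 0 <= N -> 0 < A -> 0 < a -> 0 <= b -> 0 < kappa ->
  exists2 M, 0 < M & forall (rho : 'R3 R -> R) (jn : R -> R),
    measurable_fun setT rho -> (forall x, 0 <= rho x) ->
    (I3 rho <= N%:E)%E -> (I3 (fun x => rho x `^ (4 / 3)) <= A%:E)%E ->
    (forall t, 0 <= t -> a * t `^ (4 / 3) <= jn t + b * t) ->
    {ae @leb3 R, forall x,
      ((jn (rho x))%:E <= kappa%:E * ((rho x)%:E * potential rho x))%E} ->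
    {ae @leb3 R, forall x, rho x <= M} /\ (forall x, potential rho x <= M%:E)%E.
Proof.
move=> N0 A0 a0 b0 k0; set B := (b + kappa) / a.
have B0 : 0 < B by rewrite divr_gt0// ltr_wpDl.
have [M M0 MP] := potential_bootstrap N0 A0 B0.
exists ((B * (1 + M)) ^+ 3 + M + 1).
  by rewrite ltr_wpDl// addr_ge0// exprn_ge0// mulr_ge0 ?(ltW B0)// addr_ge0.
move=> rho jn mrho rho0 rhoN rhoA jb hae.
pose r x := rho x `^ 3^-1.
have r3 x : r x ^+ 3 = rho x.
  by rewrite /r -powR_mulrn ?powR_ge0// -powRrM mulVf// powRr1.
have r4 x : r x ^+ 4 = rho x `^ (4 / 3).
  by rewrite /r -powR_mulrn ?powR_ge0// -powRrM mulrC.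
have mr : measurable_fun setT r by exact: (measurableT_comp (measurable_powR _) mrho).
have r0 x : 0 <= r x by exact: powR_ge0.
have r3E : (fun x => r x ^+ 3) = rho by apply/funext.
have V0 x : (0 <= potential rho x)%E by exact: potential_ge0.
have hr : {ae @leb3 R, forall x, ((r x)%:E <= B%:E * (1 + potential rho x))%E}.
  apply: filterS hae => x hx.
  have := jb _ (rho0 x); rewrite -r4 => h4.
  have := V0 x; case VE : (potential rho x) => [v| |] v0; last by [].
  - move: hx; rewrite VE -[(1 + v%:E)%E]/((1 + v)%:E) -!EFinM !lee_fin => hx.
    have {}v0 : 0 <= v by rewrite -lee_fin.
    have := r0 x; rewrite le_eqVlt => /orP[/eqP <-|rp].
      by apply: mulr_ge0; [exact: ltW|exact: addr_ge0].
    have rp3 : 0 < r x ^+ 3 by rewrite exprn_gt0.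
    have h : a * r x <= b + kappa * v.
      rewrite -(ler_pM2l rp3).
      have -> : r x ^+ 3 * (a * r x) = a * r x ^+ 4 by rewrite mulrCA -exprSr.
      apply: (le_trans h4); rewrite r3 [leRHS]mulrDr addrC [rho x * b]mulrC lerD2l.
      by rewrite [leRHS]mulrCA.
    rewrite /B mulrAC ler_pdivlMr// mulrC (le_trans h)//.
    have bv : 0 <= b * v by apply: mulr_ge0.
    by rewrite mulrDl !mulrDr !mulr1; move: bv k0; move: (b * v) (kappa * v) => y z; lra.
  by rewrite addey// gt0_muley ?lte_fin// leey.
have VM x : (potential rho x <= M%:E)%E.
  rewrite -r3E; apply: MP => //; first by rewrite r3E.
  - by under eq_nnint do rewrite r4.
  - by rewrite r3E.
split.
  apply: filterS hr => x hx.
  have h : r x <= B * (1 + M).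
    rewrite -lee_fin; apply: (le_trans hx).
    apply: (@le_trans _ _ (B%:E * (1 + M%:E))%E); last by [].
    by apply: lee_wpmul2l; [rewrite lee_fin ltW|exact: leeD].
  have h3 : r x ^+ 3 <= (B * (1 + M)) ^+ 3 by rewrite lerXn2r// ?nnegrE// mulr_ge0 ?(ltW B0)// addr_ge0.
  by rewrite -r3 (le_trans h3)// -addrA lerDl addr_ge0.
move=> x; rewrite (le_trans (VM x))// lee_fin addrAC lerDr addr_ge0// exprn_ge0//.
by rewrite mulr_ge0 ?(ltW B0)// addr_ge0.
Qed.

End bounded.

(** * The radius of a radial minimizer *)
Lemma outer_eps_arith (R : realType) (k t c d n r e : R) : 0 < k ->
  t + k * c <= d -> n * (r - e) <= c -> t + k * (n * r) <= d + e * (k * n).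
Proof.
move=> k0 h /(ler_wpM2l (ltW k0)) h2.
have -> : k * (n * r) = k * (n * (r - e)) + e * (k * n) by ring.
rewrite addrA lerD2r; apply: le_trans h; rewrite lerD2l; exact: h2.
Qed.

Section radius.
Variable R : realType.
Local Notation I3 f := (nnint (@leb3 R) f%R).

Definition ball_at (p : 'R3 R) (r : R) : set ('R3 R) := [set z | eucl_dist p z < r].

Lemma measurable_ball_at p r : measurable (ball_at p r).
Proof. by apply: measurable_set_lt => //; exact: measurable_eucl_dist. Qed.

Lemma leb3_ball_at p r : @leb3 R (ball_at p r) = @leb3 R (oball r).
Proof.
rewrite -(nnint_indic (@leb3 R) (measurable_ball_at p r)).
rewrite -(nnint_indic (@leb3 R) (measurable_oball r)) /nnint.
pose F (z : 'R3 R) : \bar R := (\1_(oball r) z : R)%:E.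
have mF : measurable_fun setT F.
  by apply/measurable_EFinP; apply: measurable_indic; exact: measurable_oball.
have F0 z : (0 <= F z)%E by rewrite lee_fin indicE.
have n10 : (-1 : R) != 0 by rewrite oppr_eq0 oner_eq0.
have := leb3_affine p n10 mF F0; rewrite normrN1 expr1n invr1 mul1e => <-.
apply: eq_integral => z _; rewrite /F !indicE.
suff -> : (z \in ball_at p r) = (affine3 (-1) p z \in oball r) by [].
by apply/idP/idP; rewrite !inE /ball_at /oball /= eucl_distE.
Qed.

Lemma eucl_norm_axis (a : R) : 0 <= a -> eucl_norm ((0, 0, a) : 'R3 R) = a.
Proof.
by move=> a0; rewrite /eucl_norm /= expr0n /= !add0r sqrtr_sqr ger0_norm.
Qed.

Lemma eucl_dist_axis (a b : R) : eucl_dist ((0, 0, a) : 'R3 R) (0, 0, b) = `|a - b|.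
Proof. by rewrite /eucl_dist /= subrr expr0n /= !add0r sqrtr_sqr. Qed.

Lemma le_eucl_norm (z : 'R3 R) : z.2 <= eucl_norm z.
Proof.
apply: (le_trans (ler_norm _)); rewrite -sqrtr_sqr ler_wsqrtr// lerDr.
by rewrite addr_ge0// sqr_ge0.
Qed.

Section support.
Variables (rho : 'R3 R -> R) (Rad : R).
Hypothesis rho0 : forall x, 0 <= rho x.
Hypothesis sym : symmetric_decreasing rho.
Hypothesis suppR : has_support_radius rho Rad.

Lemma rho_out x : Rad < eucl_norm x -> rho x = 0.
Proof.
move=> Rx; apply/eqP; apply/negPn/negP => nz.
have : supp rho x by apply: subset_closure.
by have [_ ->] := suppR; rewrite /= leNgt Rx.
Qed.

(** A point of the boundary of the support is a limit of points where [rho] does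
    not vanish, and [rho] is decreasing. *)
Lemma rho_in x : 0 < Rad -> eucl_norm x < Rad -> 0 < rho x.
Proof.
move=> Rp xR; have : supp rho (0, 0, Rad).
  by have [_ ->] := suppR; rewrite /= (eucl_norm_axis (ltW Rp)).
have nb : nbhs ((0, 0, Rad) : R * R * R) [set z : R * R * R | eucl_norm (x : 'R3 R) < z.2].
  have h : z.2 @[z --> ((0, 0, Rad) : R * R * R)] --> Rad by exact: cvg_snd.
  exact: (h _ (lt_nbhsr xR)).
move=> /(_ _ nb)[y [/= nz xy]].
apply: (@lt_le_trans _ _ (rho y)); first by rewrite lt_neqAle eq_sym nz rho0.
by apply: sym; apply: (le_trans (ltW xy)); exact: (le_eucl_norm y).
Qed.

(** Otherwise [rho], which is bounded, would live on balls of arbitrarily small volume. *)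
Lemma radius_gt0 M N : 0 < N -> 0 < M -> measurable_fun setT rho -> I3 rho = N%:E ->
  {ae @leb3 R, forall y, rho y <= M} -> 0 < Rad.
Proof.
move=> N0 M0 mr rN rM; rewrite ltNge; apply/negP => R0.
have mb s : measurable_fun setT (\1_(oball s) : 'R3 R -> R).
  by apply: measurable_indic; exact: measurable_oball.
have al0 := disk_area_gt0 R.
have key s : 0 < s -> N <= M * (disk_area R * (4 / 3 * s ^+ 3)).
  move=> s0; rewrite -lee_fin -rN EFinM -(leb3_oball s0).
  have b0 x : 0 <= (\1_(oball s) x : R) by rewrite indicE.
  rewrite -(nnint_indic (@leb3 R) (measurable_oball s)).
  rewrite -(nnintZ (@leb3 R) (mb s) b0 (ltW M0)); apply: ae_le_nnint.
  - exact: mr.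
  - exact: (measurable_funM (measurable_cst _) (mb s)).
  - exact: rho0.
  - by move=> x; exact: (mulr_ge0 (ltW M0)).
  apply: filterS rM => x hx; rewrite indicE.
  have [xs|xs] := ltP (eucl_norm x) s; first by rewrite mem_set// mulr1.
  by rewrite rho_out ?mulr_ge0 ?(ltW M0)// (lt_le_trans _ xs)// (le_lt_trans R0).
have k0 : 0 < M * (disk_area R * (4 / 3)) by rewrite !mulr_gt0.
have [s s0 sE] := cuberoot (divr_gt0 (divr_gt0 N0 k0) (ltr0n _ 2)).
have := key s s0; rewrite sE !mulrA.
rewrite [leRHS](_ : _ = N / 2).
  by rewrite leNgt ltr_pdivrMr// ltr_pMr// ltr1n.
field; rewrite gt_eqF//= gt_eqF//.
Qed.

End support.

Lemma Cou_between (f g : 'R3 R -> R) (n a b : R) : measurable_fun setT f -> measurable_fun setT g ->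
  (forall x, 0 <= f x) -> (forall x, 0 <= g x) -> I3 f = n%:E -> 0 <= a -> 0 <= b ->
  (forall x, f x != 0 -> (a%:E <= potential g x <= b%:E)%E) -> a * n <= Cou f g <= b * n.
Proof.
move=> mf mg f0 g0 fn a0 b0 H.
have V0 x : (0 <= potential g x)%E by exact: potential_ge0.
have mV : measurable_fun setT (potential g) by exact: measurable_potential.
have mEf : measurable_fun setT (fun x => (f x)%:E) by exact/measurable_EFinP.
have mfV : measurable_fun setT (fun x => ((f x)%:E * potential g x)%E) by exact: emeasurable_funM.
have fV0 x : (0 <= (f x)%:E * potential g x)%E by rewrite mule_ge0// lee_fin.
have maf : measurable_fun setT (fun x => (a * f x)%:E).
  by apply/measurable_EFinP; exact: measurable_funM.
have mbf : measurable_fun setT (fun x => (b * f x)%:E).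
  by apply/measurable_EFinP; exact: measurable_funM.
have H1 x : ((a * f x)%:E <= (f x)%:E * potential g x)%E.
  have [->|nz] := eqVneq (f x) 0; first by rewrite mulr0 mul0e.
  have /andP[h _] := H x nz; rewrite mulrC EFinM; apply: lee_wpmul2l; last exact: h.
  by rewrite lee_fin.
have H2 x : ((f x)%:E * potential g x <= (b * f x)%:E)%E.
  have [->|nz] := eqVneq (f x) 0; first by rewrite mulr0 mul0e.
  have /andP[_ h] := H x nz; rewrite mulrC EFinM; apply: lee_wpmul2l; last exact: h.
  by rewrite lee_fin.
have : ((a * n)%:E <= coulomb_form f g <= (b * n)%:E)%E.
  rewrite (coulomb_formE mf mg f0 g0) !EFinM -fn.
  rewrite -(nnintZ (@leb3 R) mf f0 a0) -(nnintZ (@leb3 R) mf f0 b0); apply/andP; split.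
  - apply: ge0_le_integral; [exact: measurableT| |exact: maf|exact: mfV|].
    + by move=> x _; rewrite lee_fin mulr_ge0.
    + by move=> x _; exact: H1.
  - apply: ge0_le_integral; [exact: measurableT| |exact: mfV|exact: mbf|].
    + by move=> x _; exact: fV0.
    + by move=> x _; exact: H2.
rewrite /Cou; case: (coulomb_form f g) => [c| |]; rewrite ?lee_fin ?leeNy_eq ?leye_eq ?andbF//.
Qed.

(** The two first-order conditions at the boundary: the potential is continuous
    and takes the value [N / Rad] there, so that moving mass into a small ball just
    outside of the support, or away from one just inside of it, costs the same. *)
Lemma boundary_identity (kappa N pe M C Rad : R) (jn vn : R -> R) (rho : 'R3 R -> R) :
  0 < kappa -> 0 < N -> 0 < pe -> 0 < M -> 0 <= C -> kinetic_law pe jn vn ->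
  (forall f, density pe f -> (coulomb_form f f < +oo)%E) ->
  (forall t, 0 <= t -> jn t <= C * t `^ (5 / 3)) ->
  admissible pe N rho ->
  (forall f, admissible pe N f -> (energy kappa jn rho <= energy kappa jn f)%E) ->
  symmetric_decreasing rho -> has_support_radius rho Rad ->
  {ae @leb3 R, forall y, rho y <= M} ->
  0 < Rad /\ kappa * (N ^+ 2 / Rad) = 5 / 3 * Vir vn rho - Kin jn rho.
Proof.
move=> k0 N0 pe0 M0 C0 law cfin j53 adm rmin sym suppR rM.
have [rho0 mr rN rp] := (admissibleP N pe0 rho).1 adm.
have Rp : 0 < Rad by exact: (radius_gt0 rho0 suppR N0 M0 mr rN rM).
split=> //.
pose e : 'R3 R := (0, 0, Rad).
have Ve : potential rho e = (N / Rad)%:E.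
  rewrite (potential_axis Rp mr rho0 sym); last by move=> y; exact: (rho_out suppR).
  by rewrite rN -EFinM mulrC.
have V0 x : (0 <= potential rho x)%E by exact: potential_ge0.
have mV : measurable_fun setT (potential rho) by exact: measurable_potential.
have near_e eps : 0 < eps -> exists2 delta, 0 < delta &
    forall x, eucl_dist e x <= delta ->
      ((N / Rad - eps)%:E <= potential rho x <= (N / Rad + eps)%:E)%E.
  move=> eps0; have [dl dl0 H] := potential_unif_cont (ltW M0) (ltW N0) eps0.
  exists dl => // x xd; have rN' : (I3 rho <= N%:E)%E by rewrite rN.
  have := H rho mr rho0 rN' rM e x xd; rewrite eucl_distC in xd.
  have := H rho mr rho0 rN' rM x e xd; rewrite Ve => h1 h2.
  apply/andP; split; last by rewrite EFinD.
  by rewrite EFinB leeBlDr.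
have mball p r : measurable_fun setT (\1_(ball_at p r) : 'R3 R -> R).
  by apply: measurable_indic; exact: measurable_ball_at.
have ball0 p r x : 0 <= (\1_(ball_at p r) x : R) by rewrite indicE.
have I3ball p r : 0 < r -> exists2 v, 0 < v & I3 \1_(ball_at p r) = v%:E.
  move=> r0; rewrite (nnint_indic _ (measurable_ball_at p r)) leb3_ball_at.
  have b0 := leb3_oball_gt0 r0; exists (fine (@leb3 R (oball r))).
    by rewrite fine_gt0// b0 leb3_oball_fin.
  by rewrite fineK// ge0_fin_numE ?leb3_oball_fin// ltW.
have vir := virial pe0 law cfin adm rmin.
set T := Kin jn rho; set P := Vir vn rho in vir *; set D := Cou rho rho in vir.
(* [g] is spread over a ball of radius [dl / 2] touching the support from outside *)
have upper : T + P / 3 + kappa * (N * (N / Rad)) <= kappa * D.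
  apply: (@le_of_affine _ _ _ (kappa * N)) => eps /andP[eps0 _].
  have [dl dl0 H] := near_e _ eps0.
  have dl2 : 0 < dl / 2 by rewrite divr_gt0.
  pose p : 'R3 R := (0, 0, Rad + dl / 2).
  have [v v0 vE] := I3ball p _ dl2.
  pose k := N / v; have kp : 0 <= k by rewrite divr_ge0// ltW.
  pose g x := k * \1_(ball_at p (dl / 2)) x.
  have g0 x : 0 <= g x by rewrite mulr_ge0.
  have mg : measurable_fun setT g by exact: measurable_funM.
  have gN : I3 g = N%:E.
    rewrite (nnintZ _ (mball _ _) (ball0 _ _) kp) vE -EFinM divfK// gt_eqF//.
  have gp s : 0 < s -> I3 (fun x => g x `^ s) = (k `^ s * v)%:E.
    move=> s0; rewrite EFinM -vE -(nnintZ _ (mball _ _) (ball0 _ _) (powR_ge0 _ _)).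
    apply: eq_nnint => x; rewrite /g indicE; case: (x \in _) => /=.
      by rewrite !mulr1.
    by rewrite !mulr0 powR0// gt_eqF.
  have B_out z : ball_at p (dl / 2) z -> Rad < eucl_norm z /\ eucl_dist e z <= dl.
    rewrite /ball_at /= => zp; split.
      apply: (lt_le_trans _ (le_eucl_norm z)).
      have : Rad + dl / 2 - z.2 <= eucl_dist p z.
        apply: (le_trans (ler_norm _)); rewrite -sqrtr_sqr /eucl_dist /= ler_wsqrtr// lerDr.
        by rewrite addr_ge0// sqr_ge0.
      by move=> /le_lt_trans /(_ zp); rewrite ltrBlDr addrC ltrD2l.
    apply: (le_trans (eucl_dist_triangle _ p _)).
    rewrite eucl_dist_axis opprD addrA subrr sub0r normrN gtr0_norm//.
    by rewrite {2}[dl]splitr lerD2l ltW.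
  have rg x : rho x * g x = 0.
    have [xb|xb] := pselect (ball_at p (dl / 2) x).
      by rewrite (rho_out suppR (B_out _ xb).1) mul0r.
    by rewrite /g indicE memNset// mulr0 mulr0.
  have gK l : 0 < l -> (I3 (fun x => jn (l ^+ 3 * g x)) <=
      (l ^+ 5 * (C * (k `^ (5 / 3) * v)))%:E)%E.
    move=> l0; have l30 : 0 <= l ^+ 3 by rewrite exprn_ge0// ltW.
    have mlg : measurable_fun setT (fun x => l ^+ 3 * g x) by exact: measurable_funM.
    have lg0 x : 0 <= l ^+ 3 * g x by rewrite mulr_ge0.
    have mgp : measurable_fun setT (fun x => g x `^ (5 / 3)).
      exact: (measurableT_comp (measurable_powR _) mg).
    have lC : 0 <= l ^+ 5 * C by rewrite mulr_ge0// exprn_ge0// ltW.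
    rewrite [l ^+ 5 * (C * _)]mulrA [leRHS]EFinM -(gp (5 / 3)) ?divr_gt0// -(nnintZ _ mgp (fun=> powR_ge0 _ _) lC).
    apply: le_nnint.
    - exact: (law_measurable law mlg lg0).
    - exact: (measurable_funM (measurable_cst _) mgp).
    - by move=> x; exact: (law_ge0 law).
    move=> x; apply: (le_trans (j53 _ (lg0 x))).
    rewrite powRM// -powR_mulrn ?(ltW l0)// -powRrM -powR_mulrn ?(ltW l0)//.
    rewrite (_ : 3%:R * (5 / 3) = 5%:R); last by field.
    by rewrite mulrA [C * _]mulrC.
  have K0 : 0 <= C * (k `^ (5 / 3) * v) by rewrite !mulr_ge0 ?powR_ge0// ltW.
  have gpf : (I3 (fun x => g x `^ pe) < +oo)%E by rewrite gp// ltry.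
  have := outer_variation k0 pe0 law cfin adm rmin g0 mg gN gpf rg gK K0.
  rewrite -/T -/P -/D => h.
  suff hc : N * (N / Rad - eps) <= Cou rho g.
    exact: outer_eps_arith k0 h hc.
  have VR : 0 <= N / Rad by rewrite divr_ge0// ltW.
  have between x : g x != 0 ->
      ((Num.max 0 (N / Rad - eps))%:E <= potential rho x <= (N / Rad + eps)%:E)%E.
    move=> nz; have xb : ball_at p (dl / 2) x.
      apply: contrapT => xb; move: nz.
      by rewrite /g indicE memNset// mulr0 eqxx.
    have /andP[h1 h2] := H x (B_out _ xb).2; rewrite h2 andbT.
    by rewrite EFin_max ge_max h1 V0.
  have max0 : 0 <= Num.max 0 (N / Rad - eps) by rewrite le_max lexx.
  have be0 := addr_ge0 VR (ltW eps0).
  have /andP[hc _] := Cou_between mg mr g0 rho0 gN max0 be0 between.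
  have -> : Cou rho g = Cou g rho by rewrite /Cou (coulomb_formC mr mg rho0 g0).
  apply: le_trans hc; rewrite mulrC ler_wpM2r ?(ltW N0)//.
  by rewrite le_max lexx orbT.
(* [A] is a ball at distance at least [dl / 4] from the boundary, where [rho >= r1] *)
have lower : kappa * D <= T + P / 3 + kappa * (N * (N / Rad)).
  apply: (@le_of_affine _ _ _ (kappa * N)) => eps /andP[eps0 _].
  have [dl' dl'0 H] := near_e _ eps0.
  pose dl := Num.min dl' Rad.
  have dl0 : 0 < dl by rewrite lt_min dl'0 Rp.
  have dlR : dl <= Rad by rewrite ge_min lexx orbT.
  have dl4 : 0 < dl / 4 by rewrite divr_gt0.
  pose p : 'R3 R := (0, 0, Rad - dl / 2).
  have pR : 0 <= Rad - dl / 2.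
    by rewrite subr_ge0 (le_trans _ dlR)// ler_pdivrMr// ler_peMr// ?ler1n// ltW.
  have [v v0 vE] := I3ball p _ dl4.
  pose A := ball_at p (dl / 4).
  have A_in z : A z -> eucl_norm z <= Rad - dl / 4 /\ eucl_dist e z <= dl'.
    rewrite /A /ball_at /= => zp; split.
      rewrite -eucl_dist0; apply: (le_trans (eucl_dist_triangle _ p _)).
      rewrite eucl_dist0 eucl_norm_axis// eucl_distC.
      rewrite (_ : Rad - dl / 4 = dl / 4 + (Rad - dl / 2)); last by field.
      by rewrite lerD2r ltW.
    apply: (le_trans (eucl_dist_triangle _ p _)).
    rewrite eucl_dist_axis opprB addrCA subrr addr0 gtr0_norm ?divr_gt0//.
    have : dl <= dl' by rewrite ge_min lexx.
    apply: le_trans; rewrite [leRHS]splitr lerD2l (le_trans (ltW zp))//.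
    by rewrite ler_pM2l// lef_pV2 ?posrE// ler_nat.
  have mA : measurable A by exact: measurable_ball_at.
  have cut0 x : 0 <= \1_A x * rho x by rewrite mulr_ge0// indicE.
  have mcut : measurable_fun setT (fun x => \1_A x * rho x).
    by apply: measurable_funM mr; exact: measurable_indic.
  have cle : (I3 (fun x => \1_A x * rho x) <= N%:E)%E.
    rewrite -rN; apply: le_nnint; [exact: mcut|exact: mr|exact: cut0|].
    by move=> x; rewrite ler_piMl// indicE; case: (x \in A).
  have RdR : 0 <= Rad - dl / 4.
    by rewrite (le_trans pR)// lerD2l lerN2 ler_pM2l// lef_pV2 ?posrE// ler_nat.
  pose r1 := rho (0, 0, Rad - dl / 4).
  have r1p : 0 < r1.
    by apply: (rho_in rho0 sym suppR Rp); rewrite eucl_norm_axis// gtrBl.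
  have cge : ((r1 * v)%:E <= I3 (fun x => \1_A x * rho x))%E.
    rewrite EFinM -vE -(nnintZ _ (mball _ _) (ball0 _ _) (ltW r1p)).
    apply: le_nnint.
    - exact: (measurable_funM (measurable_cst _) (mball _ _)).
    - exact: mcut.
    - by move=> x; exact: (mulr_ge0 (ltW r1p)).
    move=> x; rewrite indicE; have [xA|xA] := pselect (A x); last first.
      by rewrite memNset// mulr0 mul0r.
    rewrite mem_set// mulr1 mul1r; apply: sym.
    by rewrite eucl_norm_axis//; exact: (A_in _ xA).1.
  have [n nE] : exists n, I3 (fun x => \1_A x * rho x) = n%:E.
    exists (fine (I3 (fun x => \1_A x * rho x))); rewrite fineK// ge0_fin_numE.
      by rewrite (le_lt_trans cle)// ltry.
    exact: nnint_ge0.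
  have n0 : 0 < n by rewrite -lte_fin -nE (lt_le_trans _ cge)// lte_fin mulr_gt0.
  have b0 : 0 < N / n by rewrite divr_gt0.
  have cN : I3 (fun x => \1_A x * rho x) = (N / (N / n))%:E.
    by rewrite nE invf_div mulrCA divff ?mulr1// gt_eqF.
  have := inner_variation k0 pe0 law cfin adm rmin mA b0 cN.
  rewrite -/T -/P -/D => h.
  have between x : \1_A x * rho x != 0 ->
      (0%:E <= potential rho x <= (N / Rad + eps)%:E)%E.
    move=> nz; have xb : A x.
      apply: contrapT => xb; move: nz.
      by rewrite indicE memNset// mul0r eqxx.
    by have /andP[h1 ->] := H x (A_in _ xb).2; rewrite V0.
  have be0 : 0 <= N / Rad + eps by rewrite addr_ge0 ?divr_ge0// ltW.
  have /andP[_ hc] := Cou_between mcut mr cut0 rho0 nE (lexx _) be0 between.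
  apply: (le_trans h); rewrite -[leRHS]addrA lerD2l.
  have -> : kappa * (N * (N / Rad)) + eps * (kappa * N) = kappa * (N * (N / Rad + eps)) by ring.
  rewrite ler_pM2l// -mulrA ler_pM2l// ler_pdivrMl// [n * _]mulrC.
  exact: hc.
have E : T + P / 3 + kappa * (N * (N / Rad)) = kappa * D by apply/eqP; rewrite eq_le upper lower.
rewrite (_ : kappa * (N ^+ 2 / Rad) = kappa * (N * (N / Rad))); last by ring.
rewrite vir in E; apply: (@addrI _ (T + P / 3)); rewrite E -/T -/P; first by field.
Qed.

End radius.

(** * Semiclassical comparison of the minimizers *)
Section laws.
Variable R : realType.
Variables (q m : R).
Hypothesis q0 : 0 < q.
Hypothesis m0 : 0 < m.

Lemma relativistic_law nu : 0 < nu -> kinetic_law (4 / 3) (jnu q m nu) (vnu q m nu).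
Proof.
move=> n0; have n0' := ltW n0; split.
- by move=> t; exact: jnu_ge0.
- by move=> t; exact: vnu_ge0.
- exact: jnu_at0.
- by move=> t t'; exact: le_jnu.
- by move=> t; exact: jnu_le_vnu.
- by move=> t; exact: vnu_le_jnu2.
- by move=> l t; exact: jnu_scale.
- by move=> f; exact: measurable_jnu.
- by move=> f; exact: measurable_vnu.
eexists; last by move=> t t0; exact: (jnu_le_43 q0 m0 n0 t0).
apply: divr_ge0; last exact: sqrtr_ge0.
by apply: mulr_ge0; [exact: fermi_momentum_ge0|exact: ltW (kin_cst_gt0 q0)].
Qed.

Lemma classical_law : kinetic_law (5 / 3) (jnu q m 0) (vnu q m 0).
Proof.
have n0' := lexx (0 : R); split.
- by move=> t; exact: jnu_ge0.
- by move=> t; exact: vnu_ge0.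
- exact: jnu_at0.
- by move=> t t'; exact: le_jnu.
- by move=> t; exact: jnu_le_vnu.
- by move=> t; exact: vnu_le_jnu2.
- by move=> l t; exact: jnu_scale.
- by move=> f; exact: measurable_jnu.
- by move=> f; exact: measurable_vnu.
exists (TF_cst q m); first exact: ltW (TF_cst_gt0 q0 m0).
by move=> t t0; rewrite (j0E q0 m0 t0).
Qed.

End laws.

Lemma gap_shift_arith (R : realType) (a b c d : R) : a + b <= c + d -> a + (b - d) <= c.
Proof. by rewrite addrA lerBlDr. Qed.

Lemma gap_move_arith (R : realType) (a b c d e : R) :
  a - b + (c - d) <= e -> a + c <= b + e + d.
Proof. lra. Qed.

Lemma compare_arith1 (R : realType) (t p d s ps ds x : R) :
  t - d = t - p -> s - ds = s - ps -> ps = 2 * s -> t - d <= x - ds -> x <= s -> s <= p - t.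
Proof. lra. Qed.

Lemma compare_arith2 (R : realType) (t p d s ps ds x : R) :
  t - d = t - p -> s - ds = s - ps -> ps = 2 * s -> s - ds <= x - d -> p - x <= s.
Proof. lra. Qed.

(** Linear arithmetic of the comparison: [t], [p], [j] stand for the three energies of
    the relativistic minimizer and [s] for the kinetic energy of the classical one. *)
Lemma upper_arith (R : realType) (t p j s e : R) : j <= t + e -> j + t <= p + e -> p <= 2 * t ->
  p - j <= s -> t <= j -> p <= t + j ->
  j - s <= 14 / 3 * e /\ 5 / 3 * p - t - 7 / 3 * s <= 14 / 3 * e.
Proof. by move=> *; split; lra. Qed.

Lemma lower_arith (R : realType) (t p j s e e' : R) : 0 <= e' -> e' <= e ->
  p + e <= t + j -> p + e <= 2 * t -> s <= p - t ->
  2 / 3 * e' <= j - s /\ 2 / 3 * e' <= 5 / 3 * p - t - 7 / 3 * s.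
Proof. by move=> *; split; lra. Qed.

(** From inverse radii to radii. *)
Lemma radius_arith (R : realType) (k r1 r2 x1 x2 a b n : R) : 0 < k -> 0 < r1 -> 0 < r2 ->
  k / r1 = x1 -> k / r2 = x2 -> 0 <= a -> 0 <= b -> 0 <= n <= 1 ->
  a * n <= x1 - x2 <= b * n ->
  k * a / (x2 * (x2 + b)) * n <= r2 - r1 <= k * b / x2 ^+ 2 * n.
Proof.
move=> k0 r10 r20 e1 e2 a0 b0 /andP[n0 n1] /andP[h1 h2].
have x10 : 0 < x1 by rewrite -e1 divr_gt0.
have x20 : 0 < x2 by rewrite -e2 divr_gt0.
have -> : r2 - r1 = k * (x1 - x2) / (x2 * x1).
  by rewrite -e1 -e2; field; rewrite !gt_eqF.
have x21 : x2 <= x1 by rewrite -subr_ge0 (le_trans _ h1)// mulr_ge0.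
have x1b : x1 <= x2 + b.
  by rewrite addrC -lerBlDr (le_trans h2)// ler_piMr.
have an0 : 0 <= a * n by rewrite mulr_ge0.
have d0 : 0 <= x1 - x2 by rewrite subr_ge0.
apply/andP; split.
- rewrite mulrAC -[k * a * n]mulrA; apply: ler_pM.
  + by rewrite mulr_ge0// ltW.
  + by rewrite invr_ge0 mulr_ge0 ?(ltW x20)// addr_ge0// ltW.
  + by rewrite ler_pM2l.
  + by rewrite lef_pV2 ?posrE ?mulr_gt0// ?ltr_wpDr// ler_pM2l.
- rewrite [leRHS]mulrAC -[k * b * n]mulrA; apply: ler_pM.
  + by rewrite mulr_ge0// ltW.
  + by rewrite invr_ge0 mulr_ge0// ltW.
  + by rewrite ler_pM2l.
  + by rewrite lef_pV2 ?posrE ?mulr_gt0 ?exprn_gt0// expr2 ler_pM2l.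
Qed.

Lemma ge0_arith (R : realType) (t p s : R) : s <= p - t -> p <= 2 * t ->
  7 / 3 * s <= 5 / 3 * p - t.
Proof. lra. Qed.

Lemma sub_arith (R : realType) (t p j : R) : p <= t + j -> p - t <= j.
Proof. by rewrite lerBlDl. Qed.

(** The lower bounds of the gaps are quadratic in a parameter, whose optimal value
    is [dl]. *)
Lemma two_sided_arith (R : realType) (m k C C' n N t p j s : R) :
  0 < m -> 0 < k * N -> 0 < C' -> 0 < n -> 0 < s ->
  j <= t + C * n * N -> j + t <= p + C * n * N -> p <= 2 * t -> p - j <= s -> t <= j ->
  p <= t + j -> s <= p - t -> s <= j ->
  let dl := 2 * m * s / (k * N) in
  let e := C' * n * (2 * dl * (2 * m * j) - dl ^+ 2 * (k * N)) in
  p + e <= t + j -> p + e <= 2 * t ->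
  let E := C' * (dl * (2 * m * s)) in
  (2 / 3 * E * n <= j - s <= (14 / 3 * (C * N) + 1) * n) /\
  (2 / 3 * E * n <= 5 / 3 * p - t - 7 / 3 * s <= (14 / 3 * (C * N) + 1) * n).
Proof.
move=> m0 kN C'0 n0 s0 u1 u2 p2 pj tj ptj spt sj dl e l1 l2 E.
have ms : 0 < 2 * m * s by rewrite !mulr_gt0.
have dl0 : 0 < dl by rewrite divr_gt0.
have [U1 U2] := upper_arith u1 u2 p2 pj tj ptj.
have e0 : 0 <= E * n := ltW (mulr_gt0 (mulr_gt0 C'0 (mulr_gt0 dl0 ms)) n0).
have ele : E * n <= e.
  rewrite /E /e mulrAC ler_pM2l ?mulr_gt0//.
  have -> : dl ^+ 2 * (k * N) = dl * (2 * m * s).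
    by rewrite expr2 -mulrA /dl divfK// gt_eqF.
  have h : dl * (2 * m * s) <= dl * (2 * m * j) by rewrite ler_pM2l// ler_pM2l// mulr_gt0.
  have -> : 2 * dl * (2 * m * j) = dl * (2 * m * j) + dl * (2 * m * j) by ring.
  by rewrite lerBrDr lerD.
have [L1 L2] := lower_arith e0 ele l1 l2 spt.
have le2 : 14 / 3 * (C * n * N) <= (14 / 3 * (C * N) + 1) * n.
  have -> : 14 / 3 * (C * n * N) = 14 / 3 * (C * N) * n by ring.
  by apply: (ler_wpM2r (ltW n0)); rewrite lerDl.
by rewrite -[2 / 3 * E * _]mulrA L1 L2 (le_trans U1 le2) (le_trans U2 le2).
Qed.

Section comparison.
Variable R : realType.
Variables (kappa q m N Nstar : R).
Hypothesis kappa0 : 0 < kappa.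
Hypothesis q0 : 0 < q.
Hypothesis m0 : 0 < m.
Hypothesis N0 : 0 < N.
Hypothesis Nstar0 : 0 < Nstar.
Hypothesis interp : interpolation_ineq kappa q Nstar.
Local Notation I3 f := (nnint (@leb3 R) f%R).
Local Notation J := (jnu q m).
Local Notation V := (vnu q m).
Implicit Types f rho : 'R3 R -> R.

Let p43 : (0 : R) < 4 / 3. Proof. by rewrite divr_gt0. Qed.
Let p53 : (0 : R) < 5 / 3. Proof. by rewrite divr_gt0. Qed.
Let law0 := classical_law q0 m0.

Definition coulomb_cst : R := K_cl q / (kappa * Nstar `^ (2 / 3)).

Lemma coulomb_bound f n : density (4 / 3) f -> I3 f = n%:E ->
  (coulomb f <= (coulomb_cst * n `^ (2 / 3))%:E * I3 (fun x => (f x `^ (4 / 3))%R))%E.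
Proof.
move=> df fn; have [f0 mf _ _] := (densityP f p43).1 df.
have k0 : 0 < kappa * Nstar `^ (2 / 3) by rewrite mulr_gt0// powR_gt0.
have := interp df; rewrite (Lnorm_nnint p43 f0) (Lnorm1_nnint f0) fn poweR_EFin => h.
have ki0 : (0 <= ((kappa * Nstar `^ (2 / 3))^-1)%:E)%E by rewrite lee_fin invr_ge0 ltW.
have := lee_wpmul2l ki0 h; rewrite muleA -EFinM mulVf ?gt_eqF// mul1e => /le_trans; apply.
rewrite le_eqVlt; apply/orP; left; apply/eqP.
by rewrite muleC -!muleA [(I3 _ * _)%E]muleC !muleA -!EFinM /coulomb_cst; congr (_%:E * _)%E; ring.
Qed.

Lemma coulomb_cst_ge0 : 0 <= coulomb_cst.
Proof.
apply: divr_ge0; last by rewrite mulr_ge0 ?powR_ge0// ltW.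
by rewrite /K_cl mulr_ge0 ?powR_ge0.
Qed.

Lemma coulomb_fin43 f : density (4 / 3) f -> (coulomb_form f f < +oo)%E.
Proof.
move=> df; have [f0 mf fi fp] := (densityP f p43).1 df.
have fn : I3 f = (fine (I3 f))%:E by rewrite fineK// ge0_fin_numE// nnint_ge0.
have h : (coulomb f < +oo)%E.
  apply: (le_lt_trans (coulomb_bound df fn)).
  apply: lte_mul_pinfty => //.
  by rewrite lee_fin mulr_ge0 ?coulomb_cst_ge0 ?powR_ge0.
move: h; rewrite (coulombE mf f0).
have : (0 <= coulomb_form f f)%E by exact: coulomb_form_ge0.
by case: (coulomb_form f f) => [a| |]// _; rewrite ?ltry// gt0_muley// lte_fin.
Qed.

Lemma coulomb_fin53 f : density (5 / 3) f -> (coulomb_form f f < +oo)%E.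
Proof. by move=> /density53_43; exact: coulomb_fin43. Qed.

Local Notation T_of nu := (Kin (J nu)).
Local Notation P_of nu := (Vir (V nu)).

Lemma admissible53_43 f : admissible (5 / 3) N f -> admissible (4 / 3) N f.
Proof. by move=> [/density53_43]. Qed.

Lemma minimizer_c_min c rho : 0 < c -> minimizer_c kappa q m c N rho ->
  admissible (4 / 3) N rho /\ forall f, admissible (4 / 3) N f ->
    (energy kappa (J (c ^- 2)) rho <= energy kappa (J (c ^- 2)) f)%E.
Proof.
move=> c0 [adm E]; split; first exact: adm; move=> f af; rewrite -(j_mcE q m0 c0) E.
by apply: ereal_inf_lbound; exists f.
Qed.

Lemma minimizer_oo_min rho : minimizer_oo kappa q m N rho ->
  admissible (5 / 3) N rho /\ forall f, admissible (5 / 3) N f ->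
    (energy kappa (J 0) rho <= energy kappa (J 0) f)%E.
Proof.
move=> [adm E]; split; first exact: adm; move=> f af; rewrite -(j_ooE q m0) E.
by apply: ereal_inf_lbound; exists f.
Qed.


(** Bundles what a comparison of real integrals needs to know of each of them. *)
Definition has_int f (a : R) : Prop :=
  [/\ measurable_fun setT f, forall x, 0 <= f x & I3 f = a%:E].

Lemma has_intD f g a b : has_int f a -> has_int g b -> has_int (fun x => f x + g x) (a + b).
Proof.
move=> [mf f0 fa] [mg g0 gb]; split.
- exact: measurable_funD.
- by move=> x; exact: addr_ge0.
by rewrite (nnintD _ mf mg f0 g0) fa gb.
Qed.

Lemma has_intZ k f a : 0 <= k -> has_int f a -> has_int (fun x => k * f x) (k * a).
Proof.
move=> k0 [mf f0 fa]; split.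
- exact: (measurable_funM (measurable_cst _) mf).
- by move=> x; exact: mulr_ge0.
by rewrite (nnintZ _ mf f0 k0) fa.
Qed.

Lemma has_int_le f g a b : has_int f a -> has_int g b ->
  {ae @leb3 R, forall x, f x <= g x} -> a <= b.
Proof.
move=> [mf f0 fa] [mg g0 gb] fg; rewrite -lee_fin -fa -gb; exact: ae_le_nnint.
Qed.

Lemma has_int_mass p f : 0 < p -> admissible p N f -> has_int f N.
Proof. by move=> p0 /(admissibleP N p0)[f0 mf fN _]; split. Qed.

Lemma has_int_Kin p nu f : 0 < p -> kinetic_law p (J nu) (V nu) -> admissible p N f ->
  has_int (fun x => J nu (f x)) (T_of nu f).
Proof.
move=> p0 law af; have [f0 mf _ _] := (admissibleP N p0 f).1 af; split.
- exact: (law_measurable law mf f0).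
- by move=> x; exact: jnu_ge0.
exact: (Kin_fin p0 law af).
Qed.

Lemma has_int_Vir p nu f : 0 < p -> kinetic_law p (J nu) (V nu) -> admissible p N f ->
  has_int (fun x => V nu (f x)) (P_of nu f).
Proof.
move=> p0 law af; have [f0 mf _ _] := (admissibleP N p0 f).1 af; split.
- exact: (law_vmeasurable law mf f0).
- by move=> x; exact: vnu_ge0.
exact: (Vir_fin p0 law af).
Qed.

Lemma has_int43 f : admissible (4 / 3) N f ->
  has_int (fun x => f x `^ (4 / 3)) (fine (I3 (fun x => f x `^ (4 / 3)))).
Proof.
move=> /(admissibleP N p43)[f0 mf _ fp]; split.
- exact: (measurableT_comp (measurable_powR _) mf).
- by move=> x; exact: powR_ge0.
by rewrite fineK// ge0_fin_numE// nnint_ge0// => x; exact: powR_ge0.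
Qed.

(** A density whose energy is at most [0] has a bounded [4 / 3] norm, when the
    kinetic energy dominates the Coulomb energy at large densities. *)
Lemma int43_bound a b nu f : 0 < nu -> 0 <= b ->
  (forall t, 0 <= t -> a * t `^ (4 / 3) <= J nu t + b * t) ->
  0 <= a -> kappa * (coulomb_cst * N `^ (2 / 3)) + 1 <= a ->
  admissible (4 / 3) N f -> T_of nu f - kappa / 2 * Cou f f <= 0 ->
  (I3 (fun x => (f x `^ (4 / 3))%R) <= (b * N)%:E)%E.
Proof.
move=> n0 b0 ja a0 La af E0; have law := relativistic_law q0 m0 n0.
have [f0 mf fN _] := (admissibleP N p43 f).1 af.
have h43 := has_int43 af; have [_ _ E43] := h43.
have hT := has_int_Kin p43 law af.
have hle := has_int_le (has_intZ a0 h43) (has_intD hT (has_intZ b0 (has_int_mass p43 af))).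
have : {ae @leb3 R, forall x, a * f x `^ (4 / 3) <= J nu (f x) + b * f x}.
  by apply: aeW => x; exact: ja.
move=> /hle hle'.
have := coulomb_bound af.1 fN.
rewrite (coulombE mf f0) (Cou_fin p43 coulomb_fin43 af) E43 -!EFinM !lee_fin.
set i := fine _ in hle' *; move=> hC.
have i0 : 0 <= i by rewrite fine_ge0// nnint_ge0// => x; exact: powR_ge0.
have h1 := ler_wpM2l (ltW kappa0) hC.
have h2 : (kappa * (coulomb_cst * N `^ (2 / 3)) + 1) * i <= a * i by rewrite ler_wpM2r.
have e1 : kappa * (2^-1 * Cou f f) = kappa / 2 * Cou f f by rewrite mulrA.
have e2 : kappa * (coulomb_cst * N `^ (2 / 3) * i) = kappa * (coulomb_cst * N `^ (2 / 3)) * i.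
  by rewrite mulrA.
rewrite e1 e2 in h1; rewrite mulrDl mul1r in h2.
rewrite subr_le0 in E0.
have h3 := le_trans E0 h1.
have h4 := le_trans h2 hle'.
have := le_trans h4 (lerD h3 (lexx (b * N))).
by rewrite lerD2l.
Qed.

(** So a relativistic minimizer is admissible in the classical problem. *)
Lemma bounded53 f M : 0 < M -> admissible (4 / 3) N f -> {ae @leb3 R, forall x, f x <= M} ->
  admissible (5 / 3) N f.
Proof.
move=> M0 /(admissibleP N p43)[f0 mf fN _] fM; apply/(admissibleP N p53).
split; [exact: f0|exact: mf|exact: fN|].
have M23 : 0 <= M `^ (2 / 3) by exact: powR_ge0.
apply: (@le_lt_trans _ _ ((M `^ (2 / 3))%:E * I3 f)%E); last by rewrite fN -EFinM ltry.
rewrite -(nnintZ _ mf f0 M23); apply: ae_le_nnint.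
- exact: (measurableT_comp (measurable_powR _) mf).
- exact: (measurable_funM (measurable_cst _) mf).
- by move=> x; exact: powR_ge0.
- by move=> x; exact: mulr_ge0.
apply: filterS fM => x xM.
have -> : (5 / 3 : R) = 2 / 3 + 1 by field.
have h53 : (2 / 3 + 1 : R) != 0 by rewrite gt_eqF// addr_gt0// divr_gt0.
rewrite powRD; last by apply/implyP => /eqP h; move: h53; rewrite h eqxx.
by rewrite powRr1// ler_wpM2r// ge0_ler_powR ?nnegrE ?divr_ge0// (le_trans _ xM).
Qed.

(** The energy density is asymptotically at least [c * ultrarel_cst * t ^ (4 / 3)]; the
    rest energy accounts for [rest_cst c * t]. *)
Definition ultrarel_cst : R := kin_sqr q / fermi_momentum q 1.

Lemma ultrarel_cst_gt0 : 0 < ultrarel_cst.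
Proof. by rewrite divr_gt0 ?kin_sqr_gt0 ?fermi_momentum_gt0. Qed.

Definition rest_cst (c : R) : R := c ^+ 2 * m * kin_cst q.

Lemma rest_cst_ge0 c : 0 <= rest_cst c.
Proof.
apply: mulr_ge0; last exact: ltW (kin_cst_gt0 q0).
by apply: mulr_ge0; [exact: sqr_ge0|exact: ltW].
Qed.

Lemma J_ge43 c nu t : 0 < c -> 0 <= nu -> nu <= c ^- 2 -> 0 <= t ->
  c * ultrarel_cst * t `^ (4 / 3) <= J nu t + rest_cst c * t.
Proof.
move=> c0 n0 nc t0; apply: (le_trans (jnu_ge_43 q0 m0 c0 t0)).
by rewrite lerD2r; exact: (jnu_antitone q0 m0 t n0 nc).
Qed.

(** A minimizer is bounded in terms of its norm in [L ^ (4 / 3)], uniformly for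
    light speeds of at least [c], infinite speed included. *)
Lemma critical_bounded A c : 0 < A -> 0 < c -> exists2 M, 0 < M & forall nu p rho,
  0 <= nu -> nu <= c ^- 2 -> 0 < p -> kinetic_law p (J nu) (V nu) ->
  (forall f, density p f -> (coulomb_form f f < +oo)%E) -> admissible p N rho ->
  (forall f, admissible p N f -> (energy kappa (J nu) rho <= energy kappa (J nu) f)%E) ->
  (I3 (fun x => (rho x `^ (4 / 3))%R) <= A%:E)%E ->
  {ae @leb3 R, forall x, rho x <= M}.
Proof.
move=> A0 c0; have cd0 := mulr_gt0 c0 ultrarel_cst_gt0.
have [M M0 MP] := unif_bounded (ltW N0) A0 cd0 (rest_cst_ge0 c) kappa0.
exists M; first exact: M0.
move=> nu p rho n0 nc p0 law cfin adm rmin r43.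
have [r0 mr rN _] := (admissibleP N p0 rho).1 adm.
have rN' : (I3 rho <= N%:E)%E by rewrite rN.
have hj t : 0 <= t -> c * ultrarel_cst * t `^ (4 / 3) <= J nu t + rest_cst c * t.
  exact: J_ge43.
have hae := ae_kinetic_le_potential kappa0 N0 p0 law cfin adm rmin.
by have [] := MP rho (J nu) mr r0 rN' r43 hj hae.
Qed.

Lemma int43_fin f : admissible (4 / 3) N f ->
  exists2 A, 0 < A & (I3 (fun x => (f x `^ (4 / 3))%R) <= A%:E)%E.
Proof.
move=> af; have [_ _ E43] := has_int43 af; set i := fine _ in E43.
have i0 : 0 <= i by rewrite fine_ge0// nnint_ge0// => x; exact: powR_ge0.
by exists (i + 1); [rewrite ltr_wpDl|rewrite E43 lee_fin lerDl].
Qed.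

Lemma minimizer_c_bounded c rho : 0 < c -> minimizer_c kappa q m c N rho ->
  exists2 M, 0 < M & {ae @leb3 R, forall x, rho x <= M}.
Proof.
move=> c0 /(minimizer_c_min c0)[adm rmin].
have n0 : 0 < c ^- 2 by rewrite invr_gt0 exprn_gt0.
have [A A0 rA] := int43_fin adm; have [M M0 H] := critical_bounded A0 c0.
exists M; first exact: M0.
exact: (H _ _ _ (ltW n0) (lexx _) p43 (relativistic_law q0 m0 n0) coulomb_fin43 adm rmin rA).
Qed.

Lemma minimizer_oo_bounded rho : minimizer_oo kappa q m N rho ->
  exists2 M, 0 < M & {ae @leb3 R, forall x, rho x <= M}.
Proof.
move=> /minimizer_oo_min[adm rmin].
have [A A0 rA] := int43_fin (admissible53_43 adm).
have [M M0 H] := critical_bounded A0 (ltr01 : (0 : R) < 1).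
exists M; first exact: M0.
have n1 : (0 : R) <= 1 ^- 2 by rewrite invr_ge0 sqr_ge0.
exact: (H _ _ _ (lexx 0) n1 p53 law0 coulomb_fin53 adm rmin rA).
Qed.

Lemma minimizer_c_energy c rho : 0 < c -> minimizer_c kappa q m c N rho ->
  T_of (c ^- 2) rho - kappa / 2 * Cou rho rho = T_of (c ^- 2) rho - P_of (c ^- 2) rho
  /\ T_of (c ^- 2) rho - kappa / 2 * Cou rho rho <= 0.
Proof.
move=> c0 /(minimizer_c_min c0)[adm rmin].
have n0 : 0 < c ^- 2 by rewrite invr_gt0 exprn_gt0.
have law := relativistic_law q0 m0 n0.
have E := energy_min p43 law coulomb_fin43 adm rmin.
split; first exact: E.
rewrite E; exact: (energy_min_le0 p43 law adm).
Qed.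

(** For large [c] the nonpositivity of the energy bounds the norm in [L ^ (4 / 3)]
    independently of [c]. *)
Lemma minimizer_c_unif_bounded : exists c0 M, [/\ 1 <= c0, 0 < M &
  forall c rho, c0 <= c -> minimizer_c kappa q m c N rho ->
    {ae @leb3 R, forall x, rho x <= M}].
Proof.
pose L := kappa * (coulomb_cst * N `^ (2 / 3)).
pose c0 := Num.max 1 ((L + 1) / ultrarel_cst).
have c01 : 1 <= c0 by rewrite le_max lexx.
have c0p : 0 < c0 by rewrite (lt_le_trans (ltr01 : (0 : R) < 1)).
have L1 : L + 1 <= c0 * ultrarel_cst.
  by rewrite -ler_pdivrMr ?ultrarel_cst_gt0// le_max lexx orbT.
have b0 := rest_cst_ge0 c0; set b := rest_cst c0 in b0.
have A0 : 0 < b * N + 1 by rewrite ltr_wpDl// mulr_ge0// ltW.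
have cd0 := mulr_gt0 c0p ultrarel_cst_gt0.
have [M M0 H] := critical_bounded A0 c0p.
exists c0, M; split; [exact: c01|exact: M0|].
move=> c rho cc min; have cp : 0 < c by rewrite (lt_le_trans c0p).
have [adm rmin] := minimizer_c_min cp min.
have n0 : 0 < c ^- 2 by rewrite invr_gt0 exprn_gt0.
have nc : c ^- 2 <= c0 ^- 2.
  by rewrite lef_pV2 ?posrE ?exprn_gt0// lerXn2r ?nnegrE ?(ltW cp) ?(ltW c0p).
have hj t : 0 <= t -> c0 * ultrarel_cst * t `^ (4 / 3) <= J (c ^- 2) t + b * t.
  exact: (J_ge43 c0p (ltW n0) nc).
have [_ E0] := minimizer_c_energy cp min.
have i43 := int43_bound n0 b0 hj (ltW cd0) L1 adm E0.
have r43 : (I3 (fun x => (rho x `^ (4 / 3))%R) <= (b * N + 1)%:E)%E.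
  by apply: (le_trans i43); rewrite lee_fin lerDl.
exact: (H _ _ _ (ltW n0) nc p43 (relativistic_law q0 m0 n0) coulomb_fin43 adm rmin r43).
Qed.

Lemma T_le_classical nu f : 0 < nu -> admissible (5 / 3) N f -> T_of nu f <= T_of 0 f.
Proof.
move=> n0 af; have law := relativistic_law q0 m0 n0.
have a43 := admissible53_43 af.
apply: (has_int_le (has_int_Kin p43 law a43) (has_int_Kin p53 law0 af)).
by apply: aeW => x; exact: (jnu_antitone q0 m0 _ (lexx 0) (ltW n0)).
Qed.

Lemma P_le_2T nu f : 0 < nu -> admissible (4 / 3) N f -> P_of nu f <= 2 * T_of nu f.
Proof.
move=> n0 a43; have law := relativistic_law q0 m0 n0.
apply: (has_int_le (has_int_Vir p43 law a43) (has_intZ (ler0n R 2) (has_int_Kin p43 law a43))).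
by apply: aeW => x; exact: (law_vj law).
Qed.

Lemma P_le_TJ nu f : 0 < nu -> admissible (5 / 3) N f -> P_of nu f <= T_of nu f + T_of 0 f.
Proof.
move=> n0 af; have law := relativistic_law q0 m0 n0; have a43 := admissible53_43 af.
apply: (has_int_le (has_int_Vir p43 law a43)
  (has_intD (has_int_Kin p43 law a43) (has_int_Kin p53 law0 af))).
by apply: aeW => x; rewrite -lerBlDl; exact: (virial_gap_le q0 m0 _ (ltW n0)).
Qed.

Lemma classical_virial f : admissible (5 / 3) N f -> P_of 0 f = 2 * T_of 0 f.
Proof.
move=> af; have hT := has_intZ (ler0n R 2) (has_int_Kin p53 law0 af).
have hP := has_int_Vir p53 law0 af.
apply/eqP; rewrite eq_le; apply/andP; split.
- by apply: (has_int_le hP hT); apply: aeW => x; rewrite (v0E q m0).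
- by apply: (has_int_le hT hP); apply: aeW => x; rewrite (v0E q m0).
Qed.

Lemma gaps_upper_int M : 0 < M -> exists2 C, 0 <= C & forall nu f, 0 < nu ->
  admissible (5 / 3) N f -> {ae @leb3 R, forall x, f x <= M} ->
  T_of 0 f <= T_of nu f + C * nu * N /\ T_of 0 f + T_of nu f <= P_of nu f + C * nu * N.
Proof.
move=> M0; have [C C0 HC] := kin_gaps_upper q0 m0 (ltW M0).
exists C => // nu f n0 af fM.
have law := relativistic_law q0 m0 n0; have a43 := admissible53_43 af.
have [f0 _ _ _] := (admissibleP N p53 f).1 af.
have Cn : 0 <= C * nu by rewrite mulr_ge0// ltW.
have hN := has_intZ Cn (has_int_mass p53 af).
have hT := has_int_Kin p43 law a43; have hP := has_int_Vir p43 law a43.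
have h0 := has_int_Kin p53 law0 af.
split.
- apply: (has_int_le h0 (has_intD hT hN)); apply: filterS fM => x xM.
  have xM' : 0 <= f x <= M by rewrite f0.
  by have [h _] := HC _ _ (ltW n0) xM'.
- apply: (has_int_le (has_intD h0 hT) (has_intD hP hN)); apply: filterS fM => x xM.
  have xM' : 0 <= f x <= M by rewrite f0.
  have [_ h] := HC _ _ (ltW n0) xM'.
  by rewrite -lerBrDr addrAC.
Qed.

Lemma gaps_lower_int M : 0 < M -> exists2 C, 0 < C & forall nu f d, 0 < nu <= 1 -> 0 <= d ->
  admissible (5 / 3) N f -> {ae @leb3 R, forall x, f x <= M} ->
  let e := C * nu * (2 * d * (2 * m * T_of 0 f) - d ^+ 2 * (kin_cst q * N)) in
  P_of nu f + e <= T_of nu f + T_of 0 f /\ P_of nu f + e <= 2 * T_of nu f.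
Proof.
move=> M0; have [C C0 HC] := kin_gaps_lower q0 m0 (ltW M0).
exists C => // nu f d /andP[n0 n1] d0 af fM e.
have law := relativistic_law q0 m0 n0; have a43 := admissible53_43 af.
have [f0 _ _ _] := (admissibleP N p53 f).1 af.
pose k1 := C * nu * (2 * d * (2 * m)); pose k2 := C * nu * (d ^+ 2 * kin_cst q).
have Cn : 0 <= C * nu by rewrite mulr_ge0// ltW.
have k10 : 0 <= k1 by rewrite mulr_ge0// !mulr_ge0// ltW.
have k20 : 0 <= k2.
  by apply: mulr_ge0 => //; apply: mulr_ge0; [exact: sqr_ge0|exact: ltW (kin_cst_gt0 q0)].
have eE : e = k1 * T_of 0 f - k2 * N by rewrite /e /k1 /k2; ring.
have hN := has_intZ k20 (has_int_mass p53 af).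
have hT := has_int_Kin p43 law a43; have hP := has_int_Vir p43 law a43.
have h0 := has_int_Kin p53 law0 af; have h1 := has_intZ k10 h0.
have nu01 : 0 <= nu <= 1 by rewrite (ltW n0).
have HE x : C * nu * (2 * d * (2 * m * J 0 (f x)) - d ^+ 2 * (kin_cst q * f x)) =
   k1 * J 0 (f x) - k2 * f x by rewrite /k1 /k2; ring.
rewrite eE; split.
- apply: gap_shift_arith; apply: (has_int_le (has_intD hP h1) (has_intD (has_intD hT h0) hN)).
  apply: filterS fM => x xM; have xM' : 0 <= f x <= M by rewrite f0.
  have [h _] := HC _ _ d nu01 xM'; move: h; rewrite HE.
  exact: gap_move_arith.
- apply: gap_shift_arith.
  apply: (has_int_le (has_intD hP h1) (has_intD (has_intZ (ler0n R 2) hT) hN)).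
  apply: filterS fM => x xM; have xM' : 0 <= f x <= M by rewrite f0.
  have [_ h] := HC _ _ d nu01 xM'; move: h; rewrite HE.
  by rewrite addrA lerBlDr.
Qed.

(** Each minimizer is a competitor in the problem of the other one. *)
Lemma compare_energies c rho rho_oo : 0 < c -> minimizer_c kappa q m c N rho ->
  minimizer_oo kappa q m N rho_oo -> admissible (5 / 3) N rho ->
  T_of 0 rho_oo <= P_of (c ^- 2) rho - T_of (c ^- 2) rho /\
  P_of (c ^- 2) rho - T_of 0 rho <= T_of 0 rho_oo.
Proof.
move=> c0 min min_oo a53.
have n0 : 0 < c ^- 2 by rewrite invr_gt0 exprn_gt0.
have law := relativistic_law q0 m0 n0.
have [adm rmin] := minimizer_c_min c0 min.
have [adm_oo rmin_oo] := minimizer_oo_min min_oo.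
have [E _] := minimizer_c_energy c0 min.
have Eoo := energy_min p53 law0 coulomb_fin53 adm_oo rmin_oo.
have P2 := classical_virial adm_oo.
have h1 := min_le p43 law coulomb_fin43 adm rmin (admissible53_43 adm_oo).
have h2 := min_le p53 law0 coulomb_fin53 adm_oo rmin_oo a53.
have h3 := T_le_classical n0 adm_oo.
by split; [exact: (compare_arith1 E Eoo P2 h1 h3)|exact: (compare_arith2 E Eoo P2 h2)].
Qed.

Lemma T_oo_gt0 f : admissible (5 / 3) N f -> 0 < T_of 0 f.
Proof.
move=> af; have [mj j0 jE] := has_int_Kin p53 law0 af.
have [f0 mf fN _] := (admissibleP N p53 f).1 af.
rewrite lt_neqAle eq_sym (Kin_ge0 law0) andbT.
apply/negP => /eqP T0; move: jE; rewrite T0 => jE.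
have : ae_eq (@leb3 R) setT (fun x => (J 0 (f x))%:E) (cst 0%E).
  apply/ae_eq_integral_abs => //; first exact/measurable_EFinP.
  by rewrite -[RHS]jE; apply: eq_integral => x _; rewrite gee0_abs// lee_fin.
move=> h; have : (I3 f <= I3 (fun=> 0))%E.
  apply: ae_le_nnint => //; apply: filterS h => x /(_ I) /=.
  rewrite (j0E q0 m0 (f0 x)) => -[] /eqP; rewrite mulf_eq0 gt_eqF ?TF_cst_gt0//=.
  by move=> /eqP /powR_eq0_eq0 ->.
by rewrite fN /nnint integral0 lee_fin leNgt N0.
Qed.

Lemma int53E f : admissible (5 / 3) N f ->
  I3 (fun x => f x `^ (5 / 3)) = (T_of 0 f / TF_cst q m)%:E.
Proof.
move=> af; have [_ _ jE] := has_int_Kin p53 law0 af.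
have [f0 mf _ _] := (admissibleP N p53 f).1 af.
have c0 := TF_cst_gt0 q0 m0.
have mp : measurable_fun setT (fun x => f x `^ (5 / 3)).
  exact: (measurableT_comp (measurable_powR _) mf).
have : I3 (fun x => TF_cst q m * f x `^ (5 / 3)) = (T_of 0 f)%:E.
  by rewrite -jE; apply: eq_nnint => x; rewrite (j0E q0 m0 (f0 x)).
rewrite (nnintZ _ mp (fun=> powR_ge0 _ _) (ltW c0)).
have : (0 <= I3 (fun x => f x `^ (5 / 3)))%E by apply: nnint_ge0 => x; exact: powR_ge0.
case: (I3 _) => [a| |]// _.
  by rewrite -EFinM => -[<-]; rewrite mulrAC divff ?mul1r// gt_eqF.
by rewrite gt0_muley// lte_fin.
Qed.

Lemma le_classical nu t : 0 <= nu -> 0 <= t -> J nu t <= TF_cst q m * t `^ (5 / 3).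
Proof.
by move=> n0 t0; rewrite -(j0E q0 m0 t0); exact: (jnu_antitone q0 m0 t (lexx 0) n0).
Qed.

Lemma radius_c c rho Rad : 0 < c -> minimizer_c kappa q m c N rho ->
  symmetric_decreasing rho -> has_support_radius rho Rad ->
  0 < Rad /\ kappa * (N ^+ 2 / Rad) = 5 / 3 * P_of (c ^- 2) rho - T_of (c ^- 2) rho.
Proof.
move=> c0 min sym sR; have [M M0 rM] := minimizer_c_bounded c0 min.
have n0 : 0 < c ^- 2 by rewrite invr_gt0 exprn_gt0.
have law := relativistic_law q0 m0 n0.
have [adm rmin] := minimizer_c_min c0 min.
have hj t : 0 <= t -> J (c ^- 2) t <= TF_cst q m * t `^ (5 / 3) by exact: (le_classical (ltW n0)).
exact: (boundary_identity kappa0 N0 p43 M0 (ltW (TF_cst_gt0 q0 m0)) law coulomb_fin43 hj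
  adm rmin sym sR rM).
Qed.

Lemma radius_oo rho Rad : minimizer_oo kappa q m N rho ->
  symmetric_decreasing rho -> has_support_radius rho Rad ->
  0 < Rad /\ kappa * (N ^+ 2 / Rad) = 7 / 3 * T_of 0 rho.
Proof.
move=> min sym sR; have [M M0 rM] := minimizer_oo_bounded min.
have [adm rmin] := minimizer_oo_min min.
have hj t : 0 <= t -> J 0 t <= TF_cst q m * t `^ (5 / 3) by exact: (le_classical (lexx 0)).
have [Rp ->] := boundary_identity kappa0 N0 p53 M0 (ltW (TF_cst_gt0 q0 m0)) law0 coulomb_fin53 hj
  adm rmin sym sR rM.
split; first exact: Rp.
by rewrite (classical_virial adm); field.
Qed.

(** The minimal energy is monotone in [c]; the one-particle gaps have a sign. *)
Lemma comparison_ge0 c rho rho_oo : 0 < c -> minimizer_c kappa q m c N rho ->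
  minimizer_oo kappa q m N rho_oo ->
  [/\ admissible (5 / 3) N rho, T_of 0 rho_oo <= T_of 0 rho &
      7 / 3 * T_of 0 rho_oo <= 5 / 3 * P_of (c ^- 2) rho - T_of (c ^- 2) rho].
Proof.
move=> c0 min min_oo; have [M M0 rM] := minimizer_c_bounded c0 min.
have n0 : 0 < c ^- 2 by rewrite invr_gt0 exprn_gt0.
have a43 := (minimizer_c_min c0 min).1.
have a53 := bounded53 M0 a43 rM.
have [h1 _] := compare_energies c0 min min_oo a53.
have h2 := P_le_TJ n0 a53; have h3 := P_le_2T n0 a43.
split; first exact: a53.
- exact: (le_trans h1 (sub_arith h2)).
- exact: ge0_arith h1 h3.
Qed.

(** Uniformly bounded densities make the constants of the gaps independent of [c]. *)
Lemma comparison_two_sided rho_oo : minimizer_oo kappa q m N rho_oo ->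
  exists c0 K1 K2, [/\ 1 <= c0, 0 < K1, 0 < K2 & forall c rho, c0 <= c ->
    minimizer_c kappa q m c N rho ->
    (K1 * c ^- 2 <= T_of 0 rho - T_of 0 rho_oo <= K2 * c ^- 2) /\
    (K1 * c ^- 2 <= 5 / 3 * P_of (c ^- 2) rho - T_of (c ^- 2) rho - 7 / 3 * T_of 0 rho_oo
      <= K2 * c ^- 2)].
Proof.
move=> min_oo; have tau0 := T_oo_gt0 (minimizer_oo_min min_oo).1.
have [c0 [M [c01 M0 HM]]] := minimizer_c_unif_bounded.
have [C C0 HC] := gaps_upper_int M0.
have [C' C'0 HC'] := gaps_lower_int M0.
have kN : 0 < kin_cst q * N by exact: (mulr_gt0 (kin_cst_gt0 q0) N0).
pose dl := 2 * m * T_of 0 rho_oo / (kin_cst q * N).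
have mt : 0 < 2 * m * T_of 0 rho_oo by exact: (mulr_gt0 (mulr_gt0 (ltr0n R 2) m0) tau0).
have dl0 : 0 < dl by exact: divr_gt0.
pose E := C' * (dl * (2 * m * T_of 0 rho_oo)).
have E0 : 0 < E by exact: (mulr_gt0 C'0 (mulr_gt0 dl0 mt)).
exists c0, (2 / 3 * E), (14 / 3 * (C * N) + 1); split; first exact: c01.
- by apply: (mulr_gt0 _ E0); rewrite divr_gt0.
- have CN : 0 <= C * N by apply: (mulr_ge0 C0); exact: ltW.
  by apply: ltr_wpDl => //; apply: (mulr_ge0 _ CN); rewrite divr_ge0.
move=> c rho cc min; have cp : 0 < c := lt_le_trans (ltr01 : (0 : R) < 1) (le_trans c01 cc).
have rM := HM c rho cc min.
have a43 := (minimizer_c_min cp min).1.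
have a53 := bounded53 M0 a43 rM.
have n0 : 0 < c ^- 2 by rewrite invr_gt0 exprn_gt0.
have n1 : c ^- 2 <= 1.
  by rewrite invf_le1 ?exprn_gt0// exprn_ege1// (le_trans c01).
have n01 : 0 < c ^- 2 <= 1 by rewrite n0.
have [_ tau_le _] := comparison_ge0 cp min min_oo.
have [h1 h2] := compare_energies cp min min_oo a53.
have [u1 u2] := HC _ _ n0 a53 rM.
have [l1 l2] := HC' _ _ _ n01 (ltW dl0) a53 rM.
exact: (two_sided_arith m0 kN C'0 n0 tau0 u1 u2 (P_le_2T n0 a43) h2 (T_le_classical n0 a53)
  (P_le_TJ n0 a53) h1 tau_le l1 l2).
Qed.

End comparison.

(** * The rate of convergence as [c] tends to infinity *)
Lemma large_c (R : realType) (N Ns c : R) : 0 < Ns -> 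
  N `^ (2 / 3) < c * Ns `^ (2 / 3) -> 0 < c.
Proof.
move=> Ns0 h; have s0 : 0 < Ns `^ (2 / 3) by exact: powR_gt0.
by rewrite -(pmulr_lgt0 _ s0); apply: le_lt_trans h; exact: powR_ge0.
Qed.

Lemma near_large_c (R : realType) (N Ns c0 : R) : 0 < Ns ->
  \forall c \near +oo, c0 <= c /\ N `^ (2 / 3) < c * Ns `^ (2 / 3).
Proof.
move=> Ns0; have s0 : 0 < Ns `^ (2 / 3) by exact: powR_gt0.
exists (Num.max c0 (N `^ (2 / 3) / Ns `^ (2 / 3))); split; first exact: num_real.
move=> c; rewrite gt_max => /andP[h1 h2]; split; first exact: ltW.
by rewrite -ltr_pdivrMr.
Qed.

Theorem theorem1p3 (R : realType) (kappa q : R) (hkappa : 0 < kappa)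
    (hq : 1 <= q) (Nstar : R) (hNstar : optimal_constant kappa q Nstar)
    (m N : R) (hm : 0 < m) (hN : 0 < N) :
  (forall (rho : R -> 'R3 R -> R) (rho_oo : 'R3 R -> R),
     (forall c, N `^ (2 / 3) < c * Nstar `^ (2 / 3) ->
        minimizer_c kappa q m c N (rho c)) ->
     minimizer_oo kappa q m N rho_oo ->
     let d c := (\int[@leb3 R]_x (rho c x `^ (5 / 3))%:E
                 - \int[@leb3 R]_x (rho_oo x `^ (5 / 3))%:E)%E in
     (forall c, N `^ (2 / 3) < c * Nstar `^ (2 / 3) -> (0 <= d c < +oo)%E)
     /\ two_sided_O_inv_sqr d)
  /\
  (forall (rho : R -> 'R3 R -> R) (rho_oo : 'R3 R -> R)
          (Rad : R -> R) (Rad_oo : R),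
     (forall c, N `^ (2 / 3) < c * Nstar `^ (2 / 3) ->
        [/\ minimizer_c kappa q m c N (rho c),
            symmetric_decreasing (rho c)
          & has_support_radius (rho c) (Rad c)]) ->
     [/\ minimizer_oo kappa q m N rho_oo,
         symmetric_decreasing rho_oo
       & has_support_radius rho_oo Rad_oo] ->
     (forall c, N `^ (2 / 3) < c * Nstar `^ (2 / 3) -> 0 <= Rad_oo - Rad c)
     /\ two_sided_O_inv_sqr (fun c => (Rad_oo - Rad c)%:E)).
Proof.
have q0 : 0 < q := lt_le_trans (ltr01 : (0 : R) < 1) hq.
have [Ns0 interp _] := hNstar.
have T0 := TF_cst_gt0 q0 hm.
split.
- move=> rho rho_oo min min_oo d.
  have a_oo := (minimizer_oo_min hm min_oo).1.
  pose D c := (Kin (jnu q m 0) (rho c) - Kin (jnu q m 0) rho_oo) / TF_cst q m.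
  have dE c : N `^ (2 / 3) < c * Nstar `^ (2 / 3) -> d c = (D c)%:E.
    move=> hc; have c0 := large_c Ns0 hc.
    have [a53 _ _] := comparison_ge0 hkappa q0 hm hN Ns0 interp c0 (min c hc) min_oo.
    have e1 : (\int[@leb3 R]_x (rho c x `^ (5 / 3))%:E)%E = _ := int53E q0 hm a53.
    have e2 : (\int[@leb3 R]_x (rho_oo x `^ (5 / 3))%:E)%E = _ := int53E q0 hm a_oo.
    by rewrite /d e1 e2 -EFinB /D mulrBl.
  split.
    move=> c hc; have c0 := large_c Ns0 hc.
    have [_ le _] := comparison_ge0 hkappa q0 hm hN Ns0 interp c0 (min c hc) min_oo.
    rewrite (dE c hc) lee_fin ltry andbT; apply: divr_ge0; last exact: ltW.
    by rewrite subr_ge0.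
  have [c0 [K1 [K2 [c01 K10 K20 H]]]] :=
    comparison_two_sided hkappa q0 hm hN Ns0 interp min_oo.
  exists (K1 / TF_cst q m), (K2 / TF_cst q m).
  split; [exact: divr_gt0|exact: divr_gt0|].
  apply: filterS (near_large_c N c0 Ns0) => c [cc hc].
  have [/andP[h1 h2] _] := H c (rho c) cc (min c hc).
  rewrite (dE c hc) !lee_fin /D.
  by rewrite ![_ / TF_cst q m / _]mulrAC !(ler_pM2r (_ : 0 < (TF_cst q m)^-1)) ?invr_gt0// h1.
move=> rho rho_oo Rad Rad_oo min [min_oo sym_oo supp_oo].
have [Roo0 Eoo] := radius_oo hkappa q0 hm hN Ns0 interp min_oo sym_oo supp_oo.
have k0 : 0 < kappa * N ^+ 2 by rewrite mulr_gt0// exprn_gt0.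
have {}Eoo : kappa * N ^+ 2 / Rad_oo = 7 / 3 * Kin (jnu q m 0) rho_oo by rewrite -mulrA.
have radE c : N `^ (2 / 3) < c * Nstar `^ (2 / 3) -> 0 < Rad c /\ kappa * N ^+ 2 / Rad c =
    5 / 3 * Vir (vnu q m (c ^- 2)) (rho c) - Kin (jnu q m (c ^- 2)) (rho c).
  move=> hc; have c0 := large_c Ns0 hc; have [mc sc uc] := min c hc.
  by rewrite -mulrA; exact: (radius_c hkappa q0 hm hN Ns0 interp c0 mc sc uc).
split.
  move=> c hc; have c0 := large_c Ns0 hc; have [mc sc uc] := min c hc.
  have [Rc0 Ec] := radE c hc.
  have [_ _ le] := comparison_ge0 hkappa q0 hm hN Ns0 interp c0 mc min_oo.
  move: le; rewrite -Eoo -Ec ler_pM2l// lef_pV2 ?posrE// => le.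
  by rewrite subr_ge0.
have [c0 [K1 [K2 [c01 K10 K20 H]]]] :=
  comparison_two_sided hkappa q0 hm hN Ns0 interp min_oo.
pose x2 := 7 / 3 * Kin (jnu q m 0) rho_oo.
have x20 : 0 < x2 by rewrite /x2 -Eoo divr_gt0.
exists (kappa * N ^+ 2 * K1 / (x2 * (x2 + K2))), (kappa * N ^+ 2 * K2 / x2 ^+ 2); split.
- exact: (divr_gt0 (mulr_gt0 k0 K10) (mulr_gt0 x20 (addr_gt0 x20 K20))).
- exact: (divr_gt0 (mulr_gt0 k0 K20) (exprn_gt0 2 x20)).
apply: filterS (near_large_c N c0 Ns0) => c [cc hc].
have [Rc0 Ec] := radE c hc; have [mc _ _] := min c hc.
have [_ h] := H c (rho c) cc mc; rewrite !lee_fin.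
have n01 : 0 <= c ^- 2 <= 1.
  have cp : 1 <= c by exact: le_trans cc.
  by rewrite invr_ge0 sqr_ge0 invf_le1 ?exprn_ege1// exprn_gt0// (lt_le_trans ltr01).
exact: (radius_arith k0 Rc0 Roo0 Ec Eoo (ltW K10) (ltW K20) n01 h).
Qed.
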